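(* Let $k$ be a field of characteristic $p>0$ containing a primitive $l'$-th root of unity $\varepsilon$, and assume that $l'=l\ge3$ is odd and $n\ge r$. Let $\mathtt F_r:K(\tilde u_k(n,r))\to K(\mathcal H_r)$ be the homomorphism of Grothendieck groups induced by the baby Schur functor $V\mapsto\mathtt k_\omega V$. Then $\mathtt F_r$ is surjective and $\ker(\mathtt F_r)=K(\tilde u_k(n,r-l))$, where $K(\tilde u_k(n,r-l))$ is viewed as a subgroup of $K(\tilde u_k(n,r))$ via inflation along the baby transfer map $\rho_{r,r-l}:\tilde u_k(n,r)\to\tilde u_k(n,r-l)$ (and is $0$ if $r<l$).
   Context: Modules are finite dimensional left modules; $K(A)$ is the Grothendieck group of the category of finite dimensional $A$-modules. $\mathbb N=\{0,1,2,\dots\}$, $\upsilon$ is an indeterminate, $\mathcal Z=\mathbb Z[\upsilon,\upsilon^{-1}]$, and $k$ is a $\mathcal Z$-algebra via $\upsilon\mapsto\varepsilon$. $[m]=\frac{\upsilon^m-\upsilon^{-m}}{\upsilon-\upsilon^{-1}}$, $[m]!=[1]\cdots[m]$. Quantum $\mathfrak{gl}_n$: $\mathbf U(n)$ is the $\mathbb Q(\upsilon)$-algebra with generators $E_i,F_i$ ($1\le i\le n-1$), $K_j^{\pm1}$ ($1\le j\le n$) and relations $K_iK_j=K_jK_i$, $K_iK_i^{-1}=1$; $K_iE_j=\upsilon^{\delta_{i,j}-\delta_{i,j+1}}E_jK_i$; $K_iF_j=\upsilon^{-\delta_{i,j}+\delta_{i,j+1}}F_jK_i$; $E_iF_j-F_jE_i=\delta_{ij}\frac{\tilde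 K_i-\tilde K_i^{-1}}{\upsilon-\upsilon^{-1}}$ with $\tilde K_i=K_iK_{i+1}^{-1}$; $E_iE_j=E_jE_i$, $F_iF_j=F_jF_i$ if $|i-j|>1$; $E_i^2E_j-(\upsilon+\upsilon^{-1})E_iE_jE_i+E_jE_i^2=0$ and likewise for the $F$'s if $|i-j|=1$. $U_{\mathcal Z}(n)$ is its $\mathcal Z$-subalgebra generated by all $E_i^{(m)}=E_i^m/[m]!$, $F_i^{(m)}=F_i^m/[m]!$, $K_j^{\pm1}$ and $\left[{K_j;0\atop t}\right]=\prod_{s=1}^t\frac{K_j\upsilon^{1-s}-K_j^{-1}\upsilon^{s-1}}{\upsilon^s-\upsilon^{-s}}$ ($m,t\in\mathbb N$). $U_k(n)=U_{\mathcal Z}(n)\otimes_{\mathcal Z}k$, and $\tilde u_k(n)$ is the $k$-subalgebra of $U_k(n)$ generated by all $E_i,F_i,K_j^{\pm1}$. $q$-Schur algebras: for a commutative ring $R$ and $q^{1/2}\in R$, $A_q(n)$ is the $R$-algebra generated by $c_{ij}$ ($1\le i,j\le n$) with relations $c_{ij}c_{im}=c_{im}c_{ij}$ for all $i,j,m$; $c_{ij}c_{rs}=qc_{rs}c_{ij}$ for $i>r$, $j\le s$; $c_{ij}c_{rs}=(q-1)c_{rj}c_{is}+c_{rs}c_{ij}$ for $i>r$, $j>s$. It is a bialgebra with $\Delta(c_{ij})=\sum_tc_{it}\otimes c_{tj}$, counit $c_{ij}\mapsto\delta_{ij}$. Its degree $r$ part $A_q(n,r)$ is a subcoalgebra, and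 $U_R(n,r)=A_q(n,r)^*$ is the $q$-Schur algebra. Let $\Xi(n,r)$ be the set of $n\times n$ matrices over $\mathbb N$ with entry sum $r$; $\{\xi_A\}_{A\in\Xi(n,r)}$ is the basis dual to the monomials $c^A=c_{11}^{a_{11}}c_{21}^{a_{21}}\cdots c_{n1}^{a_{n1}}c_{12}^{a_{12}}\cdots c_{nn}^{a_{nn}}$, and $[A]=q^{-d_A/2}\xi_A$ with $d_A=-\sum_{i<s,j>t}a_{ij}a_{st}+\sum_{j>t}a_{ij}a_{it}$. Write $\mathbf U(n,r)=U_{\mathbb Q(\upsilon)}(n,r)$ and $U_{\mathcal Z}(n,r)$ for $q^{1/2}=\upsilon$, and $U_k(n,r)\cong U_{\mathcal Z}(n,r)\otimes_{\mathcal Z}k$ for $q^{1/2}=\varepsilon$. For a matrix $A$ over $\mathbb N$ with zero diagonal and $\mathbf j\in\mathbb Z^n$ put $A(\mathbf j,r)=\sum_D\upsilon^{\sum_id_ij_i}[A+D]$, over diagonal $D=\mathrm{diag}(d_1,\dots,d_n)$ over $\mathbb N$ with $A+D\in\Xi(n,r)$. There is an algebra epimorphism $\zeta_r:\mathbf U(n)\to\mathbf U(n,r)$ with $E_h\mapsto E_{h,h+1}(\mathbf 0,r)$, $F_h\mapsto E_{h+1,h}(\mathbf 0,r)$ ($E_{i,j}$ matrix units), $K_1^{j_1}\cdots K_n^{j_n}\mapsto 0(\mathbf j,r)$, mapping $U_{\mathcal Z}(n)$ onto $U_{\mathcal Z}(n,r)$; base change gives $\zeta_r:U_k(n)\to U_k(n,r)$.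 The little $q$-Schur algebra is $\tilde u_k(n,r)=\zeta_r(\tilde u_k(n))$, generated by $\mathtt e_i=\zeta_r(E_i)$, $\mathtt f_i=\zeta_r(F_i)$, $\mathtt k_j=\zeta_r(K_j)$. The baby transfer map $\rho_{r,r-l}:\tilde u_k(n,r)\to\tilde u_k(n,r-l)$ (for $l'=l$, $r\ge l$) is the algebra epimorphism sending the generators $\mathtt e_i,\mathtt f_i,\mathtt k_j$ of $\tilde u_k(n,r)$ to the corresponding generators of $\tilde u_k(n,r-l)$. For $n\ge r$ let $\omega=(1^r,0^{n-r})$ and $\mathtt k_\omega=\zeta_r\big(\prod_i\left[{K_i;0\atop\omega_i}\right]\big)$, an idempotent which lies in $\tilde u_k(n,r)$. The algebra $\mathtt k_\omega\tilde u_k(n,r)\mathtt k_\omega$ is isomorphic to the Hecke algebra of the symmetric group $\mathfrak S_r$ over $k$ with parameter $q=\varepsilon^2$, and is denoted $\mathcal H_r$. The baby Schur functor sends a $\tilde u_k(n,r)$-module $V$ to the $\mathcal H_r$-module $\mathtt k_\omega V$; it is exact. *)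

(* Defs.v *)
From HB Require Import structures.
From mathcomp Require Import all_boot all_order all_algebra.
From mathcomp Require Import boolp classical_sets.
From mathcomp Require Import freeg.
Set Implicit Arguments. Unset Strict Implicit. Unset Printing Implicit Defensive.
Import Order.TTheory GRing.Theory Num.Theory.
Local Open Scope ring_scope.

Section Modules.
Variables (k : fieldType) (A : algType k).

(* A finite dimensional left module, up to isomorphism: the space 'cV[k]_d of
   column vectors, on which a acts as left multiplication by [mact a]. *)
Record fdmod := FdMod {
  mdim : nat;
  mact : {linear A -> 'M[k]_mdim};
  mact1 : mact 1 = 1%:M;
  mactM : forall a b, mact (a * b) = mact a *m mact b }.

Definition modhom (U V : fdmod) (f : 'M[k]_(mdim V, mdim U)) : Prop :=
  forall a : A, f *m mact U a = mact V a *m f.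

(* 0 -> U -f-> V -g-> W -> 0 is exact. *)
Definition ses (U V W : fdmod) : Prop :=
  exists (f : 'M[k]_(mdim V, mdim U)) (g : 'M[k]_(mdim W, mdim V)),
    [/\ modhom f, modhom g,
        forall u : 'cV_(mdim U), f *m u = 0 -> u = 0,
        forall w : 'cV_(mdim W), exists v, g *m v = w
      & forall v : 'cV_(mdim V), g *m v = 0 <-> exists u, v = f *m u].

HB.instance Definition _ := gen_eqMixin fdmod.
HB.instance Definition _ := gen_choiceMixin fdmod.

(* The subgroup of the free abelian group on all modules generated by the
   [V] - [U] - [W], for 0 -> U -> V -> W -> 0 exact.  Isomorphic modules are
   identified in the quotient: take U = 0. *)
Inductive ses_span : {freeg fdmod / int} -> Prop :=
| ses_span_ses U V W of ses U V W : ses_span (<< V >> - << U >> - << W >>)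
| ses_span0 : ses_span 0
| ses_spanB x y of ses_span x & ses_span y : ses_span (x - y).

Definition K0_rel : {pred {freeg fdmod / int}} := fun x => `[< ses_span x >].

Lemma K0_rel_zmod_closed : zmod_closed K0_rel.
Proof.
split; first exact/asboolP/ses_span0.
by move=> x y /asboolP sx /asboolP sy; apply/asboolP/ses_spanB.
Qed.
HB.instance Definition _ := GRing.isZmodClosed.Build _ K0_rel K0_rel_zmod_closed.

Definition K0 : zmodType := Quotient.quot K0_rel.
Definition K0_class (V : fdmod) : K0 := (\pi_(Quotient.quot K0_rel) << V >>)%qT.

Lemma K0_ses U V W : ses U V W -> K0_class V = K0_class U + K0_class W.
Proof.
move=> h; rewrite /K0_class -raddfD /=; apply/eqP.
rewrite -Quotient.idealrBE opprD addrA.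
exact/asboolP/ses_span_ses.
Qed.
End Modules.

Section Functoriality.
Variables (k : fieldType) (A B : algType k).

(* An exact functor, through its action on objects. *)
Record exactmap := ExactMap {
  emap :> fdmod A -> fdmod B;
  emap_ses : forall U V W, ses U V W -> ses (emap U) (emap V) (emap W) }.

Variable G : exactmap.

Let lift : {freeg (fdmod A) / int} -> zmodule (K0 B) := fglift (fun V => K0_class (G V) : zmodule (K0 B)).

Let liftB x y : lift (x - y) = lift x - lift y.
Proof. exact: lift_is_additive. Qed.

Let liftU V : lift << V >> = K0_class (G V).
Proof. by rewrite /lift liftU scale1r. Qed.

Let lift_rel x : ses_span x -> lift x = 0.
Proof.
elim=> [U V W h||x1 y _ h1 _ h2].
- rewrite !liftB !liftU (K0_ses (emap_ses G h)).
  by rewrite (addrC (K0_class (G U))) addrK subrr.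
- by rewrite -(subr0 0) liftB subrr.
- by rewrite liftB h1 h2 subr0.
Qed.

Definition K0_map (x : K0 A) : K0 B := lift (repr x).

Lemma K0_map_class V : K0_map (K0_class V) = K0_class (G V).
Proof.
rewrite -liftU /K0_map; apply/eqP; rewrite -subr_eq0 -liftB.
apply/eqP/lift_rel/asboolP; rewrite -[X in is_true X]/(_ \in @K0_rel k A).
by rewrite Quotient.idealrBE reprK.
Qed.

Lemma K0_map_is_zmod_morphism : zmod_morphism K0_map.
Proof.
move=> x y; apply/eqP; rewrite -subr_eq0; apply/eqP.
rewrite -[_ - _](_ : lift (repr (x - y) - (repr x - repr y)) = _); last first.
  by rewrite liftB (liftB (repr x)).
apply/lift_rel/asboolP; rewrite -[X in is_true X]/(_ \in @K0_rel k A).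
by rewrite Quotient.idealrBE reprK raddfB /= !reprK.
Qed.
HB.instance Definition _ := GRing.isZmodMorphism.Build (K0 A) (K0 B) K0_map K0_map_is_zmod_morphism.
End Functoriality.

Section Inflation.
Variables (k : fieldType) (A B : algType k) (rho : {lrmorphism A -> B}).

Fact infl_act1 (V : fdmod B) : (mact V \o rho) 1 = 1%:M.
Proof. by rewrite /= rmorph1 mact1. Qed.
Fact infl_actM (V : fdmod B) a b :
  (mact V \o rho) (a * b) = (mact V \o rho) a *m (mact V \o rho) b.
Proof. by rewrite /= rmorphM mactM. Qed.

(* B-modules viewed as A-modules via rho. *)
Definition infl (V : fdmod B) : fdmod A :=
  @FdMod k A (mdim V) (mact V \o rho) (infl_act1 V) (infl_actM V).

Lemma infl_ses U V W : ses U V W -> ses (infl U) (infl V) (infl W).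
Proof.
case=> f [g [hf hg fi gs fg]]; exists f, g; split=> //.
- by move=> a; rewrite /= hf.
- by move=> a; rewrite /= hg.
Qed.

Definition K0_infl : {additive K0 B -> K0 A} := K0_map (ExactMap infl_ses).
End Inflation.

Section Corner.
Variables (k : fieldType) (A : algType k).

Record idempotent := Idempotent {
  ival : A;
  ival_id : ival * ival = ival;
  ival_neq0 : ival != 0 }.

Variable e : idempotent.
Local Notation e0 := (ival e).

(* The algebra e A e = {x | e x e = x}, whose unit is e. *)
Definition corner_pred : {pred A} := fun x => e0 * x * e0 == x.
Definition corner := {x : A | x \in corner_pred}.

Lemma corner_submod_closed : submod_closed corner_pred.
Proof.
split; rewrite ?unfold_in ?mulr0 ?mul0r // => c x y.
rewrite !unfold_in => /eqP hx /eqP hy.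
by rewrite mulrDr mulrDl -scalerAr -scalerAl hx hy.
Qed.
HB.instance Definition _ := GRing.isSubmodClosed.Build k A corner_pred corner_submod_closed.
HB.instance Definition _ := SubChoice.on corner.
HB.instance Definition _ := [SubChoice_isSubLmodule of corner by <:].

Fact corner1_subproof : e0 \in corner_pred.
Proof. by rewrite unfold_in !ival_id. Qed.
Fact cornerM_subproof (x y : corner) : val x * val y \in corner_pred.
Proof.
case: x y => [x hx] [y hy] /=; rewrite unfold_in.
rewrite !unfold_in in hx hy; rewrite -(eqP hx) -(eqP hy).
by rewrite !mulrA !ival_id -!mulrA !ival_id.
Qed.
Lemma corner_mull (x : corner) : e0 * val x = val x.
Proof. by case: x => x /= /eqP <-; rewrite !mulrA ival_id. Qed.
Lemma corner_mulr (x : corner) : val x * e0 = val x.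
Proof. by case: x => x /= /eqP <-; rewrite -!mulrA ival_id. Qed.

Definition corner1 : corner :=
  exist (fun z => z \in corner_pred) e0 corner1_subproof.
Definition corner_mul (x y : corner) : corner :=
  exist (fun z => z \in corner_pred) _ (cornerM_subproof x y).

Fact corner_mulA : associative corner_mul.
Proof. by move=> x y z; apply/val_inj; rewrite /= mulrA. Qed.
Fact corner_mul1x : left_id corner1 corner_mul.
Proof. by move=> x; apply/val_inj; rewrite /= corner_mull. Qed.
Fact corner_mulx1 : right_id corner1 corner_mul.
Proof. by move=> x; apply/val_inj; rewrite /= corner_mulr. Qed.
Fact corner_mulDl : left_distributive corner_mul +%R.
Proof. by move=> x y z; apply/val_inj; rewrite /= mulrDl. Qed.
Fact corner_mulDr : right_distributive corner_mul +%R.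
Proof. by move=> x y z; apply/val_inj; rewrite /= mulrDr. Qed.
Fact corner_1neq0 : corner1 != 0.
Proof. by rewrite -val_eqE /= ival_neq0. Qed.
HB.instance Definition _ := GRing.Zmodule_isNzRing.Build corner
  corner_mulA corner_mul1x corner_mulx1 corner_mulDl corner_mulDr corner_1neq0.
Fact corner_scaleAl (c : k) (x y : corner) : c *: (x * y) = (c *: x) * y.
Proof. by apply/val_inj; rewrite /= scalerAl. Qed.
Fact corner_scaleAr (c : k) (x y : corner) : c *: (x * y) = x * (c *: y).
Proof. by apply/val_inj; rewrite /= scalerAr. Qed.
HB.instance Definition _ := GRing.Lmodule_isLalgebra.Build k corner corner_scaleAl.
HB.instance Definition _ := GRing.Lalgebra_isAlgebra.Build k corner corner_scaleAr.

Section CornerModule.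
Variable V : fdmod A.
Let P := mact V e0.

(* [col_base P] is a basis of e V = im P and [row_base P] maps a vector v to the
   coordinates of P v in this basis: this is the action of e A e on e V. *)
Definition corner_act (x : corner) : 'M[k]_(\rank P) :=
  row_base P *m mact V (val x) *m col_base P.

Lemma row_col_base : row_base P *m col_base P = 1%:M.
Proof.
have PP : P *m P = P by rewrite -mactM ival_id.
have h : col_base P *m (row_base P *m col_base P) *m row_base P
   = col_base P *m 1%:M *m row_base P.
  by rewrite mulmx1 mulmx_base mulmxA mulmx_base -mulmxA mulmx_base.
exact: (row_full_inj (col_base_full P)) (row_free_inj (row_base_free P) h).
Qed.

Lemma corner_act_is_linear : linear corner_act.
Proof.
by move=> c x y; rewrite /corner_act /= linearP /= mulmxDr mulmxDl -scalemxAr -scalemxAl.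
Qed.
HB.instance Definition _ := GRing.isLinear.Build k corner 'M[k]_(\rank P) _
  corner_act corner_act_is_linear.

Fact corner_act1 : corner_act 1 = 1%:M.
Proof.
have RP : row_base P *m P = row_base P.
  by rewrite -[X in _ *m X](mulmx_base P) mulmxA row_col_base mul1mx.
by rewrite /corner_act /= -/P RP row_col_base.
Qed.
Fact corner_actM x y : corner_act (x * y) = corner_act x *m corner_act y.
Proof.
rewrite /corner_act /= -{1}[val y]corner_mull !mactM -/P.
move: (row_base P) (col_base P) (mulmx_base P) => R C CR.
by rewrite !mulmxA -(mulmxA _ C R) CR.
Qed.

(* The module e V over e A e. *)
Definition schur : fdmod corner := FdMod corner_act1 corner_actM.
End CornerModule.

Lemma schur_ses U V W : ses U V W -> ses (schur U) (schur V) (schur W).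
Proof.
pose C X := col_base (mact X e0); pose R X := row_base (mact X e0).
have CR X : C X *m R X = mact X e0 by exact: mulmx_base.
have RC X : R X *m C X = 1%:M by exact: row_col_base.
have PC X : mact X e0 *m C X = C X by have /= <- := congr1 (mulmx^~ (C X)) (CR X); rewrite -mulmxA RC mulmx1.
have RP X : R X *m mact X e0 = R X by have /= <- := congr1 (mulmx (R X)) (CR X); rewrite mulmxA RC mul1mx.
have actE X x : corner_act X x = R X *m mact X (val x) *m C X by [].
clearbody C R.
have Cact X x : C X *m corner_act X x = mact X (val x) *m C X.
  by rewrite actE !mulmxA CR -mactM corner_mull.
have Ract X x : corner_act X x *m R X = R X *m mact X (val x).
  by rewrite actE -!mulmxA CR -mactM corner_mulr.
have ker0 X m (u : 'M_(_, m)) : C X *m u = 0 -> u = 0.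
  by move=> h; rewrite -[u]mul1mx -(RC X) -mulmxA h mulmx0.
case=> f [g [hf hg fi gs fg]].
pose f' := R V *m f *m C U; pose g' := R W *m g *m C V.
have Cf : C V *m f' = f *m C U by rewrite !mulmxA CR -hf -mulmxA PC.
have Cg : C W *m g' = g *m C V by rewrite !mulmxA CR -hg -mulmxA PC.
exists f', g'; split => /=.
- by move=> x; rewrite -mulmxA Cact mulmxA -(mulmxA _ f) hf !mulmxA -Ract.
- by move=> x; rewrite -mulmxA Cact mulmxA -(mulmxA _ g) hg !mulmxA -Ract.
- move=> u /(congr1 (mulmx (C V))); rewrite mulmx0 (mulmxA (C V) f') Cf -mulmxA => /fi.
  exact: ker0.
- move=> w; have [v hv] := gs (C W *m w); exists (R V *m v).
  apply/eqP; rewrite -subr_eq0; apply/eqP; apply: (ker0 W).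
  rewrite mulmxBr (mulmxA (C W) g') Cg -!mulmxA (mulmxA (C V)) CR mulmxA hg -mulmxA hv.
  by rewrite mulmxA PC subrr.
- move=> v; split=> [/(congr1 (mulmx (C W)))|[u ->]].
    rewrite mulmx0 (mulmxA (C W) g') Cg -mulmxA => /fg [u hu]; exists (R U *m u).
    rewrite -[v]mul1mx -RC -mulmxA hu /f' -!mulmxA (mulmxA (C U)) CR.
    by rewrite (mulmxA f) hf !mulmxA RP.
  apply: (ker0 W); rewrite (mulmxA (C W) g') Cg -mulmxA (mulmxA (C V) f') Cf -mulmxA.
  by apply/fg; exists (C U *m u).
Qed.

Definition K0_schur : {additive K0 A -> K0 corner} := K0_map (ExactMap schur_ses).
End Corner.

(* The monomials of degree r in the letters c_ij are the r-tuples of pairs (i, j)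
   of elements of 'I_n.+1: everywhere below n.+1 stands for the size (>= 1) of
   the matrices, and indices start from 0. *)
Section WordDual.
Variables (k : fieldType) (n r : nat).

Definition letter : Type := ('I_n.+1 * 'I_n.+1)%type.
Definition windex : Type := (r.-tuple 'I_n.+1)%type.
Definition word (i j : windex) : r.-tuple letter := [tuple of zip i j].
Definition rows (w : r.-tuple letter) : windex := [tuple of unzip1 w].
Definition cols (w : r.-tuple letter) : windex := [tuple of unzip2 w].

(* The linear dual of the degree r part of the free algebra k<c_ij>; a functional
   is given by its values on words.  Its product is the convolution product for
   Delta(c_ij) = sum_t c_it (x) c_tj, and its unit is the counit.  The q-Schur
   algebra A_q(n.+1, r)^* is the set [in_qschur] of all functionals that vanish
   on the degree r part of the ideal of relations of A_q(n.+1). *)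
Definition wdual : Type := {ffun r.-tuple letter -> k^o}.

HB.instance Definition _ := GRing.Lmodule.on wdual.

Definition wd_one : wdual := [ffun w => (rows w == cols w)%:R].
Definition wd_mul (f g : wdual) : wdual :=
  [ffun w => \sum_(t : windex) f (word (rows w) t) * g (word t (cols w))].

Lemma rows_word i j : rows (word i j) = i.
Proof. by apply/val_inj; rewrite /= unzip1_zip ?size_tuple. Qed.
Lemma cols_word i j : cols (word i j) = j.
Proof. by apply/val_inj; rewrite /= unzip2_zip ?size_tuple. Qed.
Lemma wordK w : word (rows w) (cols w) = w.
Proof. by apply/val_inj; rewrite /= zip_unzip. Qed.

Fact wd_mulA : associative wd_mul.
Proof.
move=> f g h; apply/ffunP => w; rewrite !ffunE.
under eq_bigr do rewrite ffunE big_distrr /=.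
under [RHS]eq_bigr do rewrite ffunE big_distrl /=.
rewrite exchange_big /=; apply: eq_bigr => t _; apply: eq_bigr => u _.
by rewrite !rows_word !cols_word mulrA.
Qed.
Fact wd_mul1x : left_id wd_one wd_mul.
Proof.
move=> f; apply/ffunP => w; rewrite !ffunE (bigD1 (rows w)) //= !ffunE.
rewrite rows_word cols_word eqxx mul1r wordK big1 ?addr0 // => t ht.
by rewrite ffunE rows_word cols_word eq_sym (negPf ht) mul0r.
Qed.
Fact wd_mulx1 : right_id wd_one wd_mul.
Proof.
move=> f; apply/ffunP => w; rewrite !ffunE (bigD1 (cols w)) //= !ffunE.
rewrite rows_word cols_word eqxx mulr1 wordK big1 ?addr0 // => t ht.
by rewrite ffunE rows_word cols_word (negPf ht) mulr0.
Qed.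
Fact wd_mulDl : left_distributive wd_mul +%R.
Proof.
move=> f g h; apply/ffunP => w; rewrite !ffunE -big_split /=.
by apply: eq_bigr => t _; rewrite !ffunE mulrDl.
Qed.
Fact wd_mulDr : right_distributive wd_mul +%R.
Proof.
move=> f g h; apply/ffunP => w; rewrite !ffunE -big_split /=.
by apply: eq_bigr => t _; rewrite !ffunE mulrDr.
Qed.
Fact wd_1neq0 : wd_one != 0.
Proof.
apply/eqP => /ffunP /(_ (word (nseq_tuple r ord0) (nseq_tuple r ord0))).
by rewrite !ffunE rows_word cols_word eqxx => /eqP; rewrite oner_eq0.
Qed.
HB.instance Definition _ := GRing.Zmodule_isNzRing.Build wdual
  wd_mulA wd_mul1x wd_mulx1 wd_mulDl wd_mulDr wd_1neq0.
Fact wd_scaleAl (c : k) (f g : wdual) : c *: (f * g) = (c *: f) * g.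
Proof.
apply/ffunP => w; rewrite !ffunE scaler_sumr.
by apply: eq_bigr => t _; rewrite !ffunE scalerAl.
Qed.
Fact wd_scaleAr (c : k) (f g : wdual) : c *: (f * g) = f * (c *: g).
Proof.
apply/ffunP => w; rewrite !ffunE scaler_sumr.
by apply: eq_bigr => t _; rewrite !ffunE scalerAr.
Qed.
HB.instance Definition _ := GRing.Lmodule_isLalgebra.Build k wdual wd_scaleAl.
HB.instance Definition _ := GRing.Lalgebra_isAlgebra.Build k wdual wd_scaleAr.

(* The value of f on an arbitrary word, f being extended by 0 outside degree r. *)
Definition weval (f : wdual) (s : seq letter) : k :=
  if insub s is Some w then f w else 0.

End WordDual.

(* eps is the square root of q. *)
Section QSchur.
Variables (k : fieldType) (eps : k) (n r : nat).
Local Notation wdual := (wdual k n r).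
Local Notation letter := (letter n).
Local Notation q := (eps ^+ 2).

Definition in_qschur (f : wdual) : Prop :=
  forall u v : seq letter,
  [/\ forall i j m : 'I_n.+1,
        weval f (u ++ [:: (i, j); (i, m)] ++ v) = weval f (u ++ [:: (i, m); (i, j)] ++ v),
      forall i j a b : 'I_n.+1, (a < i)%N -> (j <= b)%N ->
        weval f (u ++ [:: (i, j); (a, b)] ++ v)
          = q * weval f (u ++ [:: (a, b); (i, j)] ++ v)
    & forall i j a b : 'I_n.+1, (a < i)%N -> (b < j)%N ->
        weval f (u ++ [:: (i, j); (a, b)] ++ v)
          = (q - 1) * weval f (u ++ [:: (a, j); (i, b)] ++ v)
            + weval f (u ++ [:: (a, b); (i, j)] ++ v)].

Definition Xi : pred 'M[nat]_n.+1 := fun A => (\sum_i \sum_j A i j)%N == r.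

Definition monomial (A : 'M[nat]_n.+1) : seq letter :=
  flatten [seq nseq (A i j) (i, j) | j <- enum 'I_n.+1, i <- enum 'I_n.+1].

(* The basis of A_q(n.+1, r)^* dual to the monomials c^A: as these form a basis of
   the degree r part of A_q(n.+1), exactly one f has this property and the
   default value 0 of [xget] is not used. *)
Definition xi (A : 'M[nat]_n.+1) : wdual :=
  xget 0 [set f : wdual | in_qschur f /\
                  forall B, Xi B -> weval f (monomial B) = (B == A)%:R]%classic.

Definition dexp (A : 'M[nat]_n.+1) : int :=
  - (\sum_(i < n.+1) \sum_(j < n.+1) \sum_(s < n.+1 | (i < s)%N)
       \sum_(t < n.+1 | (t < j)%N) A i j * A s t)%N%:Z
  + (\sum_(i < n.+1) \sum_(j < n.+1) \sum_(t < n.+1 | (t < j)%N)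
       A i j * A i t)%N%:Z.

(* [A] = q^(-d_A/2) xi_A *)
Definition stdbasis (A : 'M[nat]_n.+1) : wdual := eps ^ (- dexp A) *: xi A.

(* A(jj, r).  A diagonal matrix D over nat such that A + D has sum r has all its
   entries at most r, so nothing is lost by taking them in 'I_r.+1. *)
Definition blm (A : 'M[nat]_n.+1) (jj : 'I_n.+1 -> int) : wdual :=
  \sum_(D : {ffun 'I_n.+1 -> 'I_r.+1} | Xi (A + diag_mx (\row_i (D i : nat))))
    eps ^ (\sum_i (D i)%:Z * jj i) *: stdbasis (A + diag_mx (\row_i (D i : nat))).

End QSchur.
Arguments blm {k} eps {n} r A jj.

Section Basis.
Variables (k : fieldType) (eps : k) (n r : nat).
Local Notation wdual := (wdual k n r).
Local Notation letter := (letter n).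
Local Notation q := (eps ^+ 2).

Lemma weval_tuple (f : wdual) (w : r.-tuple letter) : weval f w = f w.
Proof. by rewrite /weval valK. Qed.

Lemma weval_size (f : wdual) s : size s != r -> weval f s = 0.
Proof. by move=> h; rewrite /weval insubN. Qed.

Lemma wevalB (f g : wdual) s : weval (f - g) s = weval f s - weval g s.
Proof. by rewrite /weval; case: insubP => [w _ _|_]; rewrite ?ffunE ?subr0. Qed.

Lemma in_qschurB (f g : wdual) :
  in_qschur eps f -> in_qschur eps g -> in_qschur eps (f - g).
Proof.
move=> hf hg u v; have [f1 f2 f3] := hf u v; have [g1 g2 g3] := hg u v.
split=> [i j m|i j a b h1 h2|i j a b h1 h2]; rewrite !wevalB.
- by rewrite f1 g1.
- by rewrite f2 // g2 // mulrBr.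
- by rewrite f3 // g3 // mulrBr opprD addrACA.
Qed.

Lemma count_monomial (p : pred letter) (A : 'M[nat]_n.+1) :
  count p (monomial A) = (\sum_j \sum_i p (i, j) * A i j)%N.
Proof.
rewrite /monomial count_flatten sumnE big_map big_allpairs_dep !enumT.
by apply: eq_bigr => j _; apply: eq_bigr => i _; rewrite count_nseq.
Qed.

Lemma size_monomial (A : 'M[nat]_n.+1) : Xi r A -> size (monomial A) = r.
Proof.
move=> /eqP <-; rewrite -count_predT count_monomial exchange_big /=.
by apply: eq_bigr => i _; apply: eq_bigr => j _; rewrite mul1n.
Qed.

Lemma count_mem_monomial i j (A : 'M[nat]_n.+1) :
  count_mem (i, j) (monomial A) = A i j.
Proof.
rewrite count_monomial (bigD1 j) //= (bigD1 i) //= eqxx mul1n.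
rewrite big1 ?addn0 => [|a /negPf ha]; last by rewrite xpair_eqE ha.
rewrite big1 ?addn0 // => b /negPf hb.
by rewrite big1 // => a _; rewrite xpair_eqE hb andbF.
Qed.

Let key (x : letter) : nat := (x.2 * n.+1 + x.1)%N.
Let kle (x y : letter) : bool := (key x <= key y)%N.

Let key_inj : injective key.
Proof.
move=> [i j] [a b] /eqP; rewrite /key /= => h.
have hj : j = b.
  apply/val_inj; move: h => /eqP /(congr1 (divn^~ n.+1)).
  by rewrite !divnMDl // !divn_small // !addn0.
by move: h; rewrite hj eqn_add2l => /eqP /val_inj ->.
Qed.

Let sorted_monomial (A : 'M[nat]_n.+1) : sorted kle (monomial A).
Proof.
apply: pairwise_sorted; rewrite /monomial.
have hf (s : seq letter) : pairwise kle s ->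
    pairwise kle (flatten [seq nseq (A x.1 x.2) x | x <- s]).
  elim: s => //= x s IH /andP [hx hs]; rewrite pairwise_cat IH // andbT.
  apply/andP; split; last first.
    by elim: (A _ _) => //= m ->; rewrite andbT all_nseq /kle leqnn orbT.
  apply/allrelP => y z; rewrite mem_nseq => /andP [_ /eqP ->].
  move=> /flattenP [t /mapP [w hw ->]]; rewrite mem_nseq => /andP [_ /eqP ->].
  exact: (allP hx).
have := hf [seq (i, j) | j <- enum 'I_n.+1, i <- enum 'I_n.+1].
rewrite map_allpairs; apply.
have hp : pairwise (fun i j : 'I_n.+1 => (i < j)%N) (enum 'I_n.+1).
  rewrite -(pairwise_map (@nat_of_ord _) ltn) val_enum_ord -sorted_pairwise.
    exact: iota_ltn_sorted.
  exact: ltn_trans.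
have hi j : pairwise kle [seq (i, j) | i <- enum 'I_n.+1].
  rewrite pairwise_map; apply: sub_pairwise hp => i i' /= h.
  by rewrite /kle /key /= leq_add2l ltnW.
elim: {1 3}(enum 'I_n.+1) hp => //= j s IH /andP [hj hs].
rewrite pairwise_cat IH // hi !andbT.
apply/allrelP => y z /mapP [i _ ->] /allpairsP [[b a] /= [hb _ ->]].
rewrite /kle /key /=; have /= hjb := allP hj _ hb.
apply: (@leq_trans (j * n.+1 + n.+1)); first by rewrite leq_add2l ltnW.
by rewrite -mulSnr (leq_trans _ (leq_addr _ _)) // leq_mul2r orbC hjb.
Qed.

Let sorted_monomialP (s : seq letter) : size s = r -> sorted kle s ->
  exists2 A, Xi r A & s = monomial A.
Proof.
move=> hs ss; pose A := \matrix_(i, j) count_mem (i, j) s.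
have hp : perm_eq s (monomial A).
  apply/allP => -[i j] _ /=; rewrite count_mem_monomial mxE //.
exists A.
  apply/eqP; rewrite exchange_big /=; transitivity (size (monomial A)).
    rewrite -count_predT count_monomial.
    by apply: eq_bigr => i _; apply: eq_bigr => j _; rewrite mul1n.
  by rewrite -(perm_size hp).
apply: (sorted_eq _ _ ss (sorted_monomial A) hp).
- by move=> x y z; apply: leq_trans.
- by move=> x y h; apply: key_inj; apply/eqP; rewrite eqn_leq.
Qed.

Let mu := fix mu (s : seq letter) : nat :=
  if s is x :: s' then ((size s').+1 * key x + mu s')%N else 0%N.

Let mu_lt u v x y x' y' : (key x' < key x)%N ->
    (key x' + key y' = key x + key y)%N ->
  (mu (u ++ [:: x'; y'] ++ v) < mu (u ++ [:: x; y] ++ v))%N.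
Proof.
move=> h1 h2; elim: u => [|z u IH] /=; last by rewrite !size_cat /= ltn_add2l.
move: (size v).+1 (mu v) (key x) (key y) (key x') (key y') h1 h2.
move=> m c kx ky kx' ky' h1 h2; rewrite !mulSn -!addnA.
rewrite !(addnA (m * _)%N (m * _)%N) -!mulnDr h2.
by rewrite ltn_add2r.
Qed.

Let unsorted (s : seq letter) : ~~ sorted kle s ->
  exists u v x y, s = u ++ [:: x; y] ++ v /\ (key y < key x)%N.
Proof.
elim: s => //= x [//|y s] IH /=; rewrite negb_and => /orP [h|/IH].
  by exists [::], s, x, y; rewrite ltnNge.
by case=> u [v [x' [y' [-> h]]]]; exists (x :: u), v, x', y'.
Qed.

Lemma in_qschur_eq0 (f : wdual) : eps != 0 -> in_qschur eps f ->
  (forall A, Xi r A -> weval f (monomial A) = 0) -> f = 0.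
Proof.
move=> he hf h0; have q0 : q != 0 by rewrite expf_neq0.
suff H m s : (mu s <= m)%N -> weval f s = 0.
  by apply/ffunP => w; rewrite -weval_tuple (H _ _ (leqnn _)) ffunE.
elim: m s => [|m IH] s hm; last first.
  have [sz|/weval_size ->//] := eqVneq (size s) r.
  have [/(sorted_monomialP sz) [A hA ->]|] := boolP (sorted kle s); first exact: h0.
  case/unsorted=> u [v [[i j] [[a b] [es hk]]]]; rewrite es in hm *.
  have lt_m s' : (mu s' < mu (u ++ [:: (i, j); (a, b)] ++ v))%N -> weval f s' = 0.
    by move=> hs'; apply: IH; rewrite -ltnS (leq_trans hs').
  have sw : weval f (u ++ [:: (a, b); (i, j)] ++ v) = 0.
    by apply/lt_m/mu_lt; rewrite // addnC.
  have [r1 r2 r3] := hf u v.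
  case: (ltngtP a i) => [lai|lia|/val_inj eai].
  - have [ljb|lbj] := leqP j b; first by rewrite r2 // sw mulr0.
    rewrite r3 // sw addr0.
    suff -> : weval f (u ++ [:: (a, j); (i, b)] ++ v) = 0 by rewrite mulr0.
    have := r2 i b a j lai (ltnW lbj).
    rewrite lt_m; first by move/esym/eqP; rewrite mulf_eq0 (negPf q0) => /eqP.
    apply: mu_lt; rewrite /key /=; first by rewrite ltn_add2r ltn_mul2r.
    by rewrite addnACA (addnC (b * _)%N) -addnACA addnC addnACA addnC.
  - have lbj : (b <= j)%N.
      rewrite leqNgt; apply/negP => ljb; move: hk; rewrite ltnNge => /negP; apply.
      rewrite /key /=; apply: (@leq_trans (j * n.+1 + n.+1)).
        by rewrite leq_add2l ltnW.
      by rewrite -mulSnr (leq_trans _ (leq_addr _ _)) // leq_mul2r orbC ljb.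
    have := r2 a b i j lia lbj; rewrite sw => /esym/eqP.
    by rewrite mulf_eq0 (negPf q0) => /eqP.
  - by rewrite eai in sw *; rewrite r1.
have [sz|/weval_size ->//] := eqVneq (size s) r.
have [/(sorted_monomialP sz) [A hA ->]|] := boolP (sorted kle s); first exact: h0.
case/unsorted=> u [v [x [y [es hk]]]]; move: hm; rewrite leqNgt es => /negP[].
by apply: leq_ltn_trans (leq0n _) (mu_lt u v hk _); rewrite addnC.
Qed.
End Basis.

Section Diagonal.
Variables (k : fieldType) (eps : k) (n r : nat).
Hypothesis eps0 : eps != 0.
Local Notation wdual := (wdual k n r).
Local Notation letter := (letter n).
Local Notation windex := (windex n r).

Definition dg (phi : windex -> k) : wdual :=
  [ffun w => (rows w == cols w)%:R * phi (rows w)].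

Lemma dgM phi psi : dg phi * dg psi = dg (fun i => phi i * psi i).
Proof.
apply/ffunP => w; rewrite !ffunE (bigD1 (rows w)) //= !ffunE.
rewrite !rows_word !cols_word eqxx mul1r big1 ?addr0 => [|t ht]; last first.
  by rewrite ffunE rows_word cols_word eq_sym (negPf ht) !mul0r.
by rewrite mulrCA.
Qed.

Lemma dg1 : dg (fun=> 1) = 1.
Proof. by apply/ffunP => w; rewrite !ffunE mulr1. Qed.

Lemma dgZB c phi psi : c *: dg phi - dg psi = dg (fun i => c * phi i - psi i).
Proof.
apply/ffunP => w; rewrite !ffunE mulrBr -[_ *: _]/(c * _) mulrCA //.
Qed.

Lemma dgZ c phi : c *: dg phi = dg (fun i => c * phi i).
Proof. by apply/ffunP => w; rewrite !ffunE -[_ *: _]/(c * _) mulrCA. Qed.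

Lemma dgB phi psi : dg phi - dg psi = dg (fun i => phi i - psi i).
Proof. by rewrite -[dg phi]scale1r dgZB; congr dg; apply/funext => i; rewrite mul1r. Qed.

Lemma dg_prod (I : Type) (s : seq I) (phi : I -> windex -> k) :
  \prod_(a <- s) dg (phi a) = dg (fun i => \prod_(a <- s) phi a i).
Proof.
elim: s => [|a s IH]; first by rewrite big_nil -dg1; congr dg; apply/funext => i; rewrite big_nil.
by rewrite big_cons IH dgM; congr dg; apply/funext => i; rewrite big_cons.
Qed.

Section Proj.
Variable lam : 'I_n.+1 -> nat.
Let P (s : seq letter) : bool := [&& size s == r, all (fun x => x.1 == x.2) s
  & [forall a, count_mem a (unzip1 s) == lam a]].

Definition proj : wdual :=
  dg (fun i => [forall a, count_mem a i == lam a]%:R).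

Let weval_proj s : weval proj s = (P s)%:R.
Proof.
rewrite /weval /P; case: insubP => [w _ <-|/negPf ->] //.
rewrite size_tuple eqxx ffunE /= -natrM mulnb; congr ((_ && _)%:R).
rewrite -val_eqE /=; case: w => w _ /=; elim: w => //= -[i j] w <-.
by rewrite eqseq_cons.
Qed.

Let P_perm s t : perm_eq s t -> P s = P t.
Proof.
move=> h; rewrite /P (perm_size h) (perm_all _ h); do 2!congr (_ && _).
by apply: eq_forallb => a; rewrite (permP (perm_map _ h)).
Qed.

Let P_swap u v x y : P (u ++ [:: x; y] ++ v) = P (u ++ [:: y; x] ++ v).
Proof.
by apply: P_perm; rewrite perm_cat2l perm_cat2r (perm_catC [:: x] [:: y]).
Qed.

Let P_diag u v x y : P (u ++ [:: x; y] ++ v) -> x.1 = x.2 /\ y.1 = y.2.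
Proof.
by case/and3P => _ + _; rewrite all_cat /= => /and3P [_ /eqP -> /andP [/eqP ->]].
Qed.

Lemma in_qschur_proj : in_qschur eps proj.
Proof.
have F (b : bool) : (b -> False) -> b = false by case: b => // /(_ isT).
move=> u v; split=> [i j m|i j a b lai ljb|i j a b lai lbj]; rewrite !weval_proj.
- by rewrite P_swap.
- rewrite -P_swap (F (P _)) ?mulr0 // => /P_diag /= [e1 e2].
  by move: lai; rewrite e1 e2 ltnNge ljb.
- rewrite -P_swap (F (P (_ ++ [:: (a, j); _] ++ _))) ?mulr0 ?add0r //.
  by move=> /P_diag /= [e1 e2]; move: lai; rewrite e1 e2 ltnNge ltnW.
Qed.

Lemma weval_proj_monomial (A : 'M[nat]_n.+1) : Xi r A ->
  weval proj (monomial A) = (A == diag_mx (\row_i lam i))%:R.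
Proof.
move=> hA; rewrite weval_proj /P (size_monomial hA) eqxx /=; congr (_%:R).
congr nat_of_bool.
have cnt a : count_mem a (unzip1 (monomial A)) = (\sum_j A a j)%N.
  rewrite count_map count_monomial; apply: eq_bigr => j _.
  rewrite (bigD1 a) //= eqxx mul1n big1 ?addn0 // => i /negPf ->.
  by rewrite mul0n.
have offd : all (fun x => x.1 == x.2) (monomial A) -> forall i j, i != j -> A i j = 0%N.
  move=> /allP h i j nij; rewrite -(count_mem_monomial i j); apply/count_memPn.
  by apply/negP => /h /=; rewrite (negPf nij).
apply/andP/eqP => [[/offd hd /forallP hl]|eA].
  apply/matrixP => i j; rewrite !mxE; have [<-|/hd //] := eqVneq i j.
  move: (hl i); rewrite cnt (bigD1 i) //= big1 ?addn0 ?mulr1n => [/eqP //|a ha].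
  by rewrite hd // eq_sym.
have sumd a : (\sum_j (diag_mx (\row_i lam i) : 'M[nat]_n.+1) a j)%N = lam a.
  rewrite (bigD1 a) //= !mxE eqxx big1 ?addn0 ?mulr1n // => j /negPf hj.
  by rewrite !mxE eq_sym hj.
split; last by apply/forallP => a; rewrite cnt eA sumd.
apply/allP => -[i j] hx /=; apply: contraLR hx => nij; apply/count_memPn.
by rewrite count_mem_monomial eA !mxE (negPf nij).
Qed.
End Proj.

Lemma xi_diag lam : Xi r (diag_mx (\row_i lam i)) ->
  xi eps r (diag_mx (\row_i lam i)) = proj lam.
Proof.
move=> hl; rewrite /xi; case: xgetP => [f _ [hf fB]|/(_ (proj lam)) []]; last first.
  by split=> [|B hB]; [exact: in_qschur_proj | rewrite weval_proj_monomial].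
apply/eqP; rewrite -subr_eq0; apply/eqP.
apply: (in_qschur_eq0 eps0) => [|A hA]; first exact: in_qschurB hf (in_qschur_proj _).
by rewrite wevalB fB // weval_proj_monomial // subrr.
Qed.

Lemma dexp_diag lam : dexp (diag_mx (\row_i lam i) : 'M[nat]_n.+1) = 0.
Proof.
rewrite /dexp !big1 ?oppr0 ?addr0 // => i _; rewrite big1 // => j _.
  rewrite big1 // => t ltj; rewrite !mxE.
  have [eij|] := eqVneq i j; last by rewrite mul0n.
  by rewrite eij -(val_eqE j t) /= (gtn_eqF ltj) muln0.
rewrite big1 // => s his; rewrite big1 // => t htj; rewrite !mxE.
have [eij|] := eqVneq i j; last by rewrite mul0n.
have [est|] := eqVneq s t; last by rewrite muln0.
by move: his htj; rewrite eij est => /ltnW; rewrite leqNgt => /negPf ->.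
Qed.

Lemma blm_diag jj :
  blm eps r 0 jj
    = dg (fun i => eps ^ (\sum_a (count_mem a i)%:Z * jj a)).
Proof.
rewrite /blm; apply/ffunP => w; rewrite sum_ffunE ffunE.
have E (D : {ffun 'I_n.+1 -> 'I_r.+1}) : Xi r (0 + diag_mx (\row_i (D i : nat))) ->
    stdbasis eps r (0 + diag_mx (\row_i (D i : nat))) = proj (fun a => D a).
  by rewrite add0r /stdbasis dexp_diag oppr0 expr0z scale1r; apply: xi_diag.
have cnt_le a : (count_mem a (rows w) < r.+1)%N.
  by rewrite ltnS -[X in (_ <= X)%N](size_tuple (rows w)) count_size.
pose D0 : {ffun 'I_n.+1 -> 'I_r.+1} := [ffun a => Ordinal (cnt_le a)].
have hD0 : Xi r (0 + diag_mx (\row_i (D0 i : nat))).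
  rewrite /Xi add0r; apply/eqP.
  transitivity (\sum_(a : 'I_n.+1) count_mem a (rows w))%N.
    apply: eq_bigr => a _; rewrite (bigD1 a) //= !mxE eqxx ffunE big1 ?addn0 //.
    by move=> j /negPf hj; rewrite !mxE eq_sym hj.
  apply: etrans (size_tuple (rows w)); elim: (tval (rows w)) => [|b s IH] /=.
    by rewrite big1.
  rewrite big_split /= IH (bigD1 b) //= eqxx big1 // => c /negPf hc.
  by rewrite eq_sym hc.
rewrite (bigD1 D0) //= E // [X in _ + X]big1 ?addr0 => [|D /andP [hD nD]].
  rewrite !ffunE -[_ *: _]/(_ * _) mulrCA; congr (_ * _).
  rewrite (_ : [forall a, _] = true) ?mulr1; last first.
    by apply/forallP => a; rewrite ffunE.
  by congr (eps ^ _); apply: eq_bigr => a _; rewrite ffunE.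
rewrite E // !ffunE (_ : [forall a, _] = false) ?mulr0 ?scaler0 //.
apply/negP => /forallP h; case/eqP: nD; apply/ffunP => a; apply/val_inj.
by rewrite ffunE /= (eqP (h a)).
Qed.
End Diagonal.

Section Little.
Variables (k : fieldType) (eps : k) (n r : nat).
Local Notation wdual := (wdual k n r).

(* The images in A_q(n.+1, r)^* of E_h, F_h, K_i and K_i^-1 under zeta_r, which
   generate zeta_r(u_k(n.+1)).  They are given by the formulas for zeta_r with
   upsilon specialised to eps, as the base change from Z[upsilon, upsilon^-1]
   to k maps xi_A to xi_A. *)
Definition zetaE (h : 'I_n) : wdual :=
  blm eps r (delta_mx (widen_ord (leqnSn n) h) (fintype.lift ord0 h)) (fun=> 0).
Definition zetaF (h : 'I_n) : wdual :=
  blm eps r (delta_mx (fintype.lift ord0 h) (widen_ord (leqnSn n) h)) (fun=> 0).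
Definition zetaK (i : 'I_n.+1) : wdual := blm eps r 0 (fun j => (j == i)%:Z).
Definition zetaKV (i : 'I_n.+1) : wdual := blm eps r 0 (fun j => - (j == i)%:Z).

(* The subalgebra of A_q(n.+1, r)^* generated by these elements. *)
Inductive little : wdual -> Prop :=
| little_E h : little (zetaE h)
| little_F h : little (zetaF h)
| little_K i : little (zetaK i)
| little_KV i : little (zetaKV i)
| little_1 : little 1
| little_lin (c : k) x y of little x & little y : little (c *: x + y)
| little_mul x y of little x & little y : little (x * y).

Definition little_pred : {pred wdual} := fun x => `[< little x >].

Lemma little_subalg_closed : subalg_closed little_pred.
Proof.
split.
- exact/asboolP/little_1.
- by move=> c x y /asboolP hx /asboolP hy; apply/asboolP/little_lin.
- by move=> x y /asboolP hx /asboolP hy; apply/asboolP/little_mul.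
Qed.
HB.instance Definition _ := GRing.isSubalgClosed.Build k wdual little_pred
  little_subalg_closed.

Definition lqschur := {x : wdual | x \in little_pred}.
HB.instance Definition _ := SubChoice.on lqschur.
HB.instance Definition _ := [SubChoice_isSubAlgebra of lqschur by <:].

Definition in_lqschur x (hx : little x) : lqschur :=
  exist (fun y => y \in little_pred) x (introT (asboolP _) hx).

Definition gen_e (h : 'I_n) : lqschur := in_lqschur (little_E h).
Definition gen_f (h : 'I_n) : lqschur := in_lqschur (little_F h).
Definition gen_k (i : 'I_n.+1) : lqschur := in_lqschur (little_K i).
Definition gen_kV (i : 'I_n.+1) : lqschur := in_lqschur (little_KV i).

(* The element [K; 0 / t], with KV the inverse of K.  It is only used for
   t = omega_i <= 1, where no denominator vanishes at upsilon = eps. *)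
Definition kbin (K KV : lqschur) (t : nat) : lqschur :=
  \prod_(1 <= s < t.+1) ((eps ^+ s - eps ^- s)^-1 *:
    (eps ^ (1 - s%:Z) *: K - eps ^ (s%:Z - 1) *: KV)).

Definition omega (i : 'I_n.+1) : nat := (i < r)%N.

Definition komega : lqschur := \prod_i kbin (gen_k i) (gen_kV i) (omega i).

Hypotheses (hr : (r <= n.+1)%N).
Hypothesis (e0 : eps != 0) (e1 : eps - eps^-1 != 0).

Let qn (m : nat) : k := (eps ^+ m - eps ^- m) / (eps - eps^-1).
Let qn0 : qn 0 = 0. Proof. by rewrite /qn expr0 invr1 subrr mul0r. Qed.
Let qn1 : qn 1 = 1. Proof. by rewrite /qn expr1 divff. Qed.

Let phi (i : windex n r) : k := \prod_(a : 'I_n.+1) if (a < r)%N then qn (count_mem a i) else 1.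

Lemma val_komega : val komega = dg phi.
Proof.
rewrite /komega rmorph_prod /phi -dg_prod; apply: eq_bigr => a _.
rewrite /omega /kbin; case: ltnP => _ /=; last by rewrite big_nil dg1.
rewrite big_nat1 expr1 subrr !expr0z !scale1r.
change ((eps - eps^-1)^-1 *: (zetaK a - zetaKV a) = dg (fun i => qn (count_mem a i))).
rewrite /zetaK /zetaKV !blm_diag // dgB dgZ.
congr dg; apply/funext => i; rewrite mulrC; congr (_ * _).
have E (c : int) : \sum_(b < n.+1) (count_mem b i)%:Z * (c * (b == a)%:Z)
   = (count_mem a i)%:Z * c.
  rewrite (bigD1 a) //= eqxx mulr1 big1 ?addr0 // => b /negPf ->.
  by rewrite !mulr0.
congr (_ - _).
  by rewrite exprnP; congr (eps ^ _); rewrite -[RHS]mulr1 -E; apply: eq_bigr => b _; rewrite mul1r.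
rewrite exprnN; congr (eps ^ _); rewrite -mulrN1 -E; apply: eq_bigr => b _.
by rewrite mulN1r.
Qed.

Lemma phi01 i : phi i = 0 \/ phi i = 1.
Proof.
have [h|] := boolP [forall (a : 'I_n.+1 | (a < r)%N), (0 < count_mem a i)%N]; last first.
  rewrite negb_forall_in => /exists_inP [a ha]; rewrite -eqn0Ngt => /eqP h0; left.
  by rewrite /phi (bigD1 a) //= ha h0 qn0 mul0r.
right; rewrite /phi big1 // => a _; case: ifP => // ha.
suff -> : count_mem a i = 1%N by [].
apply/eqP; rewrite eqn_leq (forall_inP h) // andbT leqNgt; apply/negP => h2.
have : (\sum_(b : 'I_n.+1 | (b < r)%N) 1 < \sum_(b : 'I_n.+1 | (b < r)%N) count_mem b i)%N.
  rewrite (bigD1 a) //= [X in (_ < X)%N](bigD1 a) //= -addSn leq_add //.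
  by apply: leq_sum => b /andP [hb _]; apply: (forall_inP h).
rewrite ltnNge => /negP; apply.
have -> : (\sum_(b : 'I_n.+1 | (b < r)%N) 1 = r)%N.
  by rewrite -(big_ord_widen n.+1 (fun=> 1%N) hr) sum1_card card_ord.
rewrite -[X in (_ <= X)%N](size_tuple i).
apply: (@leq_trans (\sum_(b : 'I_n.+1) count_mem b i)).
  by rewrite [X in (_ <= X)%N](bigID (fun b : 'I_n.+1 => (b < r)%N)) /= leq_addr.
elim: (tval i) => [|b s IH] /=; first by rewrite big1.
rewrite big_split /= (bigD1 b) //= eqxx big1 ?addn0 ?ltnS // => c /negPf hc.
by rewrite eq_sym hc.
Qed.

Lemma komega_id : komega * komega = komega.
Proof.
apply/val_inj; change (val komega * val komega = val komega).
rewrite val_komega dgM; congr dg; apply/funext => i.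
by have [->|->] := phi01 i; rewrite ?mulr0 ?mulr1.
Qed.

Lemma komega_neq0 : komega != 0.
Proof.
apply/eqP => /(congr1 val); rewrite val_komega raddf0 => /ffunP.
pose i : windex n r := [tuple widen_ord hr s | s < r].
move=> /(_ (word i i)); rewrite !ffunE rows_word cols_word eqxx mul1r => /eqP.
rewrite /phi big1 ?oner_eq0 // => a _; case: ifP => // ha.
rewrite (_ : count_mem a i = 1%N) // count_uniq_mem.
  by rewrite (_ : a \in i) //; apply/mapP; exists (Ordinal ha); rewrite ?mem_enum //; apply/val_inj.
rewrite map_inj_uniq ?enum_uniq // => x y /(congr1 val) h; exact: val_inj.
Qed.
End Little.

Section BabySchur.
Variables (k : fieldType) (eps : k) (n r l : nat).
Hypotheses (l3 : (3 <= l)%N) (heps : l.-primitive_root eps) (hr : (r <= n.+1)%N).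

Fact prim_neq0 : eps != 0.
Proof.
apply/eqP => h; have := prim_expr_order heps.
by rewrite h expr0n (gtn_eqF (ltn_trans _ l3)) // => /eqP; rewrite eq_sym oner_eq0.
Qed.
Fact prim_sub_inv_neq0 : eps - eps^-1 != 0.
Proof.
rewrite subr_eq0; apply/eqP => h.
have h2 : eps ^+ 2 == 1 by rewrite expr2 {2}h mulfV ?prim_neq0.
by move: h2; rewrite -(prim_order_dvd heps) => /dvdn_leq -/(_ isT); rewrite leqNgt l3.
Qed.

Definition komega_idem : idempotent (lqschur eps n r) :=
  Idempotent (komega_id hr prim_neq0 prim_sub_inv_neq0)
             (komega_neq0 hr prim_neq0 prim_sub_inv_neq0).

(* k_omega u_k(n.+1, r) k_omega *)
Definition hecke : algType k := corner komega_idem.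
Definition baby_schur_K0 : {additive K0 (lqschur eps n r) -> K0 hecke} :=
  K0_schur komega_idem.
End BabySchur.

(* Such a rho is unique, and onto, as the inverse of k_i is mapped to the inverse
   of k_i. *)
Definition baby_transfer (k : fieldType) (eps : k) (n r s : nat)
    (rho : {lrmorphism lqschur eps n r -> lqschur eps n s}) : Prop :=
  [/\ forall h, rho (gen_e eps r h) = gen_e eps s h,
      forall h, rho (gen_f eps r h) = gen_f eps s h
    & forall i, rho (gen_k eps r i) = gen_k eps s i].

(* Main.v *)
(* Write A for the little q-Schur algebra of degree r, inside the centralizer S of the
   Hecke algebra on the r-th tensor power of k^n, and e for k_omega.

   In general, the Schur functor V |-> eV has the coinduction L |-> Hom_{eAe}(eA, L) as
   a right adjoint and section, which is exact up to modules killed by e.  So the map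
   K(A) -> K(eAe) is onto, and its kernel is generated by the modules killed by e, that
   is by the modules over A / AeA.  Inflation along a surjective algebra map is injective
   on Grothendieck groups, by the Jordan-Hoelder theorem.

   It remains to see that ker rho = AeA if r >= l, and AeA = A if r < l.  Matrix entries
   of elements of A satisfy x (u c_ij^l v) = delta_ij (rho x) (u v): when x is multiplied
   by a root generator, c_ij^l contributes a sum 1 + z + ... + z^(l-1) = 0 with z = q or
   1/q.  Hence elements of ker rho vanish on all words with l equal consecutive letters
   (and if r < l all elements of A do).  Conversely such an element of S lies in AeA: for
   each sorted word s without l equal letters, AeA contains an element which is 1 on s
   and 0 on the other sorted words.  It is obtained from e by multiplications by root
   generators, which move single letters to adjacent unused letters, with coefficients
   1 + z + ... + z^(m-1) where m < l, and so invertible. *)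
Require Import Defs.
From HB Require Import structures.
From mathcomp Require Import all_boot all_order all_algebra.
From mathcomp Require Import boolp classical_sets freeg.
From mathcomp Require Import zify ring.
Set Implicit Arguments. Unset Strict Implicit. Unset Printing Implicit Defensive.
Import GRing.Theory.
Local Open Scope ring_scope.

(** * Finite dimensional modules *)

(** Elements of S are handled through one principle: they are determined by their values on sorted
    words ([in_qschur_eq0]). To apply it to products, S must be closed under multiplication; this
    holds because the relations between the c_ij express commutation with the Hecke operators T_p on
    the tensor power. The generators, given as sums of dual basis elements, must also become
    explicit matrices ([blm_tv]). Oddness of l makes q = eps^2 again a primitive l-th root of unity,
    so that 1 + z + ... + z^(m-1) vanishes exactly when l divides m, which serves both inclusions.
    On the module side coinduction is not exact, so it only defines a map from K(eAe) to K(A)/P,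
    where P contains the classes of all modules killed by e; composed with F this is the projection,
    whence ker F is contained in P. *)

Section ColumnMaps.
Variable k : fieldType.

Lemma cV_ext m n (f g : 'M[k]_(m, n)) : (forall v : 'cV_n, f *m v = g *m v) -> f = g.
Proof.
move=> h; apply/matrixP => i j; have := h (delta_mx j 0).
by rewrite -!colE => /matrixP /(_ i 0); rewrite !mxE.
Qed.

Lemma mulmx_injP m n (f : 'M[k]_(m, n)) :
  (forall v : 'cV_n, f *m v = 0 -> v = 0) -> exists g : 'M_(n, m), g *m f = 1%:M.
Proof.
move=> h; apply/row_fullP; rewrite -cokermx_eq0; apply/eqP/cV_ext => v.
by rewrite mul0mx; apply: h; rewrite mulmxA mulmx_coker mul0mx.
Qed.

Lemma mulmx_surjP m n (f : 'M[k]_(m, n)) :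
  (forall w : 'cV_m, exists v : 'cV_n, f *m v = w) -> exists g : 'M_(n, m), f *m g = 1%:M.
Proof.
move=> /(_ (delta_mx _ 0)) h; have /fin_all_exists [F hF] := h.
exists (\matrix_(i, j) F j i 0); apply/matrixP => i j.
have /matrixP /(_ i 0) := hF j; rewrite !mxE eqxx andbT => <-.
by apply: eq_bigr => x _; rewrite !mxE.
Qed.

Lemma inj_mulmx m n p (f : 'M[k]_(m, n)) (M N : 'M_(n, p)) :
  (forall v : 'cV_n, f *m v = 0 -> v = 0) -> f *m M = f *m N -> M = N.
Proof.
by case/mulmx_injP => g gf /(congr1 (mulmx g)); rewrite !mulmxA gf !mul1mx.
Qed.

Lemma surj_mulmx m n p (f : 'M[k]_(m, n)) (M N : 'M_(p, m)) :
  (forall w : 'cV_m, exists v : 'cV_n, f *m v = w) -> M *m f = N *m f -> M = N.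
Proof.
by case/mulmx_surjP => g fg /(congr1 (mulmx^~ g)); rewrite -!mulmxA fg !mulmx1.
Qed.
End ColumnMaps.

Section Build.
Variables (k : fieldType) (A : algType k).

Section Mk.
Variables (d : nat) (act : A -> 'M[k]_d).
Hypotheses (act_lin : linear act) (act1 : act 1 = 1%:M)
  (actM : forall a b, act (a * b) = act a *m act b).
HB.instance Definition _ := GRing.isLinear.Build k A 'M[k]_d _ act act_lin.
Definition mkmod : fdmod A := @FdMod k A d act act1 actM.
End Mk.

Definition injm (U V : fdmod A) (f : 'M[k]_(mdim V, mdim U)) :=
  modhom f /\ forall u : 'cV_(mdim U), f *m u = 0 -> u = 0.

Definition surjm (U V : fdmod A) (f : 'M[k]_(mdim V, mdim U)) :=
  modhom f /\ forall w : 'cV_(mdim V), exists v, f *m v = w.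

Definition exactm (U V W : fdmod A) (f : 'M[k]_(mdim V, mdim U)) (g : 'M[k]_(mdim W, mdim V)) :=
  forall v : 'cV_(mdim V), g *m v = 0 <-> exists u, v = f *m u.

Definition isom (U V : fdmod A) := exists f, @injm U V f /\ surjm f.

Lemma sesP (U V W : fdmod A) :
  ses U V W <-> exists f g, [/\ @injm U V f, @surjm V W g & exactm f g].
Proof.
split=> -[f [g]]; first by case=> *; exists f, g.
by case=> -[? ?] [? ?] ?; exists f, g.
Qed.

Lemma modhomM (U V W : fdmod A) f g : @modhom k A U V f -> @modhom k A V W g -> modhom (g *m f).
Proof. by move=> hf hg a; rewrite -mulmxA hf !mulmxA hg. Qed.

Lemma modhom1 (U : fdmod A) : @modhom k A U U 1%:M.
Proof. by move=> a; rewrite mul1mx mulmx1. Qed.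

Lemma exact_mul0 (U V W : fdmod A) f g : @exactm U V W f g -> g *m f = 0.
Proof.
by move=> h; apply: cV_ext => u; rewrite mul0mx -mulmxA; apply/h; exists u.
Qed.

Lemma isom_sym (U V : fdmod A) : isom U V -> isom V U.
Proof.
case=> f [[hf fi] [_ fs]]; have [g fg] := mulmx_surjP fs.
have gf : g *m f = 1%:M by apply: (inj_mulmx fi); rewrite mulmxA fg mul1mx mulmx1.
exists g; do !split.
- by move=> a; apply: (inj_mulmx fi); rewrite !mulmxA hf fg mul1mx -mulmxA fg mulmx1.
- by move=> u h; rewrite -[u]mul1mx -fg -mulmxA h mulmx0.
- by move=> a; apply: (inj_mulmx fi); rewrite !mulmxA hf fg mul1mx -mulmxA fg mulmx1.
- by move=> w; exists (f *m w); rewrite mulmxA gf mul1mx.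
Qed.

Lemma isom_refl (U : fdmod A) : isom U U.
Proof.
exists 1%:M; do !split; try exact: modhom1; first by move=> u; rewrite mul1mx.
by move=> w; exists w; rewrite mul1mx.
Qed.

Lemma isom_trans (U V W : fdmod A) : isom U V -> isom V W -> isom U W.
Proof.
case=> f [[hf fi] [_ fs]] [g [[hg gi] [_ gs]]]; exists (g *m f).
do !split; try exact: modhomM; first by move=> u; rewrite -mulmxA => /gi /fi.
by move=> w; have [v <-] := gs w; have [u <-] := fs v; exists u; rewrite mulmxA.
Qed.

Lemma isom_dim (U V : fdmod A) : isom U V -> mdim U = mdim V.
Proof.
case=> f [[_ fi] [_ fs]]; have [g gf] := mulmx_injP fi; have [h fh] := mulmx_surjP fs.
by apply/eqP; rewrite eqn_leq (mulmx1_min gf) (mulmx1_min fh).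
Qed.

Lemma isom_ses (U V V' W : fdmod A) : isom V V' -> ses U V W -> ses U V' W.
Proof.
move=> i; have [j [[hj ji] [_ js]]] := isom_sym i.
case: i => i [[hi ii] [_ is_]] /sesP [f [g [[hf fi] [hg gs] fg]]].
have [j' jj'] := mulmx_surjP js.
apply/sesP; exists (j' *m f), (g *m j); split.
- split=> [a|u]; last first.
    by move/(congr1 (mulmx j)); rewrite !mulmxA jj' mul1mx mulmx0 => /fi.
  by apply: (inj_mulmx ji); rewrite !mulmxA jj' mul1mx hf hj -!mulmxA (mulmxA j) jj' mul1mx.
- split=> [|w]; first exact: modhomM.
  by have [v <-] := gs w; have [v' <-] := js v; exists v'; rewrite mulmxA.
- move=> v; rewrite -mulmxA; split=> [/fg [u hu]|[u ->]].
    exists u; apply: (inj_mulmx ji); rewrite hu !mulmxA jj' mul1mx //.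
  by apply/fg; exists u; rewrite !mulmxA jj' mul1mx.
Qed.

Lemma ses_dim (U V W : fdmod A) : ses U V W -> mdim V = (mdim U + mdim W)%N.
Proof.
case/sesP=> f [g [[_ fi] [_ gs] fg]].
have [l0 lf0] := mulmx_injP fi; have [s sg] := mulmx_surjP gs.
have gf := exact_mul0 fg.
(* Composing a left inverse of f with 1 - s g, the projection onto ker g along the image of s, gives
   a retraction that also kills s; then (f, s) and (l, g) are inverse to each other. *)
pose l := l0 *m (1%:M - s *m g).
have ls : l *m s = 0 by rewrite -mulmxA mulmxBl mul1mx -(mulmxA s) sg mulmx1 subrr mulmx0.
have lf : l *m f = 1%:M by rewrite -mulmxA mulmxBl mul1mx -(mulmxA s) gf mulmx0 subr0.
clearbody l.
have fl : f *m l + s *m g = 1%:M.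
  apply: cV_ext => v; rewrite mulmxDl mul1mx -!mulmxA.
  have [|u hu] := (fg (v - s *m (g *m v))).1.
    by rewrite mulmxBr (mulmxA g) sg mul1mx subrr.
  suff -> : f *m (l *m v) = v - s *m (g *m v) by rewrite subrK.
  have lsv : l *m (s *m (g *m v)) = 0 by rewrite mulmxA ls mul0mx.
  rewrite -[l *m v]subr0 -{1}lsv -mulmxBr hu (mulmxA l) lf mul1mx //.
have e1 : row_mx f s *m col_mx l g = 1%:M by rewrite mul_row_col.
have e2 : col_mx l g *m row_mx f s = 1%:M.
  by rewrite mul_col_row lf ls gf sg -scalar_mx_block.
by apply/eqP; rewrite eqn_leq (mulmx1_min e1) (mulmx1_min e2).
Qed.

Fact zmod_act_lin : linear (fun _ : A => 0 : 'M[k]_0).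
Proof. by move=> c a b; rewrite scaler0 addr0. Qed.
Fact zmod_act1 : (0 : 'M[k]_0) = 1%:M.
Proof. by apply/matrixP => -[]. Qed.
Fact zmod_actM (a b : A) : (0 : 'M[k]_0) = (0 : 'M[k]_0) *m (0 : 'M[k]_0).
Proof. by rewrite mul0mx. Qed.
Definition zero_mod : fdmod A := @mkmod 0 (fun=> 0) zmod_act_lin zmod_act1 zmod_actM.

Lemma dim0_cV n (v : 'cV[k]_n) : n = 0%N -> v = 0.
Proof. by move=> h; subst n; apply/matrixP => -[]. Qed.

Lemma ses_isom0 (U V W : fdmod A) : isom U V -> mdim W = 0%N -> ses U V W.
Proof.
case=> f [[hf fi] [_ fs]] w0; exists f, 0; split=> //.
- by move=> a; rewrite mul0mx mulmx0.
- by move=> w; exists 0; rewrite mulmx0 [w]dim0_cV.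
- move=> v; rewrite mul0mx; split=> // _.
  by have [u <-] := fs v; exists u.
Qed.

Lemma ses_isoml (U V W : fdmod A) : ses U V W -> mdim W = 0%N -> isom U V.
Proof.
case/sesP=> f [g [[hf fi] [_ _] fg]] w0; exists f; do !split=> //.
by move=> v; have [|u ->] := (fg v).1; [exact: dim0_cV | exists u].
Qed.

Lemma ses_isomr (U V W : fdmod A) : ses U V W -> mdim U = 0%N -> isom V W.
Proof.
case/sesP=> f [g [[_ _] [hg gs] fg]] u0; exists g; do !split=> //.
by move=> v /fg [u ->]; rewrite [u]dim0_cV // mulmx0.
Qed.

Lemma K0_class0 (V : fdmod A) : mdim V = 0%N -> K0_class V = 0.
Proof.
move=> v0; have /K0_ses/eqP := ses_isom0 (isom_refl V) v0.
by rewrite -subr_eq0 opprD addrA subrr sub0r oppr_eq0 => /eqP.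
Qed.

Lemma K0_isom (U V : fdmod A) : isom U V -> K0_class U = K0_class V.
Proof.
move=> h; have w0 : mdim zero_mod = 0%N by [].
by rewrite (K0_ses (ses_isom0 h w0)) (K0_class0 w0) addr0.
Qed.

(** Matrix kernels are row spaces while modules consist of columns, whence the transposes. The
    action is transported by a left inverse [l] of the inclusion [i]; it is multiplicative because i
    l fixes the image of a i. *)
Lemma modhom_ker (X Y : fdmod A) h : @modhom k A X Y h ->
  exists K i, @injm K X i /\ exactm i h.
Proof.
move=> hh; pose i := (row_base (kermx h^T))^T.
have hi : h *m i = 0.
  apply: trmx_inj; rewrite trmx_mul trmx0 trmxK.
  by apply/sub_kermxP; rewrite eq_row_base.
have [l li] : exists l, l *m i = 1%:M.
  have /row_freeP [B hB] := row_base_free (kermx h^T).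
  by exists B^T; rewrite /i -trmx_mul hB trmx1.
have im m (v : 'M_(_, m)) : h *m v = 0 -> exists u, v = i *m u.
  move=> hv; have : (v^T <= row_base (kermx h^T))%MS.
    by rewrite eq_row_base; apply/sub_kermxP; rewrite -trmx_mul hv trmx0.
  case/submxP=> D /(congr1 trmx); rewrite trmxK trmx_mul => ->.
  by exists D^T.
have lia a : i *m (l *m mact X a *m i) = mact X a *m i.
  have [|u hu] := im _ (mact X a *m i); first by rewrite mulmxA hh -mulmxA hi mulmx0.
  by rewrite -mulmxA hu (mulmxA l) li mul1mx.
have K_lin : linear (fun a => l *m mact X a *m i).
  by move=> c a b; rewrite linearP /= mulmxDr mulmxDl -scalemxAr -scalemxAl.
have K_1 : l *m mact X 1 *m i = 1%:M by rewrite mact1 mulmx1 li.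
have K_M a b : l *m mact X (a * b) *m i = (l *m mact X a *m i) *m (l *m mact X b *m i).
  by rewrite mactM -!mulmxA; congr (l *m (_ *m _)); rewrite !mulmxA -lia !mulmxA.
exists (mkmod K_lin K_1 K_M), i; split; first split.
- by move=> a; exact: lia.
- by move=> u hu; rewrite -[u]mul1mx -li -mulmxA hu mulmx0.
- by move=> v; split=> [/im|[u ->]] //; rewrite mulmxA hi mul0mx.
Qed.

Lemma modhom_coker (X Y : fdmod A) h : @modhom k A X Y h ->
  exists C p, @surjm Y C p /\ exactm h p.
Proof.
move=> hh; pose p := (col_base (cokermx h^T))^T.
have pker m (v : 'M_(_, m)) : p *m v = 0 <-> exists u, v = h *m u.
  split=> [pv|[u ->]].
    have : (v^T <= h^T)%MS.
      rewrite submxE -(mulmx_base (cokermx h^T)) mulmxA.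
      by rewrite -[col_base _]trmxK -trmx_mul pv trmx0 mul0mx.
    case/submxP=> D /(congr1 trmx); rewrite trmxK trmx_mul trmxK => ->.
    by exists D^T.
  have hp : h^T *m col_base (cokermx h^T) = 0.
    apply: (row_free_inj (row_base_free (cokermx h^T))).
    by rewrite /= mul0mx -mulmxA mulmx_base mulmx_coker.
  by rewrite mulmxA (_ : p *m h = 0) ?mul0mx //; apply: trmx_inj; rewrite trmx_mul trmxK hp trmx0.
have [s ps] : exists s, p *m s = 1%:M.
  have /row_fullP [B hB] := col_base_full (cokermx h^T).
  by exists B^T; rewrite /p -trmx_mul hB trmx1.
have psa a : p *m mact Y a *m s *m p = p *m mact Y a.
  have [u hu] : exists u, s *m p - 1%:M = h *m u.
    by apply/pker; rewrite mulmxBr mulmxA ps mul1mx mulmx1 subrr.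
  apply/eqP; rewrite -subr_eq0 -!mulmxA -mulmxBr -[X in _ - X]mulmx1 -mulmxBr hu.
  rewrite (mulmxA _ h) -hh; apply/eqP/pker; exists (mact X a *m u).
  by rewrite mulmxA.
have C_lin : linear (fun a => p *m mact Y a *m s).
  by move=> c a b; rewrite linearP /= mulmxDr mulmxDl -scalemxAr -scalemxAl.
have C_1 : p *m mact Y 1 *m s = 1%:M by rewrite mact1 mulmx1 ps.
have C_M a b : p *m mact Y (a * b) *m s = (p *m mact Y a *m s) *m (p *m mact Y b *m s).
  by rewrite mactM !mulmxA psa.
exists (mkmod C_lin C_1 C_M), p; split; last by move=> v; exact: pker.
split=> [a|w]; first exact/esym/psa.
by exists (s *m w); rewrite mulmxA ps mul1mx.
Qed.

Lemma modhom_epi_factor (X Q Y : fdmod A) p h : @surjm X Q p -> @modhom k A X Y h ->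
  (forall v : 'cV_(mdim X), p *m v = 0 -> h *m v = 0) ->
  exists2 h', @modhom k A Q Y h' & h = h' *m p.
Proof.
case=> hp ps hh ph; have [s ps1] := mulmx_surjP ps.
have e : h = h *m s *m p.
  apply: cV_ext => v; apply/eqP; rewrite -subr_eq0 -!mulmxA -mulmxBr.
  by rewrite ph // mulmxBr !mulmxA ps1 mul1mx subrr.
exists (h *m s) => // a; apply: (surj_mulmx ps).
by rewrite -mulmxA -hp (mulmxA (h *m s)) -e hh -!(mulmxA (mact Y a)) -e.
Qed.

Lemma modhom_mono_factor (X Y Z : fdmod A) i h : @injm Z Y i -> @modhom k A X Y h ->
  (forall v : 'cV_(mdim X), exists u, h *m v = i *m u) ->
  exists2 h', @modhom k A X Z h' & h = i *m h'.
Proof.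
case=> hi ii hh ih; have [l li] := mulmx_injP ii.
have e : h = i *m (l *m h).
  apply: cV_ext => v; have [u hu] := ih v.
  by rewrite -!mulmxA hu (mulmxA l) li mul1mx.
exists (l *m h) => // a; apply: (inj_mulmx ii).
by rewrite mulmxA -e hh {1}e !mulmxA hi.
Qed.

(** Q is the image of h, obtained as the cokernel of the inclusion of its kernel. *)
Lemma ses_image (X Y K C : fdmod A) h i p : @modhom k A X Y h ->
  @injm K X i -> exactm i h -> @surjm Y C p -> exactm h p ->
  exists Q, ses K X Q /\ ses Q Y C.
Proof.
move=> hh ij ih sp hp; have [Q [s [ss is_]]] := modhom_coker ij.1.
have [|h' hh' eh] := modhom_epi_factor ss hh; first by move=> v /is_ /ih.
exists Q; split; apply/sesP; [by exists i, s | exists h', p; split=> //].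
- split=> // w hw; have [v ev] := ss.2 w; move: hw; rewrite -ev mulmxA -eh.
  by move=> /ih [u ->]; rewrite mulmxA (exact_mul0 is_) mul0mx.
- move=> v; split=> [/hp [u ->]|[u ->]]; first by exists (s *m u); rewrite mulmxA -eh.
  by have [w <-] := ss.2 u; apply/hp; exists w; rewrite mulmxA -eh.
Qed.
End Build.

(** * Jordan-Hoelder and inflation *)

Section K0Universal.
Variables (k : fieldType) (A : algType k).

Lemma freeg_zmod_ind (K : choiceType) (P : {freeg K / int} -> Prop) :
  P 0 -> (forall x y, P x -> P y -> P (x - y)) -> (forall v, P << v >>) ->
  forall x, P x.
Proof.
move=> P0 PB PU x.
have PN y : P y -> P (- y) by rewrite -[- y]sub0r; apply: PB.
have PD y z : P y -> P z -> P (y + z) by move=> ? ?; rewrite -[z]opprK; apply/PB/PN.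
have PM y n : P y -> P (y *+ n).
  by move=> hy; elim: n => [|n IH]; rewrite ?mulr0n // mulrS; apply: PD.
rewrite -(freeg_sumE x); elim/big_ind: _ => // v _.
have -> : << coeff v x *g v >> = << v >> *~ coeff v x by rewrite freegU_mulz mulrzz mul1r.
by case: (coeff v x) => n; [exact: PM | exact/PN/PM].
Qed.

Lemma K0_ind (P : K0 A -> Prop) :
  P 0 -> (forall x y, P x -> P y -> P (x - y)) -> (forall V, P (K0_class V)) ->
  forall x, P x.
Proof.
move=> P0 PB PU x; rewrite -[x]reprK.
elim/freeg_zmod_ind: (repr x) => [|y z hy hz|v]; [by rewrite raddf0| |exact: PU].
by rewrite raddfB; apply: PB.
Qed.

Lemma K0_lift (G : zmodType) (beta : fdmod A -> G) :
  (forall U V W, ses U V W -> beta V = beta U + beta W) ->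
  exists phi : {additive K0 A -> G}, forall V, phi (K0_class V) = beta V.
Proof.
move=> hb.
pose lift : {freeg (fdmod A) / int} -> zmodule G := fglift (beta : _ -> zmodule G).
have liftB x y : lift (x - y) = lift x - lift y by exact: lift_is_additive.
have liftU V : lift << V >> = beta V by rewrite /lift liftU scale1r.
have lift_rel x : ses_span x -> lift x = 0.
  elim=> [U V W h||x1 y _ h1 _ h2].
  - by rewrite !liftB !liftU (hb _ _ _ h) addrAC addrK subrr.
  - by rewrite -(subr0 0) liftB subrr.
  - by rewrite liftB h1 h2 subr0.
have eq_lift x y : (\pi_(Quotient.quot (@K0_rel k A)) x = \pi_(Quotient.quot (@K0_rel k A)) y)%qT -> lift x = lift y.
  move=> h; apply/eqP; rewrite -subr_eq0 -liftB; apply/eqP/lift_rel/asboolP.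
  rewrite -[X in is_true X]/(_ \in @K0_rel k A).
  by rewrite Quotient.idealrBE h.
pose phi (x : K0 A) : G := lift (repr x).
have phi_add : zmod_morphism phi.
  move=> x y; rewrite /phi -[RHS]liftB; apply: eq_lift.
  by rewrite raddfB /= !reprK.
pose phiM := GRing.isZmodMorphism.Build (K0 A) G phi phi_add.
exists (HB.pack phi phiM : {additive K0 A -> G}) => V /=; rewrite -liftU; apply: eq_lift.
by rewrite reprK.
Qed.
End K0Universal.

Section JordanHolder.
Variables (k : fieldType) (A : algType k) (G : zmodType) (tau : fdmod A -> G).

Definition simple_mod (V : fdmod A) :=
  (0 < mdim V)%N /\ forall U W, ses U V W -> mdim U = 0%N \/ mdim W = 0%N.

Hypothesis tau_isom : forall U V, isom U V -> tau U = tau V.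

(* [filt V x]: V has a filtration with simple factors S_i and x = sum tau S_i. *)
Inductive filt : fdmod A -> G -> Prop :=
| filt0 V of mdim V = 0%N : filt V 0
| filt_simple V of simple_mod V : filt V (tau V)
| filt_ses U V W x y of ses U V W & (0 < mdim U)%N & (0 < mdim W)%N
    & filt U x & filt W y : filt V (x + y).

Lemma simple_isom U V : isom U V -> simple_mod U -> simple_mod V.
Proof.
move=> h [u0 us]; split=> [|X Y XY]; first by rewrite -(isom_dim h).
exact: us (isom_ses (isom_sym h) XY).
Qed.

Lemma filt_isom U V x : isom U V -> filt U x -> filt V x.
Proof.
move=> h hx; case: U x / hx h => [U u0|U us|X U Y x y XUY x0 y0 hx hy] h.
- by apply: filt0; rewrite -(isom_dim h).
- by rewrite (tau_isom h); apply/filt_simple/(simple_isom h).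
- exact: filt_ses (isom_ses h XUY) x0 y0 hx hy.
Qed.

Lemma filt_exists V : exists x, filt V x.
Proof.
have [m] := ubnP (mdim V); elim: m V => // m IH V; rewrite ltnS => hV.
have [v0|v0] := posnP (mdim V); first by exists 0; apply: filt0.
have [vs|/not_andP[]//] := pselect (simple_mod V); first by exists (tau V); apply: filt_simple.
move/existsNP => [U /existsNP [W /not_implyP [UVW /not_orP [/eqP u0 /eqP w0]]]].
have hd := ses_dim UVW; rewrite -!lt0n in u0 w0.
have [|x hx] := IH U; first by apply: leq_trans hV; rewrite hd -addn1 leq_add2l.
have [|y hy] := IH W; first by apply: leq_trans hV; rewrite hd -add1n leq_add2r.
by exists (x + y); apply: filt_ses UVW _ _ _ _.
Qed.

Lemma filt_dim0 V x : filt V x -> mdim V = 0%N -> x = 0.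
Proof.
case=> [//|W [w0 _] h|U W X y z UWX u0 x0 _ _ h]; first by rewrite h in w0.
by move: (ses_dim UWX); rewrite h => /esym/eqP; rewrite addn_eq0 (gtn_eqF u0).
Qed.

(** Zero ends are treated apart because [filt_ses] asks for nonzero ones. Uniqueness is assumed for
    V alone, which is what an induction on the dimension can supply. *)
Lemma filt_add_of U V W a b c :
  (forall x y, filt V x -> filt V y -> x = y) ->
  ses U V W -> filt U a -> filt W b -> filt V c -> c = a + b.
Proof.
move=> uV h ha hb hc.
have [u0|u0] := posnP (mdim U).
  rewrite (filt_dim0 ha u0) add0r; apply: uV hc _.
  exact: filt_isom (isom_sym (ses_isomr h u0)) hb.
have [w0|w0] := posnP (mdim W).
  rewrite (filt_dim0 hb w0) addr0; apply: uV hc _.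
  exact: filt_isom (ses_isoml h w0) ha.
by apply: uV hc _; apply: filt_ses h u0 w0 ha hb.
Qed.

(* For U -f-> V -g-> W and U' -f'-> V -g'-> W' exact, the maps g' f : U -> W' and
   g f' : U' -> W have the same kernel and the same cokernel. *)
Lemma ses_diamond U V W U' W' : ses U V W -> ses U' V W' ->
  exists K C Q Q' : fdmod A, [/\ ses K U Q, ses Q W' C, ses K U' Q' & ses Q' W C].
Proof.
case/sesP=> f [g [[hf fi] [hg gs] fg]] /sesP [f' [g' [[hf' fi'] [hg' gs'] fg']]].
have gf := exact_mul0 fg; have gf' := exact_mul0 fg'.
have hh := modhomM hf hg'; have hh' := modhomM hf' hg.
have [K [i [[hi ii] ih]]] := modhom_ker hh.
have [C [p [[hp ps] hp0]]] := modhom_coker hh.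
have hi0 := exact_mul0 ih; have ph0 := exact_mul0 hp0.
(* The kernel K of g' f is sent by f into ker g' = im f', so it embeds in U' as well; dually p g'
   kills im f = ker g, so W maps onto C. *)
have [|i' hi' ei] := modhom_mono_factor (conj hf' fi') (modhomM hi hf).
  by move=> v; apply/fg'; rewrite !mulmxA hi0 mul0mx.
have [|p' hp' ep] := modhom_epi_factor (conj hg gs) (modhomM hg' hp).
  by move=> v /fg [u ->]; rewrite !mulmxA -(mulmxA p) ph0 mul0mx.
have [Q [KUQ QWC]] := ses_image hh (conj hi ii) ih (conj hp ps) hp0.
have [||||Q' [KUQ' QWC']] := @ses_image _ _ U' W K C (g *m f') i' p' hh'.
- split=> // u hu; apply/ii/fi; rewrite mulmxA ei -mulmxA hu mulmx0 //.
- move=> v; split=> [|[u ->]]; last first.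
    by rewrite -mulmxA (mulmxA f') -ei !mulmxA gf !mul0mx.
  rewrite -mulmxA => /fg [u hu].
  have [|w hw] := (ih u).1; first by rewrite -mulmxA -hu mulmxA gf' mul0mx.
  by exists w; apply: (inj_mulmx fi'); rewrite hu hw !mulmxA ei.
- split=> // w; have [v <-] := ps w; have [u <-] := gs' v.
  by exists (g *m u); rewrite !mulmxA -ep.
- move=> w; split=> [|[u ->]]; last first.
    by rewrite !mulmxA -ep -(mulmxA p) gf' mulmx0 mul0mx.
  have [v <-] := gs w; rewrite mulmxA -ep -mulmxA => /hp0 [u hu].
  have [|u' hu'] := (fg' (v - f *m u)).1; first by rewrite mulmxBr hu mulmxA subrr.
  exists u'; rewrite -mulmxA -hu' mulmxBr (mulmxA g) gf mul0mx subr0 //.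
by exists K, C, Q, Q'.
Qed.

Lemma filtP V x : filt V x ->
  [\/ mdim V = 0%N /\ x = 0, simple_mod V /\ x = tau V
    | exists U W y z, [/\ ses U V W, (0 < mdim U)%N, (0 < mdim W)%N, filt U y & filt W z /\ x = y + z]].
Proof.
case=> [U ?|U ?|U U' W y z ? ? ? ? ?]; [exact: Or31|exact: Or32|apply: Or33].
by exists U, W, y, z.
Qed.

(** In the diamond of the two first steps, U has the factors K and Q, W has Q' and C, U' has K and
    Q', W' has Q and C. Both sums thus consist of the same four terms, and the induction hypothesis
    applies to U, W, U' and W'. *)
Lemma filt_uniq V x y : filt V x -> filt V y -> x = y.
Proof.
have [m] := ubnP (mdim V); elim: m V x y => // m IH V x y; rewrite ltnS => hV.
have [v0 hx hy|v0] := posnP (mdim V); first by rewrite (filt_dim0 hx v0) (filt_dim0 hy v0).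
have nv : mdim V <> 0%N by move=> h; rewrite h in v0.
have ns U W : simple_mod V -> ses U V W -> (0 < mdim U)%N -> (0 < mdim W)%N -> False.
  by move=> [_ vs] /vs [] ->.
case/filtP=> [[/nv//]|[vs ->]|[U [W [x1 [x2 [UVW u0 w0 hx [hx' ->]]]]]]].
  case/filtP=> [[/nv//]|[_ ->] //|[U [W [? [? [UVW u0 w0 _ _]]]]]].
  by case: (ns U W).
case/filtP=> [[/nv//]|[vs ->]|[U' [W' [y1 [y2 [UVW' u0' w0' hy [hy' ->]]]]]]].
  by case: (ns U W).
have d1 := ses_dim UVW; have d2 := ses_dim UVW'.
have lU : (mdim U < m)%N by apply: leq_trans hV; rewrite d1 -addn1 leq_add2l.
have lW : (mdim W < m)%N by apply: leq_trans hV; rewrite d1 -add1n leq_add2r.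
have lU' : (mdim U' < m)%N by apply: leq_trans hV; rewrite d2 -addn1 leq_add2l.
have lW' : (mdim W' < m)%N by apply: leq_trans hV; rewrite d2 -add1n leq_add2r.
have [K [C [Q [Q' [s1 s2 s3 s4]]]]] := ses_diamond UVW UVW'.
have [[a ha] [b hb]] := (filt_exists K, filt_exists C).
have [[c hc] [d hd]] := (filt_exists Q, filt_exists Q').
rewrite (filt_add_of (fun a b => IH _ a b lU) s1 ha hc hx).
rewrite (filt_add_of (fun a b => IH _ a b lW) s4 hd hb hx').
rewrite (filt_add_of (fun a b => IH _ a b lU') s3 ha hd hy).
rewrite (filt_add_of (fun a b => IH _ a b lW') s2 hc hb hy').
by rewrite -!addrA; congr (_ + _); rewrite addrCA.
Qed.

(** The Jordan-Hoelder theorem in a form without multiplicities: an isomorphism invariant of simple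
    modules extends to K(A). It is applied with G = K(B) to build a left inverse of inflation. *)
Lemma simple_additive : exists phi : {additive K0 A -> G},
  forall V, simple_mod V -> phi (K0_class V) = tau V.
Proof.
have /choice [beta hb] := filt_exists.
have [|phi hphi] := @K0_lift k A G beta.
  move=> U V W h; exact: filt_add_of (@filt_uniq V) h (hb U) (hb W) (hb V).
exists phi => V hV; rewrite hphi; apply: filt_uniq (hb V) _.
exact: filt_simple.
Qed.
End JordanHolder.

Section InflationInjective.
Variables (k : fieldType) (A B : algType k) (rho : {lrmorphism A -> B}).
Hypothesis rho_surj : forall b, exists a, rho a = b.

Lemma modhom_infl (X Y : fdmod B) f :
  @modhom k A (infl rho X) (infl rho Y) f -> @modhom k B X Y f.
Proof. by move=> h b; have [a <-] := rho_surj b; apply: h. Qed.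

Lemma isom_infl (X Y : fdmod B) : isom (infl rho X) (infl rho Y) -> isom X Y.
Proof.
by case=> f [[/modhom_infl hf fi] [_ fs]]; exists f.
Qed.

(** B acts through any set-theoretic section of rho; two preimages differ by an element of ker rho
    and so act alike. *)
Lemma deflate (V : fdmod A) : (forall a, rho a = 0 -> mact V a = 0) ->
  exists X, isom (infl rho X) V.
Proof.
move=> hV; have /choice [s hs] := rho_surj.
have E a : mact V (s (rho a)) = mact V a.
  by apply/eqP; rewrite -subr_eq0 -linearB hV // linearB /= hs subrr.
have h_lin : linear (mact V \o s).
  move=> c x y; rewrite /= -[x in LHS]hs -[y in LHS]hs -linearZ -linearD /= E.
  by rewrite linearP.
have h_1 : (mact V \o s) 1 = 1%:M by rewrite /= -(rmorph1 rho) E mact1.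
have h_M x y : (mact V \o s) (x * y) = (mact V \o s) x *m (mact V \o s) y.
  by rewrite /= -{1}[x]hs -{1}[y]hs -rmorphM E mactM.
exists (@mkmod k B _ (mact V \o s) h_lin h_1 h_M).
exists 1%:M; split; split => /=.
- by move=> a; rewrite /= E mul1mx mulmx1.
- by move=> u; rewrite mul1mx.
- by move=> a; rewrite /= E mul1mx mulmx1.
- by move=> w; exists w; rewrite mul1mx.
Qed.

(** Submodules and quotients of a module killed by ker rho are killed by ker rho. *)
Lemma infl_ses_deflate (U W : fdmod A) (X : fdmod B) : ses U (infl rho X) W ->
  exists U' W', [/\ isom (infl rho U') U, isom (infl rho W') W & ses U' X W'].
Proof.
case/sesP=> f [g [[hf fi] [hg gs] fg]].
have [|U' iU] := @deflate U.
  move=> a ha; apply: (inj_mulmx fi).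
  by rewrite (hf a) /= ha linear0 mul0mx mulmx0.
have [|W' iW] := @deflate W.
  move=> a ha; apply: (surj_mulmx gs).
  by rewrite -(hg a) /= ha linear0 mul0mx mulmx0.
exists U', W'; split=> //.
case: iU => i [[hi ii] [_ is_]]; have [j [[hj ji] [_ js]]] := isom_sym iW.
apply/sesP; exists (f *m i), (j *m g); split.
- split=> [|u]; first exact: modhom_infl (modhomM hi hf).
  by rewrite -mulmxA => /fi /ii.
- split=> [|w]; first exact: modhom_infl (modhomM hg hj).
  by have [v <-] := js w; have [u <-] := gs v; exists u; rewrite mulmxA.
- move=> v; rewrite -mulmxA; split=> [/ji /fg [u ->]|[u ->]].
    by have [w <-] := is_ u; exists w; rewrite mulmxA.
  by rewrite -mulmxA (_ : g *m _ = 0) ?mulmx0 //; apply/fg; exists (i *m u).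
Qed.

Lemma K0_infl_class X : K0_infl rho (K0_class X) = K0_class (infl rho X).
Proof. exact: K0_map_class. Qed.

Lemma K0_infl_inj : injective (K0_infl rho).
Proof.
(* The class of the deflation of S if there is one, and 0 otherwise. The additive extension of [tau]
   is a left inverse of inflation, by induction on the dimension. *)
pose tau (S : fdmod A) : K0 B :=
  if pselect (exists X, isom (infl rho X) S) is left h then K0_class (sval (cid h)) else 0.
have tauE X S : isom (infl rho X) S -> tau S = K0_class X.
  move=> h; rewrite /tau; case: pselect => [h'|[]]; last by exists X.
  case: cid => Y /= hY; apply/K0_isom/isom_infl.
  exact: isom_trans hY (isom_sym h).
have [|phi hphi] := @simple_additive k A (K0 B) tau.
  move=> U V UV; have [[X hX]|nX] := pselect (exists X, isom (infl rho X) U).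
    by rewrite (tauE X) // (tauE X) //; apply: isom_trans hX UV.
  rewrite /tau; case: pselect => // ?; case: pselect => // -[X hX]; case: nX.
  by exists X; apply: isom_trans hX (isom_sym UV).
have phi_infl X : phi (K0_class (infl rho X)) = K0_class X.
  have [m] := ubnP (mdim X); elim: m X => // m IH X; rewrite ltnS => hX.
  have [v0|v0] := posnP (mdim X).
    by rewrite !K0_class0 ?raddf0.
  have [vs|/not_andP[]//] := pselect (simple_mod (infl rho X)).
    by rewrite hphi // (tauE X) //; apply: isom_refl.
  move/existsNP => [U /existsNP [W /not_implyP [UXW /not_orP [/eqP u0 /eqP w0]]]].
  rewrite -!lt0n in u0 w0.
  have [U' [W' [iU iW UX]]] := infl_ses_deflate UXW.
  have hd := ses_dim UX; have /= hU := isom_dim iU; have /= hW := isom_dim iW.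
  rewrite (K0_ses UX) (K0_ses (infl_ses rho UX)) raddfD /= !IH //.
    by apply: leq_trans hX; rewrite hd -add1n leq_add2r hU.
  by apply: leq_trans hX; rewrite hd -addn1 leq_add2l hW.
apply: (can_inj (g := phi)) => y.
elim/K0_ind: y => [|x y hx hy|X]; first by rewrite !raddf0.
  by rewrite !raddfB /= hx hy.
by rewrite K0_infl_class.
Qed.
End InflationInjective.

(** * Coinduction and the Schur functor *)

Section LinearAlgebra.
Variable k : fieldType.

Lemma linear_colmx m n (g : 'cV[k]_n -> 'cV[k]_m) : linear g ->
  exists M : 'M_(m, n), forall v, M *m v = g v.
Proof.
move=> hg; pose G : {linear 'cV[k]_n -> 'cV[k]_m} :=
  HB.pack g (GRing.isLinear.Build _ _ _ _ g hg).
exists (\matrix_(i, j) g (delta_mx j 0) i 0) => v.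
transitivity (G v) => //; rewrite [in RHS](matrix_sum_delta v) linear_sum.
apply/matrixP => i j; rewrite ord1 mxE summxE; apply: eq_bigr => a _.
by rewrite mxE big_ord1 linearZ [RHS]mxE mulrC.
Qed.

Lemma subspace_coord (E : vectType k) (P : E -> Prop) :
  P 0 -> (forall c x y, P x -> P y -> P (c *: x + y)) ->
  exists (N : nat) (g : 'cV[k]_N -> E) (f : E -> 'cV[k]_N),
  [/\ linear g, linear f, forall v, P (g v), cancel g f & forall x, P x -> g (f x) = x].
Proof.
move=> P0 PL.
(* P is a mere proposition. Take a subspace of maximal dimension inside P: adjoining a vector of P
   cannot enlarge it. *)
have [U hU] : exists U : {vspace E}, forall x, x \in U <-> P x.
  have [U [PU maxU]] : exists U : {vspace E}, (forall x, x \in U -> P x) /\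
      forall U' : {vspace E}, (forall x, x \in U' -> P x) -> (\dim U' <= \dim U)%N.
    have [||m /asboolP [U [PU dU]] hm] := @ex_maxnP (fun m => `[< exists U : {vspace E},
        (forall x, x \in U -> P x) /\ \dim U = m >]) (\dim {:E}).
    - by exists 0%N; apply/asboolP; exists 0%VS; split=> [x|]; rewrite ?dimv0 // memv0 => /eqP ->.
    - by move=> m /asboolP [U [_ <-]]; apply/dimvS/subvf.
    - exists U; split=> // U' PU'.
      by rewrite dU; apply: hm; apply/asboolP; exists U'.
  exists U => x; split=> [/PU //|Px].
  have : (\dim (U + <[x]>) <= \dim U)%N.
    apply: maxU => y /memv_addP [u uU [w /vlineP [c ->] ->]].
    by rewrite addrC; apply: PL => //; apply: PU.
  move=> hd; have /eqP -> : U == (U + <[x]>)%VS by rewrite eqEdim addvSl.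
  by rewrite memvE addvSr.
exists (\dim U), (fun v : 'cV_(\dim U) => \sum_(i < \dim U) v i 0 *: (vbasis U)`_i), (fun x => \col_i coord (vbasis U) i x).
split.
- move=> c x y; rewrite scaler_sumr -big_split /=; apply: eq_bigr => i _.
  by rewrite !mxE scalerDl scalerA.
- by move=> c x y; apply/matrixP => i j; rewrite !mxE linearP.
- move=> v; apply/hU/memv_suml => i _; apply/memvZ/vbasis_mem/mem_nth.
  by rewrite size_tuple.
- move=> v; apply/matrixP => i j; rewrite ord1 mxE coord_sum_free //.
  exact: basis_free (vbasisP U).
- move=> x /hU xU; rewrite [RHS](coord_vbasis xU).
  by apply: eq_bigr => i _; rewrite mxE.
Qed.
End LinearAlgebra.

Section Coinduction.
Variables (k : fieldType) (A : algType k) (e : Defs.idempotent A).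
Local Notation e0 := (ival e).

Definition finite_dim := exists d (c : A -> 'cV[k]_d) (b : 'cV[k]_d -> A),
  [/\ linear c, linear b, cancel c b & cancel b c].

Fact to_corner_subproof (x : A) : e0 * x * e0 \in corner_pred e.
Proof. by rewrite unfold_in !mulrA ival_id -!mulrA ival_id. Qed.
Definition to_corner (x : A) : corner e :=
  exist (fun z => z \in corner_pred e) _ (to_corner_subproof x).

Lemma to_corner_lin : linear to_corner.
Proof. by move=> c x y; apply/val_inj; rewrite /= mulrDr mulrDl -scalerAr -scalerAl. Qed.

Lemma to_cornerM (y : corner e) x : to_corner (val y * x) = y * to_corner x.
Proof. by apply/val_inj; rewrite /= !mulrA corner_mull corner_mulr. Qed.

Lemma to_corner_id : to_corner e0 = 1.
Proof. by apply/val_inj; rewrite /= !ival_id. Qed.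

Section Hom.
Variable L : fdmod (corner e).

Definition equivariant (phi : A -> 'cV[k]_(mdim L)) :=
  linear phi /\ forall (y : corner e) x, phi (val y * x) = mact L y *m phi x.

(* M is the coinduced module Hom_{eAe}(eA, L), whose elements are seen as functions
   on A that are constant along (1 - e) A. *)
Definition is_coind (M : fdmod A) (ev : 'cV[k]_(mdim M) -> A -> 'cV[k]_(mdim L)) :=
  [/\ forall x, linear (ev^~ x), forall v, equivariant (ev v),
      forall a v x, ev (mact M a *m v) x = ev v (x * a),
      forall v, (forall x, ev v x = 0) -> v = 0
    & forall phi, equivariant phi -> exists v, forall x, ev v x = phi x].

(** In coordinates of A, an equivariant map is a matrix F intertwining the left multiplications by
    eAe with the action on L ([P]). As left and right multiplications commute, F |-> F Rm(a)
    preserves this condition; it is the action of a. *)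
Lemma coind_exists : finite_dim -> exists M ev, @is_coind M ev.
Proof.
case=> d [c [b [c_lin b_lin cK bK]]].
have lmul a : exists X : 'M_d, forall x, X *m c x = c (a * x).
  have [|X hX] := @linear_colmx k _ _ (fun v => c (a * b v)).
    by move=> z x y; rewrite b_lin mulrDr -scalerAr c_lin.
  by exists X => x; rewrite hX cK.
have rmul a : exists X : 'M_d, forall x, X *m c x = c (x * a).
  have [|X hX] := @linear_colmx k _ _ (fun v => c (b v * a)).
    by move=> z x y; rewrite b_lin mulrDl -scalerAl c_lin.
  by exists X => x; rewrite hX cK.
have {lmul} /choice [Lm hLm] := lmul; have {rmul} /choice [Rm hRm] := rmul.
pose P (F : 'M[k]_(mdim L, d)) := forall y : corner e, F *m Lm (val y) = mact L y *m F.
have ext m (F F' : 'M[k]_(m, d)) : (forall x, F *m c x = F' *m c x) -> F = F'.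
  by move=> h; apply: cV_ext => v; rewrite -[v]bK.
have LRm a a' : Lm a *m Rm a' = Rm a' *m Lm a.
  by apply: ext => x; rewrite -!mulmxA !(hLm, hRm) mulrA.
have PR F a : P F -> P (F *m Rm a).
  by move=> hF y; rewrite -mulmxA -LRm mulmxA hF mulmxA.
have [||N [g [f [g_lin f_lin Pg gK fK]]]] := @subspace_coord k _ P.
- by move=> y; rewrite mul0mx mulmx0.
- by move=> z F F' hF hF' y; rewrite mulmxDl mulmxDr -scalemxAl -scalemxAr hF hF'.
have act a : exists X : 'M_N, forall v, X *m v = f (g v *m Rm a).
  apply: linear_colmx => z x y.
  by rewrite g_lin mulmxDl -scalemxAl f_lin.
have {act} /choice [act hact] := act.
have act_lin : linear act.
  move=> z x y; apply: cV_ext => v; rewrite mulmxDl -scalemxAl !hact.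
  rewrite -f_lin; congr f; apply: ext => u.
  by rewrite mulmxDl -scalemxAl -!mulmxA !hRm mulrDr -scalerAr c_lin mulmxDr -scalemxAr.
have act_1 : act 1 = 1%:M.
  apply: cV_ext => v; rewrite hact mul1mx -[RHS]gK; congr f; apply: ext => u.
  by rewrite -mulmxA hRm mulr1.
have act_M x y : act (x * y) = act x *m act y.
  apply: cV_ext => v; rewrite -mulmxA !hact (fK (_ *m _)); last exact: PR.
  by congr f; apply: ext => u; rewrite -!mulmxA !hRm mulrA.
exists (mkmod act_lin act_1 act_M), (fun v x => g v *m c x); split=> /=.
- by move=> x z u v; rewrite g_lin mulmxDl -scalemxAl.
- move=> v; split=> [z x y|y x]; first by rewrite c_lin mulmxDr -scalemxAr.
  by rewrite -hLm mulmxA Pg mulmxA.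
- by move=> a v x; rewrite hact fK; [rewrite -mulmxA hRm | exact: PR].
- move=> v hv; rewrite -[v]gK (ext _ (g v) 0) => [|x]; last by rewrite hv mul0mx.
  by have := f_lin (-1) 0 0; rewrite scaler0 addr0 scaleN1r addNr.
- move=> phi [phi_lin phi_eq].
  have [|F hF] := @linear_colmx k _ _ (phi \o b).
    by move=> z x y; rewrite /= b_lin phi_lin.
  have PF : P F.
    by move=> y; apply: ext => x; rewrite -!mulmxA hLm !hF /= !cK phi_eq.
  by exists (f F) => x; rewrite fK // hF /= cK.
Qed.

Variables (M : fdmod A) (ev : 'cV[k]_(mdim M) -> A -> 'cV[k]_(mdim L)).
Hypothesis hM : @is_coind M ev.

Lemma coind_e v x : ev v (e0 * x) = ev v x.
Proof. by case: hM => _ /(_ v) [_ h] _ _ _; have := h 1 x; rewrite mact1 mul1mx. Qed.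

(** phi(xe) = phi(exe) = exe phi(e), because phi ignores (1 - e) A. Thus e phi is determined by the
    single vector phi(e). *)
Lemma coind_corner v x : ev v (x * e0) = mact L (to_corner x) *m ev v e0.
Proof.
case: hM => _ /(_ v) [_ h] _ _ _; rewrite -h -coind_e /=.
by rewrite -!mulrA ival_id.
Qed.

Lemma equivariant_corner u : equivariant (fun x => mact L (to_corner x) *m u).
Proof.
split=> [z x y|y x]; first by rewrite to_corner_lin linearP mulmxDl -scalemxAl.
by rewrite to_cornerM mactM mulmxA.
Qed.
End Hom.

(** All that matters of the coordinates on eV is an inclusion C and a projection R. Later proofs
    generalise over these data, so the chosen bases disappear. *)
Lemma schurE (V : fdmod A) :
  exists (C : 'M_(mdim V, mdim (schur e V))) (R : 'M_(mdim (schur e V), mdim V)),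
  [/\ R *m C = 1%:M, C *m R = mact V e0
    & forall y, mact (schur e V) y *m R = R *m mact V (val y)].
Proof.
exists (col_base (mact V e0)), (row_base (mact V e0)).
have CR := mulmx_base (mact V e0); have RC := row_col_base e V.
split=> // y.
change (corner_act V y *m row_base (mact V e0) = row_base (mact V e0) *m mact V (val y)).
rewrite /corner_act.
by rewrite -mulmxA CR -mulmxA -mactM corner_mulr.
Qed.

(** The isomorphism is phi |-> phi(e); its inverse sends w to x |-> exe w. *)
Lemma schur_coind L M ev : @is_coind L M ev -> isom (schur e M) L.
Proof.
move=> hM; have [C [R [RC CR actR]]] := schurE M.
move: (schur e M) C R RC CR actR => S C R RC CR actR.
have eC m (u : 'M_(_, m)) : mact M e0 *m (C *m u) = C *m u.
  by rewrite -CR -mulmxA (mulmxA R) RC mul1mx.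
have [ev_lin ev_eq ev_act ev_inj ev_surj] := hM.
have [|h hh] := @linear_colmx k _ _ (fun u => ev (C *m u) e0).
  by move=> z x y; rewrite mulmxDr -scalemxAr ev_lin.
have hmod : @modhom k _ S L h.
  move=> y; apply: cV_ext => u; rewrite -!mulmxA !hh.
  have -> : C *m (mact S y *m u) = mact M (val y) *m (C *m u).
    rewrite -[u]mul1mx -RC -mulmxA (mulmxA _ R) actR (mulmxA R) RC mul1mx !mulmxA CR.
    by rewrite -mactM corner_mull.
  rewrite ev_act corner_mull -[val y]corner_mulr (coind_corner hM).
  by rewrite (_ : to_corner _ = y) //; apply/val_inj; rewrite /= corner_mull corner_mulr.
exists h; split; split=> //.
- move=> u; rewrite hh => hu; rewrite -[u]mul1mx -RC -mulmxA.
  suff -> : C *m u = 0 by rewrite mulmx0.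
  by apply: ev_inj => x; rewrite -eC ev_act (coind_corner hM) hu mulmx0.
- move=> w; have [v hv] := ev_surj _ (equivariant_corner w).
  exists (R *m v); rewrite hh mulmxA CR ev_act ival_id hv.
  by rewrite to_corner_id mact1 mul1mx.
Qed.

Section Serre.
Variable P : zmodClosed (K0 A).
Hypothesis Pkill : forall C : fdmod A, mact C e0 = 0 -> K0_class C \in P.

(** [X] - [Y] = [ker h] - [coker h], and the two conditions say that e kills the kernel and the
    cokernel. *)
Lemma K0_diff_mem X Y h : @modhom k A X Y h ->
  (forall v : 'cV_(mdim X), h *m v = 0 -> mact X e0 *m v = 0) ->
  (forall w : 'cV_(mdim Y), exists v, mact Y e0 *m w = h *m v) ->
  K0_class X - K0_class Y \in P.
Proof.
move=> hh hker hcoker; have [K [i [[hi ii] ih]]] := modhom_ker hh.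
have [C [p [[hp ps] php]]] := modhom_coker hh.
have [Q [KXQ QYC]] := ses_image hh (conj hi ii) ih (conj hp ps) php.
rewrite (K0_ses KXQ) (K0_ses QYC) (addrC (K0_class Q) (K0_class C)) opprD addrACA subrr addr0.
apply: rpredB; apply: Pkill.
  apply: cV_ext => v; rewrite mul0mx; apply: ii; rewrite mulmxA hi -mulmxA; apply: hker.
  by apply/ih; exists v.
apply: (surj_mulmx ps); rewrite -hp mul0mx; apply: cV_ext => w.
by have [v hv] := hcoker w; rewrite -mulmxA hv mulmxA (exact_mul0 php) !mul0mx.
Qed.

(** The map is the unit of the adjunction, v |-> (x |-> e x v). Evaluation at x = 1 shows that its
    kernel is killed by e, and e phi is the image of phi(e), so its cokernel is too. *)
Lemma unit_coind (V : fdmod A) M ev : @is_coind (schur e V) M ev ->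
  K0_class V - K0_class M \in P.
Proof.
have [C [R [RC CR actR]]] := schurE V.
move: (schur e V) C R RC CR actR M ev => S C R RC CR actR M ev hM.
have [ev_lin ev_eq ev_act ev_inj ev_surj] := hM.
have ev_ext v w : (forall x, ev v x = ev w x) -> v = w.
  move=> h; apply/eqP; rewrite -subr_eq0 addrC -scaleN1r; apply/eqP/ev_inj => x.
  by rewrite ev_lin h scaleN1r addNr.
have /choice [F hF] : forall v, exists w, forall x, ev w x = R *m (mact V x *m v).
  move=> v; apply: ev_surj; split=> [z x y|y x].
    by rewrite linearP /= mulmxDl mulmxDr -scalemxAl -scalemxAr.
  by rewrite mactM -!mulmxA (mulmxA (mact _ y)) actR -mulmxA.
have [|h hh] := @linear_colmx k _ _ F.
  move=> z x y; apply: ev_ext => u; rewrite ev_lin !hF.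
  by rewrite !mulmxDr -!scalemxAr.
have RP : R *m mact V e0 = R by rewrite -CR mulmxA RC mul1mx.
apply: (@K0_diff_mem _ _ h).
- move=> a; apply: cV_ext => v; rewrite -!mulmxA !hh; apply: ev_ext => x.
  by rewrite ev_act !hF mactM -!mulmxA.
- move=> v hv; have := hF v 1; rewrite -hh hv mact1 mul1mx => /(congr1 (mulmx C)).
  rewrite mulmxA CR => <-; have := ev_lin 1 (-1) 0 0.
  by rewrite scaler0 addr0 scaleN1r addNr => ->; rewrite mulmx0.
- move=> w; exists (C *m ev w e0); rewrite hh; apply: ev_ext => x.
  rewrite ev_act hF (coind_corner hM) !mulmxA; congr (_ *m _).
  have -> : R *m mact V x = mact S (to_corner x) *m R + R *m (mact V x - mact V (x * e0)).
    rewrite actR /= -mulrA mactM mulmxA RP -mulmxDr addrC subrK //.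
  rewrite mulmxDl -mulmxA RC mulmx1 mactM mulmxBr mulmxBl -!mulmxA.
  by rewrite -CR -!mulmxA RC mulmx1 subrr addr0.
Qed.

(** Coinduction is left exact ([FG], [Finj]); surjectivity may fail, but only by a cokernel killed
    by e. *)
Lemma ses_coind L1 L2 L3 M1 M2 M3 ev1 ev2 ev3 : ses L1 L2 L3 ->
  @is_coind L1 M1 ev1 -> @is_coind L2 M2 ev2 -> @is_coind L3 M3 ev3 ->
  K0_class M2 - K0_class M1 - K0_class M3 \in P.
Proof.
case/sesP=> f [g [[hf fi] [hg gs] fg]] h1 h2 h3.
have ev_ext L M ev (hM : @is_coind L M ev) v w : (forall x, ev v x = ev w x) -> v = w.
  case: hM => ev_lin _ _ ev_inj _.
  move=> h; apply/eqP; rewrite -subr_eq0 addrC -scaleN1r; apply/eqP/ev_inj => x.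
  by rewrite ev_lin h scaleN1r addNr.
have ev0 L M ev (hM : @is_coind L M ev) x : ev 0 x = 0.
  case: hM => ev_lin _ _ _ _; have := ev_lin x (-1) 0 0.
  by rewrite scaler0 addr0 scaleN1r addNr.
have push L M ev L' M' ev' u : @is_coind L M ev -> @is_coind L' M' ev' ->
    @modhom k _ L L' u ->
    exists2 h, @modhom k A M M' h & forall v x, ev' (h *m v) x = u *m ev v x.
  move=> hM hM' hu; have [ev_lin ev_eq ev_act _ _] := hM.
  have [ev_lin' _ ev_act' _ ev_surj'] := hM'.
  have /choice [F hF] : forall v, exists w, forall x, ev' w x = u *m ev v x.
    move=> v; apply: ev_surj'; split=> [z x y|y x].
      by rewrite (ev_eq v).1 mulmxDr -scalemxAr.
    by rewrite (ev_eq v).2 !mulmxA hu.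
  have [|h hh] := @linear_colmx k _ _ F.
    move=> z x y; apply: (ev_ext _ _ _ hM') => w; rewrite ev_lin' !hF ev_lin.
    by rewrite !mulmxDr -!scalemxAr.
  exists h => [a|v x]; last by rewrite hh.
  apply: cV_ext => v; rewrite -!mulmxA !hh; apply: (ev_ext _ _ _ hM') => x.
  by rewrite ev_act' !hF ev_act.
have [F hF evF] := push _ _ _ _ _ _ _ h1 h2 hf.
have [G hG evG] := push _ _ _ _ _ _ _ h2 h3 hg.
have [l lf] := mulmx_injP fi; have [s gs1] := mulmx_surjP gs.
have FG : exactm F G.
  move=> v; split=> [Gv|[u ->]]; last first.
    apply: (ev_ext _ _ _ h3) => x; rewrite evG evF mulmxA (exact_mul0 fg).
    by rewrite mul0mx (ev0 _ _ _ h3).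
  have im x : ev2 v x = f *m (l *m ev2 v x).
    have [|u ->] := (fg (ev2 v x)).1; first by rewrite -evG Gv (ev0 _ _ _ h3).
    by rewrite (mulmxA l) lf mul1mx.
  have [_ /(_ v) [v_lin v_eq] _ _ _] := h2; have [_ _ _ _ surj1] := h1.
  have [|u hu] := surj1 (fun x => l *m ev2 v x).
    split=> [z x y|y x]; first by rewrite v_lin mulmxDr -scalemxAr.
    by apply: (inj_mulmx fi); rewrite -im v_eq mulmxA hf -mulmxA -im.
  by exists u; apply: (ev_ext _ _ _ h2) => x; rewrite evF hu -im.
have Finj (v : 'cV_(mdim M1)) : F *m v = 0 -> v = 0.
  move=> hv; case: (h1) => _ _ _ ev_inj _; apply: ev_inj => x; apply: fi.
  by rewrite -evF hv (ev0 _ _ _ h2).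
have [Q [p [[hp ps] Fp]]] := modhom_coker hF.
have s12 : ses M1 M2 Q by apply/sesP; exists F, p.
have [|h hh eG] := modhom_epi_factor (conj hp ps) hG.
  by move=> v /Fp [u ->]; rewrite mulmxA (exact_mul0 FG) mul0mx.
rewrite (K0_ses s12) (addrC (K0_class M1)) addrK; apply: (K0_diff_mem hh).
- move=> q hq; have [v ev] := ps q; move: hq; rewrite -ev mulmxA -eG => /FG hv.
  by rewrite (Fp v).2 // mulmx0.
(* e w is the function x |-> exe w(e). Lift w(e) to L2 by the linear section s; the function x |->
   exe s(w(e)) maps to e w. *)
- move=> w; have [_ _ _ _ surj2] := h2; have [_ _ ev_act3 _ _] := h3.
  have [v hv] := surj2 _ (equivariant_corner (s *m ev3 w e0)).
  exists (p *m v); rewrite mulmxA -eG; apply: (ev_ext _ _ _ h3) => x.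
  rewrite evG hv ev_act3 (coind_corner h3) !mulmxA hg.
  by rewrite -(mulmxA _ g) gs1 mulmx1.
Qed.

Lemma K0_schur_class V : K0_schur e (K0_class V) = K0_class (schur e V).
Proof. exact: K0_map_class. Qed.

Hypothesis fdA : finite_dim.

(** Coinduction induces phi : K(eAe) -> K(A)/P by [ses_coind], and by [unit_coind] the composite of
    F and phi is the projection. *)
Lemma K0_schur_ker x : K0_schur e x = 0 -> x \in P.
Proof.
have /choice [J hJ] := fun L => coind_exists L fdA.
have [|phi hphi] := @K0_lift k _ (Quotient.quot P)
    (fun L => (\pi_(Quotient.quot P) (K0_class (J L)))%qT).
  move=> L1 L2 L3 h; apply/eqP.
  have [[ev1 h1] [ev2 h2]] := (hJ L1, hJ L2); have [ev3 h3] := hJ L3.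
  by rewrite -raddfD /= -Quotient.idealrBE opprD addrA; apply: ses_coind h h1 h2 h3.
have phiF y : phi (K0_schur e y) = (\pi_(Quotient.quot P) y)%qT.
  elim/K0_ind: y => [|y z hy hz|V]; first by rewrite !raddf0.
    by rewrite !raddfB /= hy hz.
  rewrite K0_schur_class hphi; apply/eqP; rewrite eq_sym -Quotient.idealrBE.
  by have [ev h] := hJ (schur e V); apply: unit_coind h.
move=> hx; have := phiF x; rewrite hx raddf0 => /esym/eqP.
by rewrite -(raddf0 (\pi_(Quotient.quot P))%qT) -Quotient.idealrBE subr0.
Qed.
End Serre.

Lemma K0_schur_surj : finite_dim -> forall y, exists x, K0_schur e x = y.
Proof.
move=> fdA; elim/K0_ind => [|_ _ [x <-] [y <-]|L]; first by exists 0; rewrite raddf0.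
  by exists (x - y); rewrite raddfB.
have [M [ev h]] := coind_exists L fdA; exists (K0_class M).
rewrite K0_schur_class.
exact: K0_isom (schur_coind h).
Qed.
End Coinduction.

(** * The q-Schur algebra is closed under products *)

Section Swap.
Variables (T : Type) (p : nat).

Definition swap_at (s : seq T) : seq T :=
  if drop p s is x :: y :: v then take p s ++ y :: x :: v else s.

Lemma swap_at_cat u x y v : size u = p -> swap_at (u ++ x :: y :: v) = u ++ y :: x :: v.
Proof. by move=> hu; rewrite /swap_at -hu drop_size_cat // take_size_cat. Qed.

Lemma split_at2 (s : seq T) : (p.+1 < size s)%N ->
  exists u x y v, s = u ++ x :: y :: v /\ size u = p.
Proof.
move=> h; have := size_drop p s; have := cat_take_drop p s.
case: (drop p s) => [|x [|y v]] /= e hs; [lia|lia|].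
exists (take p s), x, y, v; rewrite e size_take; split=> //.
by rewrite (ltn_trans _ h).
Qed.

Lemma size_swap_at s : size (swap_at s) = size s.
Proof.
rewrite /swap_at; case E: (drop p s) => [|x [|y v]] //.
by rewrite -[s in RHS](cat_take_drop p) E !size_cat.
Qed.

Definition swap_tuple r (t : r.-tuple T) : r.-tuple T :=
  Tuple (introT eqP (etrans (size_swap_at t) (size_tuple t))).

Lemma swap_tupleK r : (p.+1 < r)%N -> involutive (@swap_tuple r).
Proof.
move=> hp t; apply: val_inj => /=.
have [|u [x [y [v [-> hu]]]]] := @split_at2 t; first by rewrite size_tuple.
by rewrite !swap_at_cat.
Qed.
End Swap.

Section QSchurAlgebra.
Variables (k : fieldType) (eps : k) (n r : nat).
Local Notation wdual := (wdual k n r).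
Local Notation letter := (letter n).
Local Notation windex := (windex n r).
Local Notation q := (eps ^+ 2).

Definition at_pos (p : nat) (t : windex) : 'I_n.+1 := nth ord0 t p.

Lemma at_pos_cat p (t : windex) u x y v : tval t = u ++ x :: y :: v -> size u = p ->
  [/\ at_pos p t = x, at_pos p.+1 t = y & tval (swap_tuple p t) = u ++ y :: x :: v].
Proof.
move=> et hu; rewrite /at_pos /= et swap_at_cat //; split=> //.
  by rewrite nth_cat hu ltnn subnn.
by rewrite nth_cat hu ltnNge leqnSn subSnn.
Qed.

(** The relations in terms of row and column tuples, which can be permuted separately: the form that
    suits the convolution product. *)
Definition qrel (f : wdual) := forall p (I t : windex), (p.+1 < r)%N ->
  [/\ at_pos p I = at_pos p.+1 I -> f (word I t) = f (word I (swap_tuple p t)),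
      (at_pos p.+1 I < at_pos p I)%N -> (at_pos p t <= at_pos p.+1 t)%N ->
        f (word I t) = q * f (word (swap_tuple p I) (swap_tuple p t))
    & (at_pos p.+1 I < at_pos p I)%N -> (at_pos p.+1 t < at_pos p t)%N ->
        f (word I t) = (q - 1) * f (word (swap_tuple p I) t)
           + f (word (swap_tuple p I) (swap_tuple p t))].

Lemma zip_cat2 (u1 u2 v1 v2 : seq 'I_n.+1) x1 x2 y1 y2 : size u1 = size u2 ->
  zip (u1 ++ x1 :: y1 :: v1) (u2 ++ x2 :: y2 :: v2)
   = zip u1 u2 ++ [:: (x1, x2); (y1, y2)] ++ zip v1 v2.
Proof. by move=> h; rewrite zip_cat. Qed.

Lemma qrelP f : in_qschur eps f <-> qrel f.
Proof.
split=> [hf p I t hp|hf u v].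
  have [|u1 [i [a [v1 [eI hu1]]]]] := @split_at2 _ p I; first by rewrite size_tuple.
  have [|u2 [c [d [v2 [et hu2]]]]] := @split_at2 _ p t; first by rewrite size_tuple.
  have [-> -> sI] := at_pos_cat eI hu1; have [-> -> st] := at_pos_cat et hu2.
  have e12 : size u1 = size u2 by rewrite hu1.
  rewrite -!weval_tuple /= eI et !swap_at_cat // !zip_cat2 //.
  have [r1 r2 r3] := hf (zip u1 u2) (zip v1 v2).
  by split=> [<-|h1 h2|h1 h2]; [exact: r1|exact: r2|exact: r3].
have [sz|nsz] := eqVneq (size u + (size v).+2)%N r; last first.
  have w0 x y : weval f (u ++ [:: x; y] ++ v) = 0 by rewrite weval_size ?size_cat.
  by split=> *; rewrite !w0 ?mulr0 ?addr0.
have sI i a : size (unzip1 u ++ i :: a :: unzip1 v) == r by rewrite size_cat /= !size_map sz.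
have sJ i a : size (unzip2 u ++ i :: a :: unzip2 v) == r by rewrite size_cat /= !size_map sz.
pose I i a : windex := Tuple (sI i a); pose J i a : windex := Tuple (sJ i a).
have sI' i a : swap_tuple (size u) (I i a) = I a i.
  by apply: val_inj => /=; rewrite swap_at_cat ?size_map.
have sJ' i a : swap_tuple (size u) (J i a) = J a i.
  by apply: val_inj => /=; rewrite swap_at_cat ?size_map.
have E i j a b : weval f (u ++ [:: (i, j); (a, b)] ++ v) = f (word (I i a) (J j b)).
  by rewrite -weval_tuple /= zip_cat2 ?size_map // !zip_unzip.
have hp : ((size u).+1 < r)%N by lia.
have H i j a b : [/\ i = a -> f (word (I i a) (J j b)) = f (word (I i a) (J b j)),
      (a < i)%N -> (j <= b)%N -> f (word (I i a) (J j b)) = q * f (word (I a i) (J b j))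
    & (a < i)%N -> (b < j)%N -> f (word (I i a) (J j b))
       = (q - 1) * f (word (I a i) (J j b)) + f (word (I a i) (J b j))].
  have [h1 h2 h3] := hf (size u) (I i a) (J j b) hp; move: h1 h2 h3; rewrite sI' sJ'.
  have su1 : size (unzip1 u) = size u by rewrite size_map.
  have su2 : size (unzip2 u) = size u by rewrite size_map.
  have [-> -> _] := @at_pos_cat (size u) (I i a) _ _ _ _ erefl su1.
  by have [-> -> _] := @at_pos_cat (size u) (J j b) _ _ _ _ erefl su2.
split=> [i j m|i j a b h1 h2|i j a b h1 h2]; rewrite !E.
- by have [-> ] := H i j i m.
- by have [_ -> ] := H i j a b.
- by have [_ _ ->] := H i j a b.
Qed.

Hypothesis eps0 : eps != 0.

Lemma wdualM (f g : wdual) I J : (f * g) (word I J) = \sum_(t : windex) f (word I t) * g (word t J).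
Proof. by rewrite ffunE rows_word cols_word. Qed.

(** The relations at p express that f commutes with the Hecke operator T_p on positions p and p+1,
    and a product of commuting matrices commutes again. Here [h J t] is the entry (t, J) of T_p g,
    and [sumh] moves T_p across f. *)
Lemma qrelM f g : qrel f -> qrel g -> qrel (f * g).
Proof.
move=> hf hg p I J hp; rewrite !wdualM.
have q0 : q != 0 by rewrite expf_neq0.
have sK := @swap_tupleK 'I_n.+1 p r hp; set s := @swap_tuple _ p r in sK *.
have ats t : at_pos p (s t) = at_pos p.+1 t /\ at_pos p.+1 (s t) = at_pos p t.
  have [|u [x [y [v [et hu]]]]] := @split_at2 _ p t; first by rewrite size_tuple.
  have [-> -> es] := at_pos_cat et hu.
  by have [-> -> _] := at_pos_cat es hu.
have s_eq t : at_pos p t = at_pos p.+1 t -> s t = t.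
  have [|u [x [y [v [et hu]]]]] := @split_at2 _ p t; first by rewrite size_tuple.
  have [-> -> es] := at_pos_cat et hu => exy; apply: val_inj.
  by rewrite [LHS]es [RHS]et exy.
(* [h J t] is the coefficient of [f (word (s I) t)] in the sum once the relations
   of f have been used to move the row index I to s I. *)
pose h (J t : windex) := if (at_pos p t < at_pos p.+1 t)%N then g (word (s t) J)
  else if at_pos p t == at_pos p.+1 t :> nat then q * g (word t J)
  else q * g (word (s t) J) + (q - 1) * g (word t J).
have sumh : (at_pos p.+1 I < at_pos p I)%N ->
    \sum_t f (word I t) * g (word t J) = \sum_t f (word (s I) t) * h J t.
  move=> hI.
  pose F1 t := (if (at_pos p t <= at_pos p.+1 t)%N then q else 1) * f (word (s I) (s t)) * g (word t J).
  pose F2 t := (if (at_pos p t <= at_pos p.+1 t)%N then 0 else q - 1) * f (word (s I) t) * g (word t J).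
  transitivity (\sum_t F1 t + \sum_t F2 t).
    rewrite -big_split; apply: eq_bigr => t _ /=; rewrite /F1 /F2.
    have [_ h2 h3] := hf p I t hp; case: ltnP => hlt; first by rewrite h3 // mul1r mulrDl addrC.
    by rewrite h2 // !mul0r addr0.
  rewrite [X in X + _](reindex_inj (inv_inj sK)) -big_split; apply: eq_bigr => t _ /=.
  rewrite /F1 /F2 /h; have [-> ->] := ats t; rewrite sK.
  case: (ltngtP (at_pos p t) (at_pos p.+1 t)) => ht.
  - by ring.
  - by ring.
  - by rewrite (s_eq t (val_inj ht)); ring.
(* The identity T_p g = g T_p, read off in the column K. *)
have hgt K t : [/\ (at_pos p K <= at_pos p.+1 K)%N -> h K t = q * g (word t (s K))
    & (at_pos p.+1 K < at_pos p K)%N -> h K t = (q - 1) * g (word t K) + g (word t (s K))].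
  have [r1 r2 r3] := hg p t K hp; have [r1' r2' r3'] := hg p (s t) K hp.
  have [q1 q2 q3] := hg p t (s K) hp; have [q1' q2' q3'] := hg p (s t) (s K) hp.
  have [a1 a2] := ats t; have [b1 b2] := ats K.
  move: r1 r2 r3 r1' r2' r3' q1 q2 q3 q1' q2' q3'; rewrite -!/s !sK !a1 !a2 !b1 !b2 /h.
  move=> r1 r2 r3 r1' r2' r3' q1 q2 q3 q1' q2' q3'.
  case: (ltngtP (at_pos p t) (at_pos p.+1 t)) => ht.
  - by split=> hJ; [rewrite r2'|rewrite r3'].
  - split=> hJ.
      move: hJ; rewrite leq_eqVlt => /orP [/eqP/val_inj eJ|hJ].
        have sJ : s K = K by apply: s_eq.
        by rewrite sJ in q2 *; rewrite q2 ?eJ //; ring.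
      by rewrite (q3 ht hJ) (r2 ht (ltnW hJ)); ring.
    by rewrite (q2 ht (ltnW hJ)); ring.
  - by have et := val_inj ht; rewrite -(q1 et); split=> // _; ring.
(* When the two row letters agree, the row f(I, _) is an eigenvector of T_p with eigenvalue q: the
   differences at t and at its swap cancel. *)
have sym J' : at_pos p I = at_pos p.+1 I -> \sum_t f (word I t) * h J' t = q * \sum_t f (word I t) * g (word t J').
  move=> eI; apply/eqP; rewrite big_distrr -subr_eq0 -sumrB /=; apply/eqP.
  pose D t := f (word I t) * (h J' t - q * g (word t J')).
  pose Dl t := if (at_pos p t < at_pos p.+1 t)%N then D t else 0.
  pose Dg t := if (at_pos p.+1 t < at_pos p t)%N then D t else 0.
  transitivity (\sum_t Dl t + \sum_t Dg t).
    rewrite -big_split; apply: eq_bigr => t _ /=; rewrite /Dl /Dg /D /h.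
    by case: (ltngtP (at_pos p t) (at_pos p.+1 t)) => ht; ring.
  rewrite [X in _ + X](reindex_inj (inv_inj sK)) -big_split; apply: big1 => t _ /=.
  rewrite /Dl /Dg /D; have [-> ->] := ats t; case: ifP => ht; last by rewrite addr0.
  have [/(_ eI) e _ _] := hf p I t hp; rewrite -[swap_tuple p t]/(s t) in e.
  rewrite /h sK ht; have [-> ->] := ats t; rewrite -e (ltnNge _ (at_pos p t)) (ltnW ht) (gtn_eqF ht) /=; ring.
split=> [eI|hI hJ|hI hJ].
- have main K : (at_pos p K <= at_pos p.+1 K)%N ->
      \sum_t f (word I t) * g (word t K) = \sum_t f (word I t) * g (word t (s K)).
    move=> hK; apply: (mulfI q0); rewrite -(sym K eI) big_distrr /=; apply: eq_bigr => t _.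
    by have [-> // _] := hgt K t; ring.
  case: (leqP (at_pos p J) (at_pos p.+1 J)) => hJ; first exact: main.
  by have [aJ bJ] := ats J; rewrite -{1}(sK J) -main // aJ bJ ltnW.
- rewrite sumh // big_distrr /=; apply: eq_bigr => t _.
  by have [-> // _] := hgt J t; ring.
- rewrite sumh // big_distrr /= -big_split /=; apply: eq_bigr => t _.
  by have [_ -> //] := hgt J t; ring.
Qed.
End QSchurAlgebra.

(** * The root generators as matrices *)

Section Transvection.
Variables (k : fieldType) (eps : k) (n : nat).
Local Notation letter := (letter n).
Local Notation q := (eps ^+ 2).

Definition diagl (x : letter) : bool := x.1 == x.2.

(* The matrix coefficient (s.1, s.2) of the sum over all positions of the operators
   z^h (x) ... (x) z^h (x) E_ab (x) 1 (x) ... (x) 1, where z^h = diag(1, .., z, .., 1)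
   with z in position b. *)
Fixpoint tv (a b : 'I_n.+1) (z : k) (s : seq letter) : k :=
  if s is x :: s' then (x == (a, b))%:R * (all diagl s')%:R
     + (diagl x)%:R * z ^+ (x.2 == b) * tv a b z s' else 0.

Lemma tv_cat a b z s t : tv a b z (s ++ t) =
  tv a b z s * (all diagl t)%:R
   + (all diagl s)%:R * z ^+ count_mem b (unzip2 s) * tv a b z t.
Proof.
elim: s => [|x s IH] /=; first by rewrite mul0r add0r !mul1r.
rewrite IH all_cat -!mulnb !natrM exprD; ring.
Qed.

(** z = q belongs to the generators E and z = 1/q to the generators F. These values are forced by
    the relation with the factor q, as [tv2_le] shows. *)
Definition adjacent (a b : 'I_n.+1) (z : k) :=
  (b = a.+1 :> nat /\ z = q) \/ (a = b.+1 :> nat /\ z = q^-1).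

Definition seqfun r (F : seq letter -> k) : wdual k n r := [ffun w : r.-tuple letter => F w].

Lemma weval_seqfun r F s : weval (seqfun r F) s = (size s == r)%:R * F s.
Proof.
have [e|h] := eqVneq (size s) r; last by rewrite weval_size // mul0r.
pose w : r.-tuple letter := Tuple (introT eqP e).
by rewrite -[s]/(tval w) weval_tuple ffunE mul1r.
Qed.

Variables (r : nat) (phi : seq 'I_n.+1 -> k).
Hypothesis phi_perm : forall s t, perm_eq s t -> phi s = phi t.

Lemma perm_swap (T : eqType) (u v : seq T) x y : perm_eq (u ++ [:: x; y] ++ v) (u ++ [:: y; x] ++ v).
Proof. by rewrite perm_cat2l perm_cat2r (perm_catC [:: x] [:: y]). Qed.

Lemma in_qschur_diag : in_qschur eps (seqfun r (fun s => phi (unzip2 s) * (all diagl s)%:R)).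
Proof.
move=> u v; rewrite /unzip2; split=> [i j m|i j a b h1 h2|i j a b h1 h2];
  rewrite !weval_seqfun !size_cat /= !map_cat /= !all_cat /= /diagl /= -!val_eqE /=.
- rewrite (phi_perm (perm_swap _ _ m j)); congr (_ * (_ * _%:R)).
  by rewrite (andbCA (i == j :> nat)).
- rewrite (_ : [&& i == j :> nat, _ & _] = false) ?andbF ?mulr0; last by lia.
  by rewrite (_ : [&& a == b :> nat, _ & _] = false) ?andbF ?mulr0 //; lia.
- rewrite (phi_perm (perm_swap _ _ b j)) (andbCA (a == b :> nat)).
  rewrite (_ : [&& a == j :> nat, _ & _] = false) ?andbF ?mulr0 ?add0r //; lia.
Qed.

Hypothesis eps0 : eps != 0.

(** The relations exchange two neighbouring letters, so by [tv_cat2] they need only be checked on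
    words of length two. *)
Let tv2 a b z (x y : letter) : k :=
  (x == (a, b))%:R * (diagl y)%:R + (diagl x)%:R * z ^+ (x.2 == b) * (y == (a, b))%:R.

Let tv_cat2 a b z u x y v : tv a b z (u ++ [:: x; y] ++ v) =
  tv a b z u * (diagl x && diagl y)%:R * (all diagl v)%:R
   + (all diagl u)%:R * z ^+ count_mem b (unzip2 u) *
      (tv2 a b z x y * (all diagl v)%:R
        + (diagl x && diagl y)%:R * z ^+ ((x.2 == b) + (y.2 == b)) * tv a b z v).
Proof.
rewrite !tv_cat /= !andbT addn0 andbA -[in LHS]mulnb natrM /tv2; ring.
Qed.

Ltac bool_cases a b i j c d :=
  case E1 : ((i == a :> nat) && (j == b :> nat)); case E2 : (c == d :> nat);
  case E3 : (i == j :> nat); case E4 : ((c == a :> nat) && (d == b :> nat));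
  case E5 : (j == b :> nat); case E6 : (d == b :> nat).

Let tv2E a b z i j c d : tv2 a b z (i, j) (c, d) =
  ((i == a :> nat) && (j == b :> nat))%:R * (c == d :> nat)%:R
  + (i == j :> nat)%:R * z ^+ (j == b :> nat) * ((c == a :> nat) && (d == b :> nat))%:R.
Proof. by []. Qed.

Let tv2_row a b z i j m : adjacent a b z -> tv2 a b z (i, j) (i, m) = tv2 a b z (i, m) (i, j).
Proof.
move=> hab; have {}hab : (a : nat) <> b by case: hab => -[]; lia.
by rewrite !tv2E; bool_cases a b i j i m; try (exfalso; lia); rewrite /=; ring.
Qed.

(** For a nonzero value one letter is (a, b) and the other diagonal; the inequalities force the
    latter to be (b, b). The factor z appears in exactly one of the two orders. *)
Let tv2_le a b z (i j c d : 'I_n.+1) : adjacent a b z -> (c < i)%N -> (j <= d)%N ->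
  tv2 a b z (i, j) (c, d) = q * tv2 a b z (c, d) (i, j).
Proof.
have q0 : q != 0 by rewrite expf_neq0.
by case=> -[hab ->] h1 h2; rewrite !tv2E; bool_cases a b i j c d; try (exfalso; lia);
  rewrite /= ?expr0 ?expr1; field.
Qed.

(** The correction term of the third relation vanishes by adjacency: if one of (c, j) and (i, d) is
    diagonal, the row and the column of the other differ by at least 2. *)
Let tv2_gt a b z (i j c d : 'I_n.+1) : adjacent a b z -> (c < i)%N -> (d < j)%N ->
  tv2 a b z (i, j) (c, d) = tv2 a b z (c, d) (i, j) /\ tv2 a b z (c, j) (i, d) = 0.
Proof.
case=> -[hab _] h1 h2; split.
- by rewrite !tv2E; bool_cases a b i j c d; try (exfalso; lia); rewrite /=; ring.
- by rewrite !tv2E; bool_cases a b c j i d; try (exfalso; lia); rewrite /=; ring.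
- by rewrite !tv2E; bool_cases a b i j c d; try (exfalso; lia); rewrite /=; ring.
- by rewrite !tv2E; bool_cases a b c j i d; try (exfalso; lia); rewrite /=; ring.
Qed.

Lemma in_qschur_tv a b z : adjacent a b z ->
  in_qschur eps (seqfun r (fun s => phi (unzip2 s) * tv a b z s)).
Proof.
move=> hab u v.
have W x y : weval (seqfun r (fun s => phi (unzip2 s) * tv a b z s)) (u ++ [:: x; y] ++ v) =
   (size u + (size v).+2 == r)%:R * (phi (unzip2 u ++ [:: x.2; y.2] ++ unzip2 v) *
     tv a b z (u ++ [:: x; y] ++ v)).
  by rewrite weval_seqfun /unzip2 !size_cat !map_cat.
have D0 (i j c d : 'I_n.+1) : (c < i)%N -> (j <= d)%N -> diagl (i, j) && diagl (c, d) = false.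
  by rewrite /diagl -!val_eqE /= => ? ?; apply/negbTE; lia.
split=> [i j m|i j c d h1 h2|i j c d h1 h2]; rewrite !W !tv_cat2 /=.
- rewrite (phi_perm (perm_swap _ _ m j)) (tv2_row _ _ _ hab); congr (_ * (_ * (_ * _ * _ + _ * (_ + _ * _ * _)))).
  + by rewrite andbC.
  + by rewrite andbC.
  + by rewrite addnC.
- rewrite (phi_perm (perm_swap _ _ d j)) (tv2_le hab h1 h2).
  rewrite (andbC (diagl (c, d))) (D0 _ _ _ _ h1 h2) /=; ring.
- rewrite (phi_perm (perm_swap _ _ d j)); have [-> ->] := tv2_gt hab h1 h2.
  have -> : diagl (c, j) && diagl (i, d) = false.
    by rewrite /diagl -!val_eqE /=; apply/negbTE; lia.
  rewrite (andbC (diagl (c, d))) (addnC (d == b)) /=; ring.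
Qed.
End Transvection.

Section ColumnOrder.
Variable n : nat.
Local Notation letter := (letter n).

(** The order of the factors in the monomials c^A: first by columns, then by rows. *)
Definition cle (x y : letter) : bool := (x.2 < y.2)%N || (x.2 == y.2) && (x.1 <= y.1)%N.

Lemma cle_refl : reflexive cle.
Proof. by move=> x; rewrite /cle eqxx leqnn orbT. Qed.

Lemma cle_trans : transitive cle.
Proof. by move=> [i j] [i' j'] [i'' j'']; rewrite /cle -!val_eqE /=; lia. Qed.

Lemma cle_anti : antisymmetric cle.
Proof.
move=> [i j] [i' j']; rewrite /cle -!val_eqE /= => h.
by congr (_, _); apply: val_inj => /=; lia.
Qed.

Lemma sorted_monomial (A : 'M[nat]_n.+1) : sorted cle (monomial A).
Proof.
have lt_enum : pairwise (fun i j : 'I_n.+1 => (i < j)%N) (enum 'I_n.+1).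
  rewrite -(pairwise_map (@nat_of_ord _) ltn) val_enum_ord -sorted_pairwise.
    exact: iota_ltn_sorted.
  exact: ltn_trans.
have blocks (L : seq letter) : pairwise cle L ->
    pairwise cle (flatten [seq nseq (A x.1 x.2) x | x <- L]).
  elim: L => //= x L IH /andP [hx hL]; rewrite pairwise_cat IH // andbT.
  apply/andP; split; last first.
    by elim: (A _ _) => //= m ->; rewrite andbT all_nseq cle_refl orbT.
  apply/allrelP => y z; rewrite mem_nseq => /andP [_ /eqP ->].
  move=> /flattenP [t /mapP [w hw ->]]; rewrite mem_nseq => /andP [_ /eqP ->].
  exact: (allP hx).
rewrite (sorted_pairwise cle_trans).
have -> : monomial A = flatten [seq nseq (A x.1 x.2) x |
    x <- [seq (i, j) | j <- enum 'I_n.+1, i <- enum 'I_n.+1]] by rewrite map_allpairs.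
apply: blocks.
have gen js : pairwise (fun i j : 'I_n.+1 => (i < j)%N) js ->
    pairwise cle [seq (i, j) | j <- js, i <- enum 'I_n.+1].
  elim: js => //= j js IH /andP [hj hs]; rewrite pairwise_cat IH // andbT; apply/andP; split.
    apply/allrelP => _ _ /mapP [i _ ->] /allpairsP [[j' i'] /= [hj' _ ->]].
    by rewrite /cle /= (allP hj _ hj').
  rewrite pairwise_map; apply: sub_pairwise lt_enum => i i' /= h.
  by rewrite /cle /= eqxx (ltnW h) orbT.
exact: gen.
Qed.
End ColumnOrder.

Lemma sum_count_mem (T : finType) (s : seq T) : (\sum_(x : T) count_mem x s)%N = size s.
Proof.
elim: s => [|y s IH] /=; first by rewrite big1.
rewrite big_split /= IH (bigD1 y) //= eqxx big1 // => x /negPf yx.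
by rewrite eq_sym yx.
Qed.

Section Generators.
Variables (k : fieldType) (eps : k) (n r : nat).
Local Notation letter := (letter n).
Local Notation q := (eps ^+ 2).

Variables (a b : 'I_n.+1) (z : k).
Hypothesis hab : adjacent eps a b z.

Lemma adj_neq : a != b.
Proof. by rewrite -val_eqE /=; case: hab => -[]; lia. Qed.

Hypothesis eps0 : eps != 0.

Lemma adj_z0 : z != 0.
Proof. by case: hab => -[_ ->]; rewrite ?invr_eq0 expf_neq0. Qed.

Lemma tv_single P R : all (@diagl n) P -> all (@diagl n) R ->
  tv a b z (P ++ (a, b) :: R) = z ^+ count_mem b (unzip2 P).
Proof.
move=> hP hR; rewrite tv_cat /= hP /diagl /= (negPf adj_neq) andFb mulr0 add0r.
by rewrite eqxx hR !mul0r addr0 !mul1r mulr1.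
Qed.

Lemma tv_neq0 s : tv a b z s != 0 ->
  exists P R, [/\ s = P ++ (a, b) :: R, all (@diagl n) P & all (@diagl n) R].
Proof.
elim: s => [|x s IH] /=; first by rewrite eqxx.
have [->|xab] := eqVneq x (a, b).
  rewrite /diagl /= (negPf adj_neq) !mul0r addr0 mul1r => h.
  exists [::], s; split=> //; move: h; case: (all _ s) => //.
  by rewrite eqxx.
rewrite mul0r add0r mulf_eq0 mulf_eq0 !negb_or => /andP [/andP [dx _] /IH].
case=> P [R [-> hP hR]]; exists (x :: P), R; split=> //=; rewrite hP andbT.
by move: dx; case: (diagl x) => //; rewrite eqxx.
Qed.

(** Makes the value on sorted words equal to 1. There the letters (b, b) follow (a, b) if a < b, and
    [tv] is 1. If b < a they all precede it, and [tv] is z to the number of b's in the columns minus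
    one, the letter (a, b) itself being discounted. *)
Definition tv_norm (c : seq 'I_n.+1) : k :=
  if (a < b)%N then 1 else z * z ^- count_mem b c.

Lemma tv_norm_perm s t : perm_eq s t -> tv_norm s = tv_norm t.
Proof. by rewrite /tv_norm => /permP ->. Qed.

Lemma tv_sorted P R : all (@diagl n) P -> all (@diagl n) R ->
  sorted (@cle n) (P ++ (a, b) :: R) ->
  tv_norm (unzip2 (P ++ (a, b) :: R)) * tv a b z (P ++ (a, b) :: R) = 1.
Proof.
move=> hP hR; rewrite (sorted_pairwise (@cle_trans n)) pairwise_cat /=.
move=> /and3P [h1 _ /andP [h2 _]]; rewrite tv_single // /tv_norm.
have [lab|lba] := ltnP a b.
  rewrite (_ : count_mem b _ = 0%N) ?mulr1 // count_map; apply/eqP; rewrite -leqn0 leqNgt -has_count.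
  apply/hasPn => -[i j] hx /=; have /eqP /= e := allP hP _ hx.
  have := allrelP h1 _ _ hx (mem_head _ _); rewrite /cle -e -!val_eqE /=.
  by lia.
have R0 : count_mem b (unzip2 R) = 0%N.
  rewrite count_map; apply/eqP; rewrite -leqn0 leqNgt -has_count.
  apply/hasPn => -[i j] hx /=; have /eqP /= e := allP hR _ hx.
  have := allP h2 _ hx; rewrite /cle -e -!val_eqE /=.
  by move: adj_neq; rewrite -val_eqE /=; lia.
rewrite /unzip2 map_cat count_cat /= eqxx -/(unzip2 R) R0.
rewrite addn0 addn1 exprS invfM mulrA mulfV ?adj_z0 // mul1r mulVf //.
by rewrite expf_neq0 // adj_z0.
Qed.

Section Xi.
Variable D : 'I_n.+1 -> nat.
Let M : 'M[nat]_n.+1 := delta_mx a b + diag_mx (\row_i D i).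

Let ME i j : M i j = (((i, j) == (a, b)) + (i == j) * D i)%N.
Proof.
rewrite !mxE xpair_eqE.
by case: (_ && _); case: (i == j); rewrite ?mul1n ?mul0n ?mulr1n ?mulr0n.
Qed.

Lemma colsum_tv j : (\sum_i M i j = D j + (j == b))%N.
Proof.
rewrite (eq_bigr (fun i => ((i, j) == (a, b)) + (i == j) * D i)%N) => [|i _]; last exact: ME.
rewrite big_split /= addnC (bigD1 j) //= eqxx mul1n big1 => [|i /negPf ->] //.
rewrite addn0; congr (_ + _)%N; rewrite (bigD1 a) //= xpair_eqE eqxx /= big1 ?addn0 //.
by move=> i /negPf ia; rewrite xpair_eqE ia.
Qed.

Definition xi_tv : wdual k n r := seqfun r (fun s =>
  [forall j, count_mem j (unzip2 s) == (D j + (j == b))%N]%:R * tv_norm (unzip2 s)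
    * tv a b z s).

Lemma in_qschur_xi_tv : in_qschur eps xi_tv.
Proof.
apply: (@in_qschur_tv _ _ _ _
  (fun c => [forall j, count_mem j c == (D j + (j == b))%N]%:R * tv_norm c)) => // s t h.
rewrite (tv_norm_perm h); congr (_%:R * _).
by congr nat_of_bool; apply: eq_forallb => j; rewrite (permP h).
Qed.

(** Where [tv] is nonzero, (a, b) is the only off-diagonal letter and occurs once, so the column
    sums determine the whole matrix. *)
Lemma weval_xi_tv B : Xi r B -> weval xi_tv (monomial B) = (B == M)%:R.
Proof.
move=> hB; rewrite weval_seqfun (size_monomial hB) eqxx mul1r.
have cnt j : count_mem j (unzip2 (monomial B)) = (\sum_i B i j)%N.
  rewrite count_map count_monomial (bigD1 j) //= [X in (_ + X)%N]big1 ?addn0 => [|j' /negPf h].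
    by apply: eq_bigr => i _; rewrite eqxx mul1n.
  by rewrite big1 // => i _; rewrite h mul0n.
have [eB|nB] := eqVneq B M.
  rewrite eB in cnt *.
  have [P [R [es hP hR]]] : exists P R, [/\ monomial M = P ++ (a, b) :: R,
      all (@diagl n) P & all (@diagl n) R].
    have : (a, b) \in monomial M.
      by rewrite -has_pred1 has_count count_mem_monomial ME eqxx.
    have hc i j : count_mem (i, j) (monomial M) = M i j by exact: count_mem_monomial.
    move=> hin; case/splitPr: hin hc => P R hc; exists P, R.
    suff : all (@diagl n) (P ++ R) by rewrite all_cat => /andP [].
    apply/allP => -[i j] hx; apply: contraLR hx; rewrite /diagl /= => ij.
    have := hc i j; rewrite ME (negPf ij) mul0n addn0 count_cat /= [(a, b) == _]eq_sym => h.
    by apply/count_memPn/eqP; rewrite count_cat -(eqn_add2l ((i, j) == (a, b))) addn0 addnCA h.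
  rewrite (_ : [forall j, _] = true) ?mul1r; last first.
    by apply/forallP => j; rewrite cnt colsum_tv.
  by move: (sorted_monomial M); rewrite es => /(tv_sorted hP hR).
apply/eqP; rewrite mulf_eq0; apply/norP => -[].
rewrite mulf_eq0 negb_or => /andP [h _] /tv_neq0 [P [R [es hP hR]]].
case/eqP: nB.
have {h}/forallP h : [forall j, count_mem j (unzip2 (monomial B)) == (D j + (j == b))%N].
  by move: h; case: [forall j, _] => //; rewrite eqxx.
have off i j : i != j -> B i j = ((i, j) == (a, b)).
  move=> ij; rewrite -count_mem_monomial es count_cat /= !(count_memPn _) ?addn0 ?add0n 1?eq_sym //.
    by apply/negP => /(allP hR); rewrite /diagl /= (negPf ij).
  by apply/negP => /(allP hP); rewrite /diagl /= (negPf ij).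
apply/matrixP => i j; rewrite ME; have [->{i}|ij] := eqVneq i j; last first.
  by rewrite off // mul0n addn0.
rewrite mul1n; have := h j; rewrite cnt (bigD1 j) //=.
have -> : (\sum_(i < n.+1 | i != j) B i j = (j == b))%N.
  rewrite (eq_bigr (fun i => nat_of_bool ((i, j) == (a, b)))) => [|i]; last exact: off.
  have [->{j}|jb] := eqVneq j b; last first.
    by rewrite big1 // => i _; rewrite xpair_eqE (negPf jb) andbF.
  rewrite (bigD1 a) ?adj_neq //= eqxx big1 // => i /andP [_ /negPf ia].
  by rewrite xpair_eqE ia.
rewrite eqn_add2r => /eqP ->.
rewrite xpair_eqE; case: (eqVneq j a) => [->|] //=; rewrite (negPf adj_neq) //.
Qed.

Lemma xi_eq_tv : Xi r M -> xi eps r M = xi_tv.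
Proof.
move=> hM; rewrite /xi; case: xgetP => [f _ [hf fB]|/(_ xi_tv) []]; last first.
  by split=> [|B hB]; [exact: in_qschur_xi_tv | rewrite weval_xi_tv].
apply/eqP; rewrite -subr_eq0; apply/eqP.
apply: (in_qschur_eq0 eps0) => [|A hA]; first exact: in_qschurB hf in_qschur_xi_tv.
by rewrite wevalB fB // weval_xi_tv // subrr.
Qed.

Let off_diag i j : (i, j) != (a, b) -> i != j -> M i j = 0%N.
Proof. by rewrite ME => /negPf -> /negPf ->. Qed.

(** The first sum is 0, since a pair i < s, t < j of nonzero entries would need |a - b| >= 2. In the
    second only row a can have two nonzero entries, D_a and 1. *)
Lemma dexp_tv : dexp M = (D a)%:Z.
Proof.
have nab := adj_neq; have nba : b != a by rewrite eq_sym.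
have S1 : (\sum_(i < n.+1) \sum_(j < n.+1) \sum_(s < n.+1 | (i < s)%N)
       \sum_(t < n.+1 | (t < j)%N) M i j * M s t)%N = 0%N.
  apply: big1 => i _; apply: big1 => j _; apply: big1 => s hs; apply: big1 => t ht.
  have [h1|h1] := boolP (((i, j) == (a, b)) || (i == j)); last first.
    by move: h1; rewrite negb_or => /andP [h1 h2]; rewrite (off_diag h1 h2) mul0n.
  have [h2|h2] := boolP (((s, t) == (a, b)) || (s == t)); last first.
    by move: h2; rewrite negb_or => /andP [h2 h3]; rewrite (off_diag h2 h3) muln0.
  exfalso; move: h1 h2 hs ht; rewrite !xpair_eqE -!val_eqE /=.
  by case: hab => -[] *; lia.
have S2 : (\sum_(i < n.+1) \sum_(j < n.+1) \sum_(t < n.+1 | (t < j)%N) M i j * M i t)%N = D a.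
  rewrite (bigD1 a) //= [X in (_ + X)%N]big1 ?addn0 => [|i ia]; last first.
    apply: big1 => j _; apply: big1 => t htj.
    have [ij|ij] := eqVneq i j; last by rewrite off_diag // xpair_eqE (negPf ia).
    rewrite mulnC off_diag ?xpair_eqE ?(negPf ia) //.
    by move: htj; rewrite ij -val_eqE /=; lia.
  have Mab : M a b = 1%N by rewrite ME eqxx (negPf nab).
  have Maa : M a a = D a by rewrite ME xpair_eqE (negPf nab) andbF eqxx mul1n.
  have M0 j : j != a -> j != b -> M a j = 0%N.
    by move=> ja jb; rewrite off_diag // ?xpair_eqE ?(negPf jb) ?andbF // eq_sym.
  have pick (c d : 'I_n.+1) : (d < c)%N -> (M a c * M a d)%N = D a ->
      (forall j, j != c -> j != d -> M a j = 0%N) ->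
      (\sum_(j < n.+1) \sum_(t < n.+1 | (t < j)%N) M a j * M a t)%N = D a.
    move=> ldc cd z0; rewrite (bigD1 c) //= [X in (_ + X)%N]big1 ?addn0 => [|j jc].
      rewrite (bigD1 d) //= cd big1 ?addn0 // => t /andP [htc td].
      by rewrite (z0 t) ?muln0 // -val_eqE /=; lia.
    apply: big1 => t htj; have [jd|jd] := eqVneq j d; last by rewrite (z0 j).
    rewrite mulnC (z0 t) // -val_eqE /=; move: htj; rewrite jd; lia.
  case: hab => -[lab _].
    by apply: (pick b a) => [||j jb ja]; [lia|rewrite Mab Maa mul1n|exact: M0].
  by apply: (pick a b) => [||j ja jb]; [lia|rewrite Mab Maa muln1|exact: M0].
by rewrite /dexp S1 S2 oppr0 add0r.
Qed.
End Xi.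

Definition tv_coef (c : seq 'I_n.+1) : k := eps ^- count_mem a c * tv_norm c.

(** At a word with [tv] nonzero a single D contributes: D_j is the number of j's in the columns,
    less one for j = b. The factor eps^-D_a comes from the normalisation of [A]. *)
Lemma blm_tv : blm eps r (delta_mx a b) (fun=> 0)
  = seqfun r (fun s => tv_coef (unzip2 s) * tv a b z s).
Proof.
apply/ffunP => w; rewrite sum_ffunE ffunE.
pose P (D : {ffun 'I_n.+1 -> 'I_r.+1}) := Xi r (delta_mx a b + diag_mx (\row_i (D i : nat))).
have E D : P D -> (eps ^ (\sum_i (D i)%:Z * 0) *: stdbasis eps r
       (delta_mx a b + diag_mx (\row_i (D i : nat)))) w
    = [forall j, count_mem j (unzip2 w) == (D j + (j == b))%N]%:R
       * eps ^- D a * tv_norm (unzip2 w) * tv a b z w.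
  move=> hD; rewrite big1 => [|i _]; last by rewrite mulr0.
  rewrite expr0z scale1r /stdbasis (dexp_tv (fun i => D i)) (xi_eq_tv hD).
  rewrite ffunE /xi_tv /seqfun ffunE -[_ *: _]/(_ * _) -exprnN; ring.
have [h0|h1] := eqVneq (tv a b z w) 0.
  by rewrite h0 mulr0 big1 // => D hD; rewrite E // h0 mulr0.
have [U [V [ew hU hV]]] := tv_neq0 h1.
have cb : (0 < count_mem b (unzip2 w))%N.
  by rewrite ew /unzip2 map_cat count_cat /= eqxx; lia.
have cnt_le j : (count_mem j (unzip2 w) - (j == b) < r.+1)%N.
  rewrite ltnS; apply: leq_trans (leq_subr _ _) _; apply: leq_trans (count_size _ _) _.
  by rewrite size_map size_tuple.
pose D0 : {ffun 'I_n.+1 -> 'I_r.+1} := [ffun j => Ordinal (cnt_le j)].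
have cntD0 j : count_mem j (unzip2 w) = (D0 j + (j == b))%N.
  rewrite ffunE /=; have [->|_] := eqVneq j b; last by rewrite subn0 addn0.
  by rewrite subnK.
have hD0 : P D0.
  rewrite /P /Xi exchange_big /=; apply/eqP.
  rewrite (eq_bigr _ (fun j _ => colsum_tv (fun i => D0 i) j)).
  rewrite -[RHS](size_tuple w) -(size_map snd) -sum_count_mem.
  by apply: eq_bigr => j _; rewrite cntD0.
rewrite (bigD1 D0) //= E // [X in _ + X]big1 ?addr0 => [|D /andP [hD nD]].
  rewrite (_ : [forall j, _] = true) ?mul1r; last by apply/forallP => j; rewrite cntD0.
  by rewrite /tv_coef cntD0 (negPf adj_neq) addn0.
rewrite E // (_ : [forall j, _] = false) ?mul0r //.
apply/negP => /forallP h; case/eqP: nD; apply/ffunP => j; apply/val_inj/eqP.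
by rewrite -(eqn_add2r (j == b)) -cntD0 eq_sym.
Qed.
End Generators.

(** * Right multiplication by root generators *)

Section RightMultiplication.
Variables (k : fieldType) (n : nat).
Local Notation letter := (letter n).
Variables (a b : 'I_n.+1) (z : k).

(* [rsum X s] is the sum of z^(number of b's before p) X (s with column b replaced
   by a at position p), over all positions p of s in column b. *)
Fixpoint rsum (X : seq letter -> k) (s : seq letter) : k :=
  if s is x :: s' then (x.2 == b)%:R * X ((x.1, a) :: s')
     + z ^+ (x.2 == b) * rsum (fun t => X (x :: t)) s' else 0.

Lemma eq_rsum X Y s : (forall s', unzip1 s' = unzip1 s -> X s' = Y s') -> rsum X s = rsum Y s.
Proof.
elim: s X Y => //= x s IH X Y h; rewrite h //; congr (_ + _ * _).
by apply: IH => s' hs'; rewrite h //= hs'.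
Qed.

Lemma rsum_sum (I : finType) (c : I -> k) (X : I -> seq letter -> k) s :
  rsum (fun t => \sum_i c i * X i t) s = \sum_i c i * rsum (X i) s.
Proof.
elim: s X => /= [|x s IH] X; first by rewrite big1 // => i _; rewrite mulr0.
rewrite (IH (fun i t => X i (x :: t))) !big_distrr -big_split /=; apply: eq_bigr => i _.
by ring.
Qed.

Lemma rsumZ c X s : rsum (fun t => c * X t) s = c * rsum X s.
Proof. elim: s X => /= [|x s IH] X; first by rewrite mulr0. by rewrite (IH (fun t => X (x :: t))); ring. Qed.

Lemma rsum_cat X s1 s2 : rsum X (s1 ++ s2) = rsum (fun t => X (t ++ s2)) s1
  + z ^+ count_mem b (unzip2 s1) * rsum (fun t => X (s1 ++ t)) s2.
Proof.
elim: s1 X => /= [|x s1 IH] X; first by rewrite add0r mul1r.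
rewrite (IH (fun t => X (x :: t))) exprD; ring.
Qed.

Lemma tv_rsum (I t c : seq 'I_n.+1) : size I = size c -> size t = size c ->
  tv a b z (zip t c) = rsum (fun s => (unzip2 s == t)%:R) (zip I c).
Proof.
elim: c I t => [|c0 c IH] [|i0 I] [|t0 t] //= [hI] [ht].
rewrite (IH I t) // unzip2_zip ?hI // eqseq_cons xpair_eqE.
have -> : all (@diagl n) (zip t c) = (c == t).
  elim: c t ht {IH hI} => [|c1 c IH] [|t1 t] //= [ht].
  by rewrite IH // eqseq_cons [c1 == t1]eq_sym.
have -> : rsum (fun s => (c0 :: unzip2 s == t0 :: t)%:R) (zip I c)
   = rsum (fun s => (c0 == t0)%:R * (unzip2 s == t)%:R) (zip I c).
  by apply: eq_rsum => s _; rewrite eqseq_cons -natrM mulnb.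
rewrite rsumZ /diagl /= -[X in X%:R * (c == t)%:R]mulnb -[X in _ = _ * X%:R + _]mulnb !natrM.
rewrite (eq_sym t0 c0) (eq_sym t0 a); ring.
Qed.

Variable (eps : k) (r : nat).

Definition gtv : wdual k n r := seqfun r (fun s => tv_coef eps a b z (unzip2 s) * tv a b z s).

(** Right multiplication only concerns column indices: the rows of s stay fixed while one b among
    its columns becomes a. *)
Lemma weval_mul_gtv (x : wdual k n r) s :
  weval (x * gtv) s = tv_coef eps a b z (unzip2 s) * rsum (weval x) s.
Proof.
have [hs|hs] := eqVneq (size s) r; last first.
  rewrite weval_size // (@eq_rsum _ (fun=> 0 * 0)) => [|s' hs']; last first.
    by rewrite weval_size ?mulr0 // -(size_map fst) [map _ _]hs' size_map.
  by rewrite (rsumZ 0 (fun=> 0)) mul0r mulr0.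
pose w : r.-tuple (letter) := Tuple (introT eqP hs); rewrite -[s]/(tval w).
rewrite weval_tuple ffunE -[unzip2 w]/(tval (cols w)).
rewrite (@eq_rsum _ (fun s => \sum_(t : windex n r) x (word (rows w) t) * (unzip2 s == t)%:R)).
  rewrite rsum_sum big_distrr /=; apply: eq_bigr => t _.
  rewrite !ffunE /= unzip2_zip ?size_map ?size_tuple ?hs // (@tv_rsum (unzip1 s)) ?size_map ?size_tuple //.
  by rewrite zip_unzip mulrCA.
move=> s' hs'; have sz' : size s' == r by rewrite -(size_map fst) [map _ _]hs' size_map size_tuple.
pose w' : r.-tuple letter := Tuple sz'; rewrite -[s']/(tval w') weval_tuple.
have ew : rows w = rows w' by apply: val_inj.
rewrite (bigD1 (cols w')) //= eqxx mulr1 ew wordK big1 ?addr0 // => t /negPf ht.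
by rewrite -[unzip2 s']/(tval (cols w')) -val_eqE eq_sym in ht *; rewrite ht mulr0.
Qed.

Lemma gtv_mul (x : wdual k n r) I c : (gtv * x) (word I c) =
  \sum_(t : windex n r) tv_coef eps a b z t * tv a b z (zip I t) * x (word t c).
Proof.
rewrite ffunE rows_word cols_word; apply: eq_bigr => t _.
by rewrite ffunE /= unzip2_zip ?size_tuple.
Qed.
End RightMultiplication.

Section Closure.
Variables (k : fieldType) (eps : k) (n r : nat).
Hypothesis eps0 : eps != 0.
Local Notation q := (eps ^+ 2).
Local Notation wdual := (wdual k n r).

Lemma in_qschurM (f g : wdual) : in_qschur eps f -> in_qschur eps g -> in_qschur eps (f * g).
Proof. by move=> /qrelP hf /qrelP hg; apply/qrelP/qrelM. Qed.

Lemma weval_lin c (f g : wdual) s : weval (c *: f + g) s = c * weval f s + weval g s.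
Proof. by rewrite /weval; case: insubP => [w _ _|_]; rewrite ?ffunE ?mulr0 ?addr0. Qed.

Lemma in_qschur_lin c (f g : wdual) :
  in_qschur eps f -> in_qschur eps g -> in_qschur eps (c *: f + g).
Proof.
move=> hf hg u v; have [f1 f2 f3] := hf u v; have [g1 g2 g3] := hg u v.
split=> [i j m|i j a b h1 h2|i j a b h1 h2]; rewrite !weval_lin.
- by rewrite f1 g1.
- by rewrite f2 // g2 //; ring.
- by rewrite f3 // g3 //; ring.
Qed.

Lemma dg_seqfun (phi : seq 'I_n.+1 -> k) :
  (dg phi : wdual) = seqfun r (fun s => phi (unzip2 s) * (all (@diagl n) s)%:R).
Proof.
apply/ffunP => w; rewrite !ffunE mulrC.
have -> : all (@diagl n) w = (rows w == cols w).
  rewrite -val_eqE /=; case: w => w _ /=; elim: w => //= -[i j] w ->.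
  by rewrite eqseq_cons.
by case: eqP => [->|_]; rewrite ?mulr0.
Qed.

Lemma in_qschur_dg (phi : seq 'I_n.+1 -> k) :
  (forall s t, perm_eq s t -> phi s = phi t) -> in_qschur eps (dg phi : wdual).
Proof. by move=> hphi; rewrite dg_seqfun; apply: in_qschur_diag. Qed.

Lemma adjE (h : 'I_n) : adjacent eps (widen_ord (leqnSn n) h) (fintype.lift ord0 h) q.
Proof. by left. Qed.

Lemma adjF (h : 'I_n) : adjacent eps (fintype.lift ord0 h) (widen_ord (leqnSn n) h) q^-1.
Proof. by right. Qed.

Lemma zetaE_tv h : zetaE eps r h = gtv (widen_ord (leqnSn n) h) (fintype.lift ord0 h) q eps r.
Proof. exact: (blm_tv r (adjE h) eps0). Qed.

Lemma zetaF_tv h : zetaF eps r h = gtv (fintype.lift ord0 h) (widen_ord (leqnSn n) h) q^-1 eps r.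
Proof. exact: (blm_tv r (adjF h) eps0). Qed.

Lemma tv_coef_perm a b z s t : perm_eq s t -> tv_coef eps a b z s = @tv_coef k eps n a b z t.
Proof. by move=> h; rewrite /tv_coef (tv_norm_perm _ _ _ h) (permP h). Qed.

Lemma in_qschur_gtv a b z : adjacent eps a b z -> in_qschur eps (gtv a b z eps r : wdual).
Proof. by move=> h; apply: in_qschur_tv => // s t; apply: tv_coef_perm. Qed.

Lemma blm0_perm jj (s t : seq 'I_n.+1) : perm_eq s t ->
  eps ^ (\sum_a (count_mem a s)%:Z * jj a) = eps ^ (\sum_a (count_mem a t)%:Z * jj a).
Proof. by move=> /permP h; congr (_ ^ _); apply: eq_bigr => a _; rewrite h. Qed.

Lemma little_in_qschur x : little eps x -> in_qschur eps (x : wdual).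
Proof.
elim=> {x} [h|h|i|i||c x y _ hx _ hy|x y _ hx _ hy].
- by rewrite zetaE_tv; apply/in_qschur_gtv/adjE.
- by rewrite zetaF_tv; apply/in_qschur_gtv/adjF.
- rewrite /zetaK blm_diag //; apply: (in_qschur_dg (phi := fun s =>
    eps ^ (\sum_a (count_mem a s)%:Z * (a == i)%:Z))) => s t; exact: blm0_perm.
- rewrite /zetaKV blm_diag //; apply: (in_qschur_dg (phi := fun s =>
    eps ^ (\sum_a (count_mem a s)%:Z * - (a == i)%:Z))) => s t; exact: blm0_perm.
- by rewrite -dg1; apply: (in_qschur_dg (phi := fun=> 1)).
- exact: in_qschur_lin.
- exact: in_qschurM.
Qed.
End Closure.

(** * Transfer and l-th powers *)

Section LittleInduction.
Variables (k : fieldType) (eps : k) (n r : nat).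

Lemma lqschur_ind (P : lqschur eps n r -> Prop) :
  (forall h, P (gen_e eps r h)) -> (forall h, P (gen_f eps r h)) ->
  (forall i, P (gen_k eps r i)) -> (forall i, P (gen_kV eps r i)) -> P 1 ->
  (forall c x y, P x -> P y -> P (c *: x + y)) ->
  (forall x y, P x -> P y -> P (x * y)) -> forall x, P x.
Proof.
move=> pe pf pk pkV p1 pl pm [x hx].
suff H : forall x, little eps x -> forall hx, P (exist _ x hx : lqschur eps n r).
  by apply: H; apply/asboolP.
move=> {hx}x; elim=> {x} [h|h|i|i||c x y lx IHx ly IHy|x y lx IHx ly IHy] hx.
- by rewrite (_ : exist _ _ _ = gen_e eps r h) //; apply: val_inj.
- by rewrite (_ : exist _ _ _ = gen_f eps r h) //; apply: val_inj.
- by rewrite (_ : exist _ _ _ = gen_k eps r i) //; apply: val_inj.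
- by rewrite (_ : exist _ _ _ = gen_kV eps r i) //; apply: val_inj.
- by rewrite (_ : exist _ _ _ = (1 : lqschur eps n r)) //; apply: val_inj.
- rewrite (_ : exist _ _ _ = c *: in_lqschur lx + in_lqschur ly); last exact: val_inj.
  by apply: pl; [exact: IHx | exact: IHy].
- rewrite (_ : exist _ _ _ = in_lqschur lx * in_lqschur ly); last exact: val_inj.
  by apply: pm; [exact: IHx | exact: IHy].
Qed.

Lemma val_lqM (x y : lqschur eps n r) : val (x * y) = val x * val y.
Proof. by []. Qed.

Lemma weval_mul_dg (x : wdual k n r) (phi : seq 'I_n.+1 -> k) s :
  weval (x * dg phi) s = phi (unzip2 s) * weval x s.
Proof.
have [hs|hs] := eqVneq (size s) r; last by rewrite !weval_size // mulr0.
pose w : r.-tuple (letter n) := Tuple (introT eqP hs); rewrite -[s]/(tval w).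
rewrite !weval_tuple ffunE (bigD1 (cols w)) //= ffunE rows_word cols_word eqxx mul1r wordK.
rewrite big1 ?addr0 => [|t /negPf ht]; first by rewrite mulrC.
by rewrite ffunE rows_word cols_word ht mul0r mulr0.
Qed.

Lemma mul_nseq (m : nat) (x : letter n) i (u v : seq (letter n)) :
  count_mem i (unzip2 (u ++ nseq m x ++ v)) = ((x.2 == i) * m + count_mem i (unzip2 (u ++ v)))%N.
Proof.
by rewrite /unzip2 !map_cat !count_cat map_nseq count_nseq addnCA.
Qed.
End LittleInduction.

Section RootOfUnity.
Variables (k : fieldType) (l : nat) (eps : k).
Hypotheses (heps : l.-primitive_root eps) (hl : (3 <= l)%N) (hodd : odd l).
Local Notation q := (eps ^+ 2).

Lemma prim_q_eq1 m : (q ^+ m == 1) = (l %| m)%N.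
Proof.
rewrite -exprM -(prim_order_dvd heps) mulnC Gauss_dvdl //.
by rewrite coprimen2.
Qed.

Lemma adj_expr_eq1 n (a b : 'I_n.+1) z m : adjacent eps a b z -> (z ^+ m == 1) = (l %| m)%N.
Proof. by case=> -[_ ->]; rewrite ?exprVn ?invr_eq1 prim_q_eq1. Qed.

Lemma adj_geom n (a b : 'I_n.+1) z m : adjacent eps a b z ->
  (\sum_(x < m) z ^+ x == 0) = (l %| m)%N.
Proof.
move=> hab; rewrite -(adj_expr_eq1 _ hab) -[RHS]subr_eq0 subrX1 mulf_eq0.
rewrite subr_eq0 -[z]expr1 (adj_expr_eq1 _ hab) dvdn1 gtn_eqF //.
exact: ltn_trans hl.
Qed.
End RootOfUnity.

Section Transfer.
Variables (k : fieldType) (l n r : nat) (eps : k).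
Hypotheses (heps : l.-primitive_root eps) (hl : (3 <= l)%N) (hodd : odd l).
Local Notation q := (eps ^+ 2).
Local Notation letter := (letter n).
Let eps0 : eps != 0 := prim_neq0 hl heps.

Lemma swap_same_row f u (i a b : 'I_n.+1) p v : in_qschur eps (f : wdual k n r) ->
  weval f (u ++ nseq p (i, b) ++ (i, a) :: v) = weval f (u ++ (i, a) :: nseq p (i, b) ++ v).
Proof.
move=> hf; elim: p u => //= p IH u.
have := IH (u ++ [:: (i, b)]); rewrite -!catA /= => ->.
by have [/(_ i b a) e _ _] := hf u (nseq p (i, b) ++ v).
Qed.

Lemma rsum_nseq (a b i : 'I_n.+1) (z : k) m Y c :
  (forall p, (p < m)%N -> Y (nseq p (i, b) ++ (i, a) :: nseq (m - p.+1) (i, b)) = c) ->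
  rsum a b z Y (nseq m (i, b)) = (\sum_(p < m) z ^+ p) * c.
Proof.
elim: m Y => /= [|m IH] Y h; first by rewrite big_ord0 mul0r.
have := h 0%N isT; rewrite subn1 /= => ->; rewrite eqxx mul1r expr1 IH => [|p hp].
  rewrite big_ord_recl expr0 mulrDl mul1r mulrA big_distrr /=.
  by congr (_ + _ * _); apply: eq_bigr => p _; rewrite -exprS.
exact: h p.+1 hp.
Qed.

Lemma rsum_nseq0 (a b i j : 'I_n.+1) (z : k) m Y : j != b -> rsum a b z Y (nseq m (i, j)) = 0.
Proof.
by move=> /negPf jb; elim: m Y => //= m IH Y; rewrite IH jb mul0r mulr0 addr0.
Qed.

(** A block of l equal letters changes every exponent by 0 or l, and eps^l = z^l = 1. *)
Lemma tv_coef_nseq a b z u (x : letter) v : adjacent eps a b z ->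
  tv_coef eps a b z (unzip2 (u ++ nseq l x ++ v)) = tv_coef eps a b z (unzip2 (u ++ v)).
Proof.
move=> hab; rewrite /tv_coef /tv_norm !mul_nseq !exprD.
have zl : z ^+ l = 1 by apply/eqP; rewrite (adj_expr_eq1 heps hodd _ hab).
have el : eps ^+ l = 1 := prim_expr_order heps.
by do 2![case: (_ == _)]; rewrite ?mul1n ?mul0n ?expr0 ?zl ?el !mul1r.
Qed.

Hypothesis (rl : (l <= r)%N).
Variable rho : {lrmorphism lqschur eps n r -> lqschur eps n (r - l)}.
Hypothesis hrho : baby_transfer rho.

Lemma gen_kkV s i : gen_k eps s i * gen_kV eps s i = 1 :> lqschur eps n s.
Proof.
apply: val_inj; change (zetaK eps s i * zetaKV eps s i = 1 :> wdual k n s).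
rewrite /zetaK /zetaKV !blm_diag // dgM -dg1; congr dg; apply/funext => t.
by rewrite -expfzDr // -big_split big1 // => a _ /=; rewrite -mulrDr addrN mulr0.
Qed.

Lemma gen_kVk s i : gen_kV eps s i * gen_k eps s i = 1 :> lqschur eps n s.
Proof.
apply: val_inj; change (zetaKV eps s i * zetaK eps s i = 1 :> wdual k n s).
rewrite /zetaK /zetaKV !blm_diag // dgM -dg1; congr dg; apply/funext => t.
by rewrite -expfzDr // -big_split big1 // => a _ /=; rewrite -mulrDr addNr mulr0.
Qed.

Lemma transfer_kV i : rho (gen_kV eps r i) = gen_kV eps (r - l) i.
Proof.
have [_ _ hk] := hrho.
rewrite -[LHS]mulr1 -(gen_kkV (r - l) i) mulrA -hk -rmorphM gen_kVk rmorph1 mul1r //.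
Qed.

Lemma transfer_surj y : exists x, rho x = y.
Proof.
have [he hf hk] := hrho; elim/lqschur_ind: y => [h|h|i|i||c _ _ [x <-] [y <-]|_ _ [x <-] [y <-]].
- by exists (gen_e eps r h).
- by exists (gen_f eps r h).
- by exists (gen_k eps r i).
- by exists (gen_kV eps r i); rewrite transfer_kV.
- by exists 1; rewrite rmorph1.
- by exists (c *: x + y); rewrite linearP.
- by exists (x * y); rewrite rmorphM.
Qed.

(* c_ij^l pairs with the little quantum group like delta_ij times the counit. *)
Definition power_rel (x : lqschur eps n r) := forall u i j v,
  weval (val x) (u ++ nseq l (i, j) ++ v) = (i == j)%:R * weval (val (rho x)) (u ++ v).

(** Split the sum over positions into u, the block and v. Letters of one row commute, so all
    positions in the block give the same value, and their weights add up to 1 + z + ... + z^(l-1) =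
    0. The positions in u and v are covered by the hypothesis on x; passing the block costs z^0 or
    z^l, which is 1. *)
Lemma power_rel_gtv a b z x y : adjacent eps a b z ->
  val y = gtv a b z eps r -> val (rho y) = gtv a b z eps (r - l) ->
  power_rel x -> power_rel (x * y).
Proof.
move=> hab ey ery hx u i j v; rewrite (rmorphM rho) !val_lqM ey ery.
rewrite !weval_mul_gtv tv_coef_nseq // !rsum_cat.
have xS : in_qschur eps (val x) by apply: little_in_qschur => //; apply/asboolP/(valP x).
have -> : rsum a b z (fun t => weval (val x) (u ++ t ++ v)) (nseq l (i, j)) = 0.
  have [->|jb] := eqVneq j b; last by rewrite rsum_nseq0.
  rewrite (@rsum_nseq _ _ _ _ _ _ (weval (val x) (u ++ (i, a) :: nseq l.-1 (i, b) ++ v))).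
    by have /eqP -> : \sum_(p < l) z ^+ p == 0; rewrite ?mul0r // (adj_geom heps hl hodd _ hab).
  move=> p hp; rewrite -catA /= swap_same_row // catA -nseqD; congr (weval _ (_ ++ _ :: nseq _ _ ++ _)).
  by lia.
have -> : z ^+ count_mem b (unzip2 (nseq l (i, j))) = 1.
  rewrite /unzip2 map_nseq count_nseq /=; apply/eqP.
  by rewrite (adj_expr_eq1 heps hodd _ hab) dvdn_mull.
rewrite add0r mul1r.
rewrite (@eq_rsum _ _ _ _ _ _ (fun t => (i == j)%:R * weval (val (rho x)) (t ++ v))) => [|s _]; last exact: hx.
rewrite rsumZ.
rewrite (@eq_rsum _ _ _ _ _ (fun t => weval (val x) (u ++ nseq l (i, j) ++ t))
  (fun t => (i == j)%:R * weval (val (rho x)) (u ++ t))) => [|s _]; last exact: hx.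
by rewrite rsumZ; ring.
Qed.

Lemma power_rel_dg jj x y : val y = dg (fun s => eps ^ (\sum_a (count_mem a s)%:Z * jj a)) ->
  val (rho y) = dg (fun s => eps ^ (\sum_a (count_mem a s)%:Z * jj a)) ->
  power_rel x -> power_rel (x * y).
Proof.
move=> ey ery hx u i j v; rewrite (rmorphM rho) !val_lqM ey ery.
rewrite (weval_mul_dg _ (fun s => eps ^ (\sum_a (count_mem a s)%:Z * jj a))).
rewrite (weval_mul_dg _ (fun s => eps ^ (\sum_a (count_mem a s)%:Z * jj a))).
rewrite hx mulrCA; congr (_ * (_ * _)).
rewrite (eq_bigr (fun a => ((j == a) * l)%N%:Z * jj a + (count_mem a (unzip2 (u ++ v)))%:Z * jj a)); last first.
  by move=> a _; rewrite mul_nseq PoszD mulrDl.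
rewrite big_split /= expfzDr // (bigD1 j) //= big1 ?addr0 => [|a]; last first.
  by rewrite eq_sym => /negPf ->; rewrite mul0n mul0r.
by rewrite eqxx mul1n -exprz_exp -exprnP (prim_expr_order heps) exp1rz mul1r.
Qed.

Lemma transfer_power x : power_rel x.
Proof.
have [he hf hk] := hrho.
(* The multiplier y is built up from generators and x stays arbitrary; the claim then follows from
   the case x = 1, where it is a direct computation. *)
have H y : forall x, power_rel x -> power_rel (x * y).
  elim/lqschur_ind: y => [h|h|i|i||c y1 y2 h1 h2|y1 y2 h1 h2] {}x hx.
  - apply: (power_rel_gtv (adjE eps h)) => //=; first exact: zetaE_tv.
    by rewrite he; exact: zetaE_tv.
  - apply: (power_rel_gtv (adjF eps h)) => //=; first exact: zetaF_tv.
    by rewrite hf; exact: zetaF_tv.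
  - apply: (@power_rel_dg (fun a => (a == i)%:Z)) => //=; first exact: blm_diag.
    by rewrite hk; exact: blm_diag.
  - apply: (@power_rel_dg (fun a => - (a == i)%:Z)) => //=; first exact: blm_diag.
    by rewrite transfer_kV; exact: blm_diag.
  - by rewrite mulr1.
  - move=> u i j v; have := (h1 _ hx u i j v, h2 _ hx u i j v) => -[e1 e2].
    by rewrite mulrDr -scalerAr !linearP /= !weval_lin e1 e2; ring.
  - by rewrite mulrA; apply/h2/h1.
rewrite -[x]mul1r; apply: H => u i j v.
have one s t : weval (1 : wdual k n s) t = (size t == s)%:R * (all (@diagl n) t)%:R.
  by rewrite -dg1 (dg_seqfun _ (fun=> 1)) weval_seqfun mul1r.
have val1 s : val (1 : lqschur eps n s) = 1 by [].
rewrite (rmorph1 rho) !val1 !one !all_cat all_nseq !size_cat size_nseq.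
have -> : (l == 0)%N = false by lia.
rewrite orFb /diagl [(i, j).1]/= [(i, j).2]/=.
have -> : (size u + (l + size v) == r)%N = (size u + size v == r - l)%N.
  by rewrite addnCA -[in LHS](subnKC rl) eqn_add2l.
case: (i == j) => /=; rewrite ?andbF ?mulr0 ?mul0r ?mul1r //.
Qed.
End Transfer.

(** * Moving letters in words *)

Section Displacement.
Local Open Scope nat_scope.

(* Sum of the distances |c_p - (i + p)|. *)
Fixpoint disp (i : nat) (c : seq nat) : nat :=
  if c is x :: c' then ((x - i) + (i - x) + disp i.+1 c')%N else 0%N.

Lemma disp_cat i c d : disp i (c ++ d) = (disp i c + disp (i + size c) d)%N.
Proof. by elim: c i => /= [|x c IH] i; rewrite ?addn0 // IH addSnnS addnA. Qed.

(* Move the letter at the last p with c_p < p, or else at the first p with c_p > p. *)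
Lemma sorted_move N (c : seq nat) : sorted leq c -> (size c <= N)%N ->
  all (fun x => x < N)%N c -> c != iota 0 (size c) ->
  exists c1 b c2 a, [/\ c = c1 ++ b :: c2, (a < N)%N,
    (disp 0 (c1 ++ a :: c2) < disp 0 c)%N &
    (a = b.+1 /\ all (fun x => x <= b)%N c1 /\ all (fun x => a < x)%N c2) \/
    (b = a.+1 /\ all (fun x => x < a)%N c1 /\ all (fun x => b <= x)%N c2)].
Proof.
move=> sc szN cN cne.
have srt i j : (i <= j)%N -> (j < size c)%N -> (nth 0 c i <= nth 0 c j)%N.
  move=> ij js; apply: (sorted_leq_nth leq_trans leqnn 0%N sc) => //.
  by rewrite inE (leq_ltn_trans ij).
have dec p : (p < size c)%N -> c = take p c ++ nth 0%N c p :: drop p.+1 c.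
  by move=> hp; rewrite -drop_nth // cat_take_drop.
have d1 p a : (p < size c)%N -> ((a - p) + (p - a) < (nth 0 c p - p) + (p - nth 0 c p))%N ->
    (disp 0 (take p c ++ a :: drop p.+1 c) < disp 0 c)%N.
  move=> hp ha; rewrite [in X in (_ < X)%N](dec p hp) !disp_cat /= size_takel ?(ltnW hp) //.
  by rewrite add0n ltn_add2l ltn_add2r.
have allt p (P : pred nat) : (p < size c)%N -> (forall i, (i < p)%N -> P (nth 0%N c i)) -> all P (take p c).
  move=> hp h; apply/(all_nthP 0%N) => i; rewrite size_takel ?(ltnW hp) // => ip.
  by rewrite nth_take // h.
have alld p (P : pred nat) : (forall i, (p < i)%N -> (i < size c)%N -> P (nth 0%N c i)) -> all P (drop p.+1 c).
  move=> h; apply/(all_nthP 0%N) => i; rewrite size_drop nth_drop => ip.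
  by apply: h; lia.
have [/existsP [p0 hp0]|nA] := boolP [exists p : 'I_(size c), nth 0 c p < p].
  have [||p /= hp pmax] := @ex_maxnP (fun p => (p < size c) && (nth 0 c p < p))%N (size c).
  - by exists p0; rewrite ltn_ord.
  - by move=> p /andP [/ltnW].
  case/andP: hp => hp hcp.
  exists (take p c), (nth 0 c p), (drop p.+1 c), (nth 0 c p).+1; split.
  - exact: dec.
  - by lia.
  - by apply: d1 => //; lia.
  - left; split=> //; split; first by apply: allt => // i ip; apply: srt => //; lia.
    apply: alld => i pi ic.
    have : ~~ (nth 0 c i < i)%N.
      by apply/negP => h; have := pmax i; rewrite ic h => /(_ isT); lia.
    by lia.
have geA p : (p < size c)%N -> (p <= nth 0 c p)%N.
  move=> hp; rewrite leqNgt; apply: contra nA => h.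
  by apply/existsP; exists (Ordinal hp).
have [/existsP [p0 hp0]|nB] := boolP [exists p : 'I_(size c), p < nth 0 c p].
  have [|p /= hp pmin] := @ex_minnP (fun p => (p < size c) && (p < nth 0 c p))%N.
    by exists p0; rewrite ltn_ord.
  case/andP: hp => hp hcp.
  exists (take p c), (nth 0 c p), (drop p.+1 c), (nth 0 c p).-1; split.
  - exact: dec.
  - by have := all_nthP 0%N cN p hp; lia.
  - by apply: d1 => //; lia.
  - right; split; first by lia.
    split; last by apply: alld => i pi ic; apply: srt => //; lia.
    apply: allt => // i ip.
    have : ~~ (i < nth 0 c i)%N.
      by apply/negP => h; have := pmin i; rewrite h (ltn_trans ip hp) => /(_ isT); lia.
    by lia.
case/eqP: cne; apply: (@eq_from_nth _ 0%N); rewrite ?size_iota // => i hi.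
rewrite nth_iota // add0n; apply/eqP; rewrite eqn_leq geA // andbT leqNgt.
by apply: contra nB => h; apply/existsP; exists (Ordinal hi).
Qed.

(** Each letter is weighted by the number of letters after it, so bringing a smaller letter forward
    lowers the sum: a measure for sorting permutations. *)
Fixpoint wsum (c : seq nat) : nat := if c is x :: c' then (size c' * x + wsum c')%N else 0%N.

Lemma wsumS c x d : wsum (c ++ x.+1 :: d) = (wsum (c ++ x :: d) + size d)%N.
Proof.
elim: c => /= [|y c ->]; first by rewrite mulnS; lia.
by rewrite !size_cat /= addnA.
Qed.

Lemma wsum_swap c x d e : (wsum (c ++ x :: d ++ x.+1 :: e) < wsum (c ++ x.+1 :: d ++ x :: e))%N.
Proof.
rewrite wsumS -cat_cons catA wsumS -catA cat_cons ltn_add2l size_cat /=; lia.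
Qed.

(** If each x stood before x + 1, the positions of 0, 1, 2, ... would increase strictly within a
    range of the same size, so each x would be at position x. *)
Lemma perm_iota_descent c : perm_eq c (iota 0 (size c)) -> c != iota 0 (size c) ->
  exists c1 x c2 c3, c = c1 ++ x.+1 :: c2 ++ x :: c3.
Proof.
move=> hp hne.
have uc : uniq c by rewrite (perm_uniq hp) iota_uniq.
have mc x : (x \in c) = (x < size c)%N by rewrite (perm_mem hp) mem_iota.
suff : ~ forall x, (x.+1 < size c)%N -> (index x c < index x.+1 c)%N.
  move/existsNP => [x /not_implyP [hx /negP]]; rewrite -leqNgt => hi.
  have x1 : x.+1 \in c by rewrite mc.
  have x0 : x \in c by rewrite mc; lia.
  case/splitPr: x1 uc hi x0 {hp hne mc hx} => c1 c2 uc hi x0.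
  have xc1 : x \notin c1.
    apply/negP => h; move: hi; rewrite !index_cat h.
    have -> : x.+1 \in c1 = false.
      by move: uc; rewrite cat_uniq /= => /and3P [_ /norP [/negPf -> _] _].
    by rewrite /= eqxx addn0 leqNgt index_mem h.
  move: x0; rewrite mem_cat (negPf xc1) inE /= (ltn_eqF (ltnSn x)) /= => h.
  by case/splitPr: h => c3 c4; exists c1, x, c3, c4.
move=> mono; case/eqP: hne.
have idx : [seq index x c | x <- iota 0 (size c)] = iota 0 (size c).
  apply: (sorted_eq (leT := ltn)); [exact: ltn_trans|by move=> x y; lia| |exact: iota_ltn_sorted|].
    apply/(sortedP 0%N) => i; rewrite size_map size_iota => hi.
    by rewrite !(nth_map 0%N) ?size_iota ?(ltnW hi) // !nth_iota ?(ltnW hi) //; apply: mono.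
  apply: uniq_perm; rewrite ?iota_uniq ?map_inj_in_uniq ?iota_uniq //.
    by move=> x y; rewrite !mem_iota !add0n -!mc /= => hx hy e; rewrite -(nth_index 0%N hx) e nth_index.
  apply: (uniq_min_size _ _ _).2.
  - rewrite map_inj_in_uniq ?iota_uniq // => x y.
    by rewrite !mem_iota !add0n -!mc /= => hx hy e; rewrite -(nth_index 0%N hx) e nth_index.
  - move=> _ /mapP [x hx ->]; rewrite mem_iota add0n index_mem mc.
    by move: hx; rewrite mem_iota.
  - by rewrite size_map.
apply: (@eq_from_nth _ 0%N); rewrite ?size_iota // => i hi; rewrite nth_iota // add0n.
have := congr1 (nth 0%N ^~ i) idx; rewrite (nth_map 0%N) ?size_iota // !nth_iota // add0n => {1}<-.
by rewrite nth_index // mc.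
Qed.
End Displacement.

(** * The left ideal A e *)

Inductive ideal_gen (k : nzRingType) (A : lalgType k) (e : A) : A -> Prop :=
| ideal_e : ideal_gen e e
| ideal_lin (c : k) x y of ideal_gen e x & ideal_gen e y : ideal_gen e (c *: x + y)
| ideal_ml a x of ideal_gen e x : ideal_gen e (a * x)
| ideal_mr a x of ideal_gen e x : ideal_gen e (x * a).

Lemma map_eq_cat (T1 T2 : Type) (f : T1 -> T2) s c1 x c2 : map f s = c1 ++ x :: c2 ->
  exists d1 y d2, [/\ s = d1 ++ y :: d2, map f d1 = c1, f y = x & map f d2 = c2].
Proof.
elim: c1 s => [|x1 c1 IH] [|y s] //= [<-]; first by move=> <-; exists [::], y, s.
by case/IH => d1 [y' [d2 [-> <- <- <-]]]; exists (y :: d1), y', d2.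
Qed.

Section RSum.
Variables (k : fieldType) (n : nat) (a b : 'I_n.+1) (z : k).
Local Notation letter := (letter n).

Lemma eq_rsum_split X Y (s : seq letter) :
  (forall s1 i s2, s = s1 ++ (i, b) :: s2 -> X (s1 ++ (i, a) :: s2) = Y (s1 ++ (i, a) :: s2)) ->
  rsum a b z X s = rsum a b z Y s.
Proof.
elim: s X Y => //= -[i j] s IH X Y h /=; congr (_ + _ * _).
  by case: eqVneq => [jb|_]; rewrite ?mul0r // (h [::] i s) // jb.
by apply: IH => s1 i' s2 es; apply: (h ((i, j) :: s1)); rewrite es.
Qed.

Lemma rsum0 (s : seq letter) : rsum a b z (fun=> 0) s = 0.
Proof. by elim: s => //= x s ->; rewrite !mulr0 addr0. Qed.

Lemma rsum_notin X (s : seq letter) : b \notin unzip2 s -> rsum a b z X s = 0.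
Proof.
move=> hb; rewrite -(rsum0 s); apply: eq_rsum_split => s1 i s2 es.
by case/negP: hb; rewrite es /unzip2 map_cat mem_cat /= inE eqxx orbT.
Qed.

Lemma rsum_one X s1 i s2 : b \notin unzip2 s1 -> b \notin unzip2 s2 ->
  rsum a b z X (s1 ++ (i, b) :: s2) = X (s1 ++ (i, a) :: s2).
Proof.
move=> h1 h2; rewrite rsum_cat /= !rsum_notin // (count_memPn h1) eqxx.
by rewrite mulr0 addr0 add0r !mul1r.
Qed.

Lemma rsum_two X s1 i s2 j s3 :
  b \notin unzip2 s1 -> b \notin unzip2 s2 -> b \notin unzip2 s3 ->
  rsum a b z X (s1 ++ (i, b) :: s2 ++ (j, b) :: s3)
   = X (s1 ++ (i, a) :: s2 ++ (j, b) :: s3) + z * X (s1 ++ (i, b) :: s2 ++ (j, a) :: s3).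
Proof.
move=> h1 h2 h3; rewrite rsum_cat /= (rsum_notin _ h1) (count_memPn h1) eqxx.
by rewrite add0r !mul1r expr1 rsum_one.
Qed.

Lemma tv_one I c1 c2 : b \notin c1 -> b \notin c2 -> size I = size (c1 ++ b :: c2) ->
  tv a b z (zip I (c1 ++ b :: c2)) = (I == c1 ++ a :: c2)%:R.
Proof.
move=> h1 h2 hI; have un c : unzip2 (zip c c) = c by rewrite unzip2_zip.
rewrite (tv_rsum _ _ _ (I := c1 ++ b :: c2)) // zip_cat //= rsum_one ?un //.
by rewrite /unzip2 map_cat /= -!/(unzip2 _) !un eq_sym.
Qed.

Lemma tv_two I c1 c2 c3 : b \notin c1 -> b \notin c2 -> b \notin c3 ->
  size I = size (c1 ++ b :: c2 ++ b :: c3) ->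
  tv a b z (zip I (c1 ++ b :: c2 ++ b :: c3)) =
   (I == c1 ++ a :: c2 ++ b :: c3)%:R + z * (I == c1 ++ b :: c2 ++ a :: c3)%:R.
Proof.
move=> h1 h2 h3 hI; have un c : unzip2 (zip c c) = c by rewrite unzip2_zip.
rewrite (tv_rsum _ _ _ (I := c1 ++ b :: c2 ++ b :: c3)) // zip_cat //= zip_cat //= rsum_two ?un //.
by rewrite /unzip2 !map_cat /= !map_cat /= -!/(unzip2 _) !un !(eq_sym I).
Qed.
End RSum.

Lemma uniq_split2 (T : eqType) (x y : T) c1 c2 c3 : uniq (c1 ++ x :: c2 ++ y :: c3) ->
  [/\ x \notin c1, x \notin c2 & x \notin c3] /\ [/\ y \notin c1, y \notin c2 & y \notin c3].
Proof.
rewrite cat_uniq /= cat_uniq /= has_cat /= mem_cat inE.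
move=> h; do !split; apply/negP => h'; move: h; rewrite ?inE ?h' ?orbT ?andbF //=.
Qed.

Section Ideal.
Variables (k : fieldType) (l n r : nat) (eps : k).
Hypotheses (heps : l.-primitive_root eps) (hl : (3 <= l)%N).
Local Notation q := (eps ^+ 2).
Local Notation letter := (letter n).
Local Notation windex := (windex n r).
Local Notation wdual := (wdual k n r).
Let eps0 : eps != 0 := prim_neq0 hl heps.
Let eps1 : eps - eps^-1 != 0 := prim_sub_inv_neq0 hl heps.

Lemma wdual_lin c d (f g : wdual) w : (c *: f + d *: g) w = c * f w + d * g w.
Proof. by rewrite !ffunE. Qed.

Definition in_ideal (x : wdual) := exists2 x' : lqschur eps n r,
  ideal_gen (komega eps n r) x' & val x' = x.

Lemma in_ideal_lin c x y : in_ideal x -> in_ideal y -> in_ideal (c *: x + y).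
Proof. by case=> x' hx <- [y' hy <-]; exists (c *: x' + y') => //; apply: ideal_lin. Qed.

Lemma in_ideal_little x : in_ideal x -> little eps x.
Proof. by case=> x' _ <-; apply/asboolP/(valP x'). Qed.

Lemma in_ideal_qschur x : in_ideal x -> in_qschur eps x.
Proof. by move/in_ideal_little; apply: little_in_qschur. Qed.

Lemma in_ideal0 : in_ideal 0.
Proof.
have h : in_ideal (val (komega eps n r)) by exists (komega eps n r) => //; apply: ideal_e.
by rewrite -(addNr (val (komega eps n r))) -scaleN1r; apply: in_ideal_lin.
Qed.

Lemma in_idealZ c x : in_ideal x -> in_ideal (c *: x).
Proof. by move=> hx; rewrite -[_ *: _]addr0; apply: in_ideal_lin => //; apply: in_ideal0. Qed.

Lemma little_gtv (a b : 'I_n.+1) z : adjacent eps a b z -> little eps (gtv a b z eps r).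
Proof.
case=> -[hab ->].
  have ha : (a < n)%N by have := ltn_ord b; lia.
  have -> : a = widen_ord (leqnSn n) (Ordinal ha) by apply: val_inj.
  have -> : b = fintype.lift ord0 (Ordinal ha) by apply: val_inj; rewrite /= hab.
  by rewrite -zetaE_tv //; apply: little_E.
have hb : (b < n)%N by have := ltn_ord a; lia.
have -> : b = widen_ord (leqnSn n) (Ordinal hb) by apply: val_inj.
have -> : a = fintype.lift ord0 (Ordinal hb) by apply: val_inj; rewrite /= hab.
by rewrite -zetaF_tv //; apply: little_F.
Qed.

Lemma in_ideal_gtv_l (a b : 'I_n.+1) z x : adjacent eps a b z -> in_ideal x -> in_ideal (gtv a b z eps r * x).
Proof.
move=> /little_gtv h [x' hx <-]; exists (in_lqschur h * x') => //; exact: ideal_ml.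
Qed.

Lemma in_ideal_gtv_r (a b : 'I_n.+1) z x : adjacent eps a b z -> in_ideal x -> in_ideal (x * gtv a b z eps r).
Proof.
move=> /little_gtv h [x' hx <-]; exists (x' * in_lqschur h) => //; exact: ideal_mr.
Qed.

Hypothesis hr : (r <= n.+1)%N.

Definition womega : windex := [tuple widen_ord hr s | s < r].

Lemma val_womega : map val womega = iota 0 r.
Proof.
by rewrite /= -map_comp -[RHS]val_enum_ord; apply: eq_map.
Qed.

Lemma uniq_womega : uniq womega.
Proof. by rewrite -(map_inj_uniq val_inj) val_womega iota_uniq. Qed.

Lemma mem_womega a : (a \in womega) = (a < r)%N.
Proof. by rewrite -(mem_map val_inj) val_womega mem_iota. Qed.

(** A factor vanishes as soon as some letter below r is missing; a tuple of length r missing none of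
    them is a permutation of [womega]. *)
Lemma val_komega_perm : val (komega eps n r) = dg (fun c : windex => (perm_eq c womega)%:R).
Proof.
rewrite (val_komega n r eps0); congr dg; apply/funext => c.
have [hc|hc] := boolP (perm_eq c womega).
  apply: big1 => a _; case: ifP => // ha.
  have -> : count_mem a c = 1%N.
    by rewrite (permP hc) count_uniq_mem ?uniq_womega // mem_womega ha.
  by rewrite expr1 divff.
have [h|] := boolP [forall (a : 'I_n.+1 | (a < r)%N), a \in tval c]; last first.
  rewrite negb_forall_in => /exists_inP [a ha /count_memPn hac].
  by rewrite (bigD1 a) //= ha hac expr0 invr1 subrr !mul0r.
case/negP: hc; rewrite perm_sym.
have sub : {subset womega <= c}.
  by move=> a; rewrite mem_womega => ha; apply: (forall_inP h).
have sz : (size c <= size womega)%N by rewrite !size_tuple.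
have [eq_sz mem_eq] := uniq_min_size uniq_womega sub sz.
by apply: uniq_perm; rewrite ?uniq_womega // (leq_size_uniq uniq_womega sub sz).
Qed.

(* A e is identified with the r-th tensor power of k^n by y |-> y (_, womega): here y
   corresponds to the basis vector j. *)
Definition vec_elt (y : wdual) (j : windex) := [/\ in_ideal y,
  forall I c : windex, ~~ perm_eq c womega -> y (word I c) = 0
  & forall I, y (word I womega) = (I == j)%:R].

Lemma vec_elt_omega : vec_elt (val (komega eps n r)) womega.
Proof.
split; first by exists (komega eps n r) => //; apply: ideal_e.
  by move=> I c hc; rewrite val_komega_perm ffunE rows_word cols_word; case: eqP => [->|_]; rewrite ?(negPf hc) ?mulr0 ?mul0r.
move=> I; rewrite val_komega_perm ffunE rows_word cols_word; case: eqP => [->|_]; last by rewrite mul0r.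
by rewrite perm_refl mul1r.
Qed.

Definition reachable j := exists y, vec_elt y j.

Lemma gtv_vec (a b : 'I_n.+1) z y (j I : windex) : vec_elt y j ->
  (gtv a b z eps r * y) (word I womega) = tv_coef eps a b z j * tv a b z (zip I j).
Proof.
case=> _ _ hy; rewrite gtv_mul (bigD1 j) //= hy eqxx mulr1 big1 ?addr0 // => t /negPf ht.
by rewrite hy ht mulr0.
Qed.

Lemma gtv_vec0 (a b : 'I_n.+1) z y (j I c : windex) : vec_elt y j -> ~~ perm_eq c womega ->
  (gtv a b z eps r * y) (word I c) = 0.
Proof.
by case=> _ hy _ hc; rewrite gtv_mul big1 // => t _; rewrite hy ?mulr0.
Qed.

Lemma tv_coef_neq0 (a b : 'I_n.+1) z (c : seq 'I_n.+1) : adjacent eps a b z -> tv_coef eps a b z c != 0.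
Proof.
move=> hab; have z0 := adj_z0 hab eps0; rewrite /tv_coef /tv_norm mulf_neq0 //.
  by rewrite invr_eq0 expf_neq0.
by case: ifP; rewrite ?oner_neq0 // mulf_neq0 // invr_eq0 expf_neq0.
Qed.

Definition adj (a b : nat) := (b = a.+1) \/ (a = b.+1).

Lemma adj_adjacent (a b : 'I_n.+1) : adj a b -> exists z, adjacent eps a b z.
Proof. by case=> h; [exists q; left | exists q^-1; right]. Qed.

(** The letter b occurs only once in j, so the generator sends the vector j to [tv_coef] times the
    vector j', and this scalar is invertible. *)
Lemma reachable_move (a b : 'I_n.+1) c1 c2 (j j' : windex) : adj a b ->
  tval j = c1 ++ b :: c2 -> b \notin c1 -> b \notin c2 -> tval j' = c1 ++ a :: c2 ->
  reachable j -> reachable j'.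
Proof.
case/adj_adjacent => z hab ej h1 h2 ej' [y hy].
have c0 := tv_coef_neq0 j hab.
exists ((tv_coef eps a b z j)^-1 *: (gtv a b z eps r * y)); split.
- by apply/in_idealZ/in_ideal_gtv_l => //; case: hy.
- by move=> I c hc; rewrite ffunE (gtv_vec0 _ _ _ _ hy) // scaler0.
- move=> I; rewrite ffunE (gtv_vec _ _ _ _ hy) -[_ *: _]/(_ * _) mulKf // ej.
  by rewrite tv_one // -?ej ?size_tuple // -ej'.
Qed.

Lemma reachable_swap (a b : 'I_n.+1) c1 c2 c3 (j j' : windex) : adj a b ->
  tval j = c1 ++ b :: c2 ++ a :: c3 -> tval j' = c1 ++ a :: c2 ++ b :: c3 ->
  uniq j -> reachable j -> reachable j'.
Proof.
move=> hab ej ej' uj hj.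
have nab : a != b by rewrite -val_eqE /=; case: hab; lia.
have [z hba] : exists z, adjacent eps b a z by apply: adj_adjacent; case: hab; [right|left].
have sz : size (c1 ++ a :: c2 ++ a :: c3) == r.
  by rewrite -(size_tuple j) ej !size_cat /= !size_cat.
have nba : (b == a) = false by rewrite eq_sym (negPf nab).
move: uj; rewrite ej => /uniq_split2 [[b1 b2 b3] [a1 a2 a3]].
pose j1 : windex := Tuple sz.
have [y1 hy1] : reachable j1.
  apply: (reachable_move hab ej b1 _ _ hj) => //.
  by rewrite mem_cat inE nba (negPf b2) (negPf b3).
have [y hy] := hj; have c0 := tv_coef_neq0 j1 hba; have z0 := adj_z0 hba eps0.
exists ((tv_coef eps b a z j1 * z)^-1 *: (gtv b a z eps r * y1) + (- z^-1) *: y); split.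
- by apply: in_ideal_lin; [apply: in_ideal_gtv_l => //; case: hy1|apply: in_idealZ; case: hy].
- move=> I c hc; rewrite wdual_lin (gtv_vec0 _ _ _ _ hy1) // mulr0 add0r.
  by case: hy => _ -> //; rewrite mulr0.
- move=> I; rewrite wdual_lin (gtv_vec _ _ _ _ hy1) tv_two ?size_tuple //; last exact/esym/eqP.
  case: hy => _ _ ->; rewrite -!val_eqE /= ej ej'.
  by field; apply/andP; split.
Qed.

Lemma reachable_perm (j : windex) : perm_eq j womega -> reachable j.
Proof.
have [m] := ubnP (wsum (map val j)); elim: m j => // m IH j; rewrite ltnS => hm hj.
have [->|nj] := eqVneq j womega; first by exists (val (komega eps n r)); apply: vec_elt_omega.
have sj : size (map val j) = r by rewrite size_map size_tuple.
have [||c1 [x [c2 [c3 ej]]]] := @perm_iota_descent (map val j).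
- by rewrite sj -val_womega; apply: perm_map.
- by rewrite sj -val_womega; apply: contra nj => /eqP /(inj_map val_inj) /val_inj ->.
have uj : uniq j by rewrite (perm_uniq hj) uniq_womega.
have [d1 [X1 [d' [ej' e1 eX1 ed]]]] := map_eq_cat ej.
have [d2 [X0 [d3 [ed' e2 eX0 e3]]]] := map_eq_cat ed.
rewrite ed' in ej'.
have sz : size (d1 ++ X0 :: d2 ++ X1 :: d3) == r.
  by rewrite -(size_tuple j) ej' !size_cat /= !size_cat.
have pj : perm_eq (d1 ++ X0 :: d2 ++ X1 :: d3) j.
  rewrite ej'; apply/permP => P; rewrite !count_cat /= !count_cat /=; clear; lia.
have adj10 : adj X1 X0 by right; rewrite /= eX1 eX0.
apply: (@reachable_swap X1 X0 d1 d2 d3 (Tuple sz) j adj10) => //=.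
  by rewrite (perm_uniq pj).
apply: IH => /=; last exact: perm_trans pj hj.
apply: leq_trans hm; rewrite ej' !map_cat /= !map_cat /= e1 e2 e3 eX1 eX0.
exact: wsum_swap.
Qed.

Lemma reachable_all (j : windex) : reachable j.
Proof.
have [m] := ubnP (disp 0 (sort leq (map val j))); elim: m j => // m IH j; rewrite ltnS => hm.
set s := sort leq (map val j) in hm.
have sz : size s = r by rewrite size_sort size_map size_tuple.
have ps : perm_eq s (map val j) by rewrite perm_sort.
have [es|ns] := eqVneq s (iota 0 (size s)).
  apply: reachable_perm; apply: (perm_map_inj val_inj); rewrite val_womega perm_sym.
  by move: ps; rewrite [X in perm_eq X]es sz.
have [||||c1 [b [c2 [a [es aN hd hab]]]]] := @sorted_move n.+1 s.
- exact/sort_sorted/leq_total.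
- by rewrite sz.
- by rewrite (perm_all _ ps) all_map; apply/allP => x _ /=.
- exact: ns.
have bs : b \in map val j by rewrite -(perm_mem ps) es mem_cat inE eqxx orbT.
have : a \notin map val j.
  rewrite -(perm_mem ps) es mem_cat inE !negb_or.
  by case: hab => -[-> [/allP h1 /allP h2]]; apply/and3P; split; apply/negP; [move/h1|move/eqP|move/h2|move/h1|move/eqP|move/h2]; lia.
move=> aj.
have [c1' [c2' ej]] : exists c1' c2', map val j = c1' ++ b :: c2'.
  by case/splitPr: bs => d1 d2; exists d1, d2.
have [d1 [B [d2 [{}ej _ eB _]]]] := map_eq_cat ej.
pose a' := Ordinal aN.
have ha' : a' \notin tval j by apply: contra aj => h; apply/mapP; exists a'.
have szj : size (d1 ++ a' :: d2) == r by rewrite -(size_tuple j) ej !size_cat.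
have adjBa : adj B a' by rewrite /adj /= eB; case: hab => -[-> _]; [left|right].
move: ha'; rewrite ej mem_cat inE !negb_or => /and3P [ad1 _ ad2].
apply: (@reachable_move B a' d1 d2 (Tuple szj) j adjBa) => //.
apply: IH; apply: leq_trans hm; rewrite es /=.
suff -> : sort leq (map val (d1 ++ a' :: d2)) = c1 ++ a :: c2 by rewrite -es.
apply: (sorted_eq leq_trans anti_leq); first exact/sort_sorted/leq_total.
  have : sorted leq s by exact/sort_sorted/leq_total.
  rewrite es !(sorted_pairwise leq_trans) !pairwise_cat /= => /and3P [h1 -> /andP [h2 ->]].
  rewrite andbT /=; apply/andP; split.
    apply/allrelP => x y xc; rewrite inE => /orP [/eqP ->|yc].
      by case: hab => -[e [/allP h _]]; move: e (h _ xc); clear; lia.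
    by apply: (allrelP h1) => //; rewrite inE yc orbT.
  apply/allP => y yc; case: hab => -[e [_ /allP h]]; first exact: ltnW (h _ yc).
  by apply: leq_trans (h _ yc); rewrite e.
rewrite perm_sort map_cat /= perm_sym.
apply/permP => P; have := permP ps P; rewrite es ej map_cat !count_cat /= eB; clear; lia.
Qed.
End Ideal.

(** * The two-sided ideal A e A *)

Section SortedWords.
Variable n : nat.
Local Notation letter := (letter n).
Local Notation cle := (@cle n).

Lemma filter_split (P : pred letter) (s : seq letter) : pairwise cle s ->
  (forall x y, cle x y -> P y -> P x) -> s = filter P s ++ filter (predC P) s.
Proof.
move=> hs hP; elim: s hs => //= x s IH /andP [hx /IH {IH}es].
have [Px|nPx] := boolP (P x); first by rewrite cat_cons -es.
have nP : all (predC P) s.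
  by apply/allP => y /(allP hx) xy; apply: contra nPx => /(hP _ _ xy).
rewrite (all_filterP nP) (_ : filter P s = [::]) //.
by apply/eqP; rewrite -[_ == _]negbK -has_filter -all_predC.
Qed.

Lemma sorted_block (x : letter) s : pairwise cle s ->
  exists U V, [/\ s = U ++ nseq (count_mem x s) x ++ V, x \notin U & x \notin V].
Proof.
move=> hs; have tr := @cle_trans n; have an := @cle_anti n.
have e1 := @filter_split (fun y => ~~ cle x y) s hs (fun y z yz => contra (fun xy => tr _ _ _ xy yz)).
set U := filter _ s in e1; set W := filter _ s in e1.
have hW : pairwise cle W by move: hs; rewrite e1 pairwise_cat => /and3P [].
have e2 := @filter_split (fun y => cle y x) W hW (fun y z yz => tr _ _ _ yz).
set N := filter _ W in e2; set V := filter _ W in e2.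
have hN : all (pred1 x) N.
  apply/allP => y; rewrite !mem_filter /= negbK => /and3P [yx xy _].
  by apply/eqP/an; rewrite yx xy.
have xU : x \notin U by rewrite mem_filter cle_refl.
have xV : x \notin V by rewrite mem_filter /= cle_refl.
exists U, V; split=> //; rewrite {1}e1 e2; congr (_ ++ (_ ++ _)).
rewrite e1 e2 !count_cat (count_memPn xU) (count_memPn xV) add0n addn0.
by move/all_pred1P: (hN); rewrite (eqP (etrans (esym (all_count _ _)) hN)).
Qed.
End SortedWords.

Section Straighten.
Variables (k : fieldType) (eps : k) (n r : nat).
Hypothesis eps0 : eps != 0.
Local Notation letter := (letter n).
Local Notation q := (eps ^+ 2).
Variable f : wdual k n r.
Hypothesis hf : in_qschur eps f.
Variables (a b i : 'I_n.+1).

(** The letter (i, a) has come to stand inside column b. Each (j, b) that it has to pass has j >= i,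
    so only the commuting relation or the one with factor q is used and no correction term
    arises. *)
Lemma straighten_right u m v : (b < a)%N -> all (fun x : letter => (x.2 == b) && (i <= x.1)%N) m ->
  weval f (u ++ (i, a) :: m ++ v) = q ^- count (fun x : letter => (i < x.1)%N) m
     * weval f (u ++ m ++ (i, a) :: v).
Proof.
have q0 : q != 0 by rewrite expf_neq0.
move=> ba; elim: m u => [|[j c] m IH] u /=; first by rewrite invr1 mul1r.
case/andP=> /andP [/eqP -> ij] hm.
have := IH (u ++ [:: (j, b)]) hm; rewrite -!catA /= => e.
have [r1 r2 _] := hf u (m ++ v).
have [lij|lji|/val_inj eij] := ltngtP i j; last by rewrite -eij in e *; rewrite (r1 i a b) e add0n.
  rewrite /= add1n exprS invfM -mulrA -e; apply: (mulfI q0).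
  by rewrite mulVKf // (r2 j b i a) // ltnW.
by move: ij; rewrite leqNgt lji.
Qed.

Lemma straighten_left u m v : (a < b)%N -> all (fun x : letter => (x.2 == b) && (x.1 <= i)%N) m ->
  weval f (u ++ m ++ (i, a) :: v) = q ^- count (fun x : letter => (x.1 < i)%N) m
     * weval f (u ++ (i, a) :: m ++ v).
Proof.
have q0 : q != 0 by rewrite expf_neq0.
move=> ab; elim: m u => [|[j c] m IH] u /=; first by rewrite invr1 mul1r.
case/andP=> /andP [/eqP -> ji] hm.
have := IH (u ++ [:: (j, b)]) hm; rewrite -!catA /= => e.
have [r1 r2 _] := hf u (m ++ v).
have [lji|lij|/val_inj eij] := ltngtP j i; last by rewrite eij in e *; rewrite e (r1 i b a) add0n.
  rewrite /= add1n exprS invfM -mulrA e mulrCA; congr (_ * _); apply: (mulfI q0).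
  by rewrite mulVKf // [RHS](_ : _ = weval f (u ++ [:: (i, a); (j, b)] ++ m ++ v)) // (r2 i a j b) // ltnW.
by move: ji; rewrite leqNgt lij.
Qed.
End Straighten.

Section DualBasis.
Variables (k : fieldType) (l n r : nat) (eps : k).
Hypotheses (heps : l.-primitive_root eps) (hl : (3 <= l)%N) (hodd : odd l).
Hypothesis hr : (r <= n.+1)%N.
Local Notation q := (eps ^+ 2).
Local Notation letter := (letter n).
Local Notation cle := (@cle n).
Local Notation windex := (windex n r).
Local Notation wdual := (wdual k n r).
Let eps0 : eps != 0 := prim_neq0 hl heps.

Definition dual_elt (y : wdual) (s : seq letter) := in_ideal eps y /\
  forall t : r.-tuple letter, sorted cle t -> y t = (tval t == s)%:R.

Lemma in_qschur_mask (P : pred (seq 'I_n.+1)) (f : wdual) :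
  (forall s t, perm_eq s t -> P s = P t) -> in_qschur eps f ->
  in_qschur eps [ffun w : r.-tuple letter => (P (cols w))%:R * f w : k^o].
Proof.
move=> hP hf u v.
have W s : weval [ffun w : r.-tuple letter => (P (cols w))%:R * f w : k^o] s = (P (unzip2 s))%:R * weval f s.
  have [hs|hs] := eqVneq (size s) r; last by rewrite !weval_size // mulr0.
  pose w : r.-tuple letter := Tuple (introT eqP hs).
  by rewrite -[s]/(tval w) !weval_tuple ffunE.
have [f1 f2 f3] := hf u v; rewrite /unzip2 in W *.
split=> [i j m|i j a b h1 h2|i j a b h1 h2]; rewrite !W !map_cat /=.
- by rewrite (hP _ _ (perm_swap _ _ j m)) f1.
- by rewrite (hP _ _ (perm_swap _ _ j b)) f2 // mulrCA.
- by rewrite (hP _ _ (perm_swap _ _ b j)) f3 // mulrDr mulrCA.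
Qed.

(** The relations preserve the multiset of columns. Hence the restriction of y to the other
    multisets still lies in S; it is 0 on sorted words, thus 0. *)
Lemma dual_elt_content y s (w : r.-tuple letter) : dual_elt y s ->
  ~~ perm_eq (cols w) (unzip2 s) -> y w = 0.
Proof.
case=> hy ys hw.
pose P (c : seq 'I_n.+1) := ~~ perm_eq c (unzip2 s).
have hP c d : perm_eq c d -> P c = P d.
  by move=> h; rewrite /P; congr (~~ _); apply/idP/idP => h'; [rewrite perm_sym in h|]; exact: perm_trans h h'.
have := in_qschur_mask hP (in_ideal_qschur heps hl hy).
move=> /(in_qschur_eq0 eps0) h.
have /h /ffunP /(_ w) : forall A, Xi r A ->
    weval [ffun w : r.-tuple letter => (P (cols w))%:R * y w : k^o] (monomial A) = 0.
  move=> A /size_monomial hA; pose t : r.-tuple letter := Tuple (introT eqP hA).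
  rewrite -[monomial A]/(tval t) weval_tuple ffunE ys; last exact: sorted_monomial.
  case: (eqVneq (tval t) s) => [e|_]; last by rewrite mulr0.
  by rewrite /P -e perm_refl mul0r.
by rewrite !ffunE /P hw mul1r.
Qed.

(** Among sorted words with these column letters the columns are exactly [womega] and only the rows
    vary. So the element corresponding to the basis vector given by the rows of s will do. *)
Lemma dual_elt_omega (s : seq letter) : size s = r -> sorted cle s -> perm_eq (unzip2 s) (womega hr) ->
  exists y, dual_elt y s.
Proof.
have sorted_cols t : sorted cle t -> perm_eq (unzip2 t) (womega hr) -> unzip2 t = womega hr.
  move=> ht hp; apply: (inj_map val_inj); rewrite val_womega.
  apply: (sorted_eq leq_trans anti_leq); last by rewrite -(val_womega hr); apply: perm_map.
    rewrite (sorted_pairwise leq_trans) !pairwise_map.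
    move: ht; rewrite (sorted_pairwise (@cle_trans n)); apply: sub_pairwise => -[? ?] [? ?] /=.
    by rewrite /cle -!val_eqE /=; lia.
  exact: iota_sorted.
move=> sz ss ps; have es := sorted_cols _ ss ps.
pose w : r.-tuple letter := Tuple (introT eqP sz).
have [y [hy y0 yw]] := reachable_all heps hl hr (rows w).
exists y; split=> // t st; rewrite -[t]wordK.
have [ht|ht] := boolP (perm_eq (cols t) (womega hr)); last first.
  rewrite y0 //; case: eqVneq => // e; case/negP: ht.
  by rewrite wordK in e; rewrite /= e.
have -> : cols t = womega hr by apply: val_inj; exact: sorted_cols.
rewrite yw; congr (_%:R); congr nat_of_bool.
have ew : word (rows w) (womega hr) = w.
  by rewrite -[RHS]wordK; congr word; apply: val_inj.
apply/eqP/eqP => [->|e]; first by rewrite ew.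
have e2 : word (rows t) (womega hr) = w by apply: val_inj.
by rewrite -(rows_word (rows t) (womega hr)) e2.
Qed.

Lemma notin_col (i a : 'I_n.+1) (s : seq letter) : a \notin unzip2 s -> (i, a) \notin s.
Proof. by apply: contra => h; apply/mapP; exists (i, a). Qed.

Lemma rsum_mem (a b i : 'I_n.+1) z (s : seq letter) : adjacent eps a b z ->
  pairwise cle s -> a \notin unzip2 s -> (0 < count_mem (i, b) s < l)%N ->
  rsum a b z (fun t => ((i, a) \in t)%:R) s != 0.
Proof.
move=> hab hs ha /andP [m0 ml]; have [U [V [es iU iV]]] := sorted_block (i, b) hs.
set m := count_mem _ s in es m0 ml.
have nab := adj_neq hab.
have : a \notin unzip2 U /\ a \notin unzip2 V.
  by apply/andP; move: ha; rewrite es /unzip2 !map_cat !mem_cat !negb_or => /and3P [-> _ ->].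
case=> aU aV.
have aN p : a \notin unzip2 (nseq p (i, b)).
  by rewrite /unzip2 map_nseq mem_nseq /= (negPf nab) andbF.
have miss W u v : a \notin unzip2 W -> a \notin unzip2 u -> a \notin unzip2 v -> (i, b) \notin W ->
    rsum a b z (fun t => ((i, a) \in u ++ t ++ v)%:R) W = 0.
  move=> aW au av iW; rewrite -[RHS](rsum0 a b z W); apply: eq_rsum_split => s1 j s2 eW.
  rewrite !mem_cat !inE xpair_eqE eqxx andbT.
  move: aW iW; rewrite eW /unzip2 map_cat /= !mem_cat !inE !negb_or => /and3P [a1 _ a2] /and3P [_ ij _].
  rewrite (negPf (notin_col i au)) (negPf (notin_col i av)) (negPf (notin_col i a1)) (negPf (notin_col i a2)).
  by move: ij; rewrite xpair_eqE eqxx andbT => /negPf ->.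
have aNV : a \notin unzip2 (nseq m (i, b) ++ V).
  by rewrite /unzip2 map_cat mem_cat negb_or; apply/andP; split; [exact: aN | exact: aV].
rewrite es rsum_cat -[X in X + _](_ : rsum a b z (fun t => ((i, a) \in [::] ++ t ++ (nseq m (i, b) ++ V))%:R) U = _) //.
rewrite miss // add0r mulf_neq0 ?expf_neq0 ?(adj_z0 hab eps0) // rsum_cat.
rewrite (@rsum_nseq _ _ _ _ _ _ _ _ 1) => [|p hp]; last first.
  by rewrite !mem_cat inE eqxx !orbT.
rewrite (_ : rsum _ _ _ _ V = 0) ?mulr0 ?addr0 ?mulr1; last first.
  rewrite -(miss V (U ++ nseq m (i, b)) [::]) //; last first.
    by rewrite /unzip2 map_cat mem_cat negb_or; apply/andP; split; [exact: aU | exact: aN].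
  by apply: eq_rsum => t _; rewrite cats0 catA.
by rewrite (adj_geom heps hl hodd _ hab) gtnNdvd.
Qed.

Lemma pairwise_move (a b i : 'I_n.+1) (s1 s2 : seq letter) : pairwise cle (s1 ++ (i, b) :: s2) ->
  (a = b.+1 :> nat /\ all (fun x : letter => x.2 <= b)%N s1 /\ all (fun x : letter => a < x.2)%N s2) \/
  (b = a.+1 :> nat /\ all (fun x : letter => x.2 < a)%N s1 /\ all (fun x : letter => b <= x.2)%N s2) ->
  pairwise cle (s1 ++ (i, a) :: s2).
Proof.
move=> ps hcase; move: ps; rewrite !pairwise_cat /= => /and3P [h1 -> /andP [h2 ->]].
rewrite andbT /=; apply/andP; split.
  apply/allrelP => x x' xs; rewrite inE => /orP [/eqP ->|xs']; last first.
    by apply: (allrelP h1) => //; rewrite inE xs' orbT.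
  by rewrite /cle; case: hcase => -[e [/allP h _]]; move: e (h _ xs) => /=; rewrite -val_eqE /=; clear; lia.
apply/allP => x xs; rewrite /cle; case: hcase => -[e [_ /allP h]]; move: e (h _ xs) => /=; clear; lia.
Qed.

(** Multiply y on the right by the generator changing b to a in the columns. At a sorted word t
    every changed word straightens to a multiple of one sorted word, which is the word of y only if
    t = s and the changed letter has row i. The value at s is then a product of units, by
    [rsum_mem]. *)
Lemma dual_move (a b i : 'I_n.+1) s1 s2 y : let s := s1 ++ (i, b) :: s2 in
  sorted cle s -> a \notin unzip2 s -> (forall x, (count_mem x s < l)%N) ->
  (a = b.+1 :> nat /\ all (fun x : letter => x.2 <= b)%N s1 /\ all (fun x : letter => a < x.2)%N s2) \/
  (b = a.+1 :> nat /\ all (fun x : letter => x.2 < a)%N s1 /\ all (fun x : letter => b <= x.2)%N s2) ->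
  dual_elt y (s1 ++ (i, a) :: s2) -> exists y', dual_elt y' s.
Proof.
move=> s ss as_ sl hcase hy; set s' := s1 ++ (i, a) :: s2 in hy.
have tr := @cle_trans n; have ps : pairwise cle s by rewrite -(sorted_pairwise tr).
have ps' : pairwise cle s' by exact: pairwise_move ps hcase.
have [z hab] : exists z, adjacent eps a b z.
  by apply: adj_adjacent; case: hcase => -[h _]; [right|left].
have nab := adj_neq hab; have z0 := adj_z0 hab eps0.
have q0 : q != 0 by rewrite expf_neq0.
have yS := in_ideal_qschur heps hl hy.1.
have ys (w : seq letter) : pairwise cle w -> size w = r -> weval y w = (w == s')%:R.
  move=> pw sw; pose t : r.-tuple letter := Tuple (introT eqP sw).
  by rewrite -[w]/(tval t) weval_tuple; case: hy => _ ->; rewrite ?(sorted_pairwise tr).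
have key t1 j t2 w : let t := t1 ++ (j, b) :: t2 in pairwise cle t -> pairwise cle w ->
    perm_eq w ((j, a) :: t1 ++ t2) -> (w == s') = (j == i) && (t == s).
  move=> t pt pw hw; apply/eqP/andP => [ew|[/eqP ej /eqP et]].
    have a12 : a \notin unzip2 (s1 ++ s2).
      by move: as_; rewrite /s /unzip2 !map_cat !mem_cat /= inE !negb_or => /and3P [-> _ ->].
    have : (j, a) \in s' by rewrite -ew (perm_mem hw) mem_head.
    rewrite /s' mem_cat inE orbCA -mem_cat (negPf (notin_col j a12)) orbF xpair_eqE eqxx andbT => /eqP ej.
    rewrite ej eqxx; split=> //; apply/eqP/(sorted_eq tr (@cle_anti n)); rewrite ?(sorted_pairwise tr) //.
    apply/permP => P; move: (permP hw P); rewrite ew /s /t /s' ej /= ?count_cat /= ?count_cat; clear; lia.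
  apply: (sorted_eq tr (@cle_anti n)); rewrite ?(sorted_pairwise tr) //.
  apply: perm_trans hw _; apply/permP => P; move: (congr1 (count P) et).
  by rewrite /s /t /s' ej /= ?count_cat /= ?count_cat; clear; lia.
(* The number of factors 1/q produced when the new letter (i, a) leaves the column block b, to the
   right or to the left. It does not depend on which copy of (i, b) was changed. *)
pose kap := if (b < a)%N then count (fun x : letter => (x.2 == b) && (i < x.1)%N) s
            else count (fun x : letter => (x.2 == b) && (x.1 < i)%N) s.
have term t1 j t2 : let t := t1 ++ (j, b) :: t2 in pairwise cle t -> size t = r -> a \notin unzip2 t ->
    weval y (t1 ++ (j, a) :: t2) = q ^- kap * ((j == i) && (t == s))%:R.
  move=> t pt st at_.
  have at12 : forall x, x \in t1 ++ t2 -> x.2 != a.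
    move=> x xt; apply: contra at_ => /eqP <-; apply/mapP; exists x => //.
    by move: xt; rewrite /t !mem_cat inE => /orP [->|->]; rewrite ?orbT.
  move: (pt); rewrite pairwise_cat /= => /and3P [p1 pt1 /andP [p2 pt2]].
  case: hcase => -[eab _].
    have lba : (b < a)%N by rewrite eab.
    have pl : forall x x' : letter, cle x x' -> (x'.2 <= b)%N -> (x.2 <= b)%N.
      by move=> x x'; rewrite /cle -val_eqE /=; clear; lia.
    have et2 := filter_split pt2 pl; set m := filter _ t2 in et2; set v := filter _ t2 in et2.
    have hm : all (fun x : letter => (x.2 == b) && (j <= x.1)%N) m.
      apply/allP => x; rewrite mem_filter => /andP [xb /(allP p2)].
      by rewrite /cle -!val_eqE /=; move: xb; clear; lia.
    have hv : all (fun x : letter => a < x.2)%N v.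
      apply/allP => x; rewrite mem_filter /= -ltnNge => /andP [bx xt2].
      by have := at12 x; rewrite mem_cat xt2 orbT -val_eqE /= => /(_ isT); move: bx eab; clear; lia.
    rewrite [in LHS]et2 (straighten_right eps0 yS _ _ lba hm).
    clearbody m v; rewrite et2 in p1 p2 pt2.
    have pw : pairwise cle (t1 ++ m ++ (j, a) :: v).
      move: pt2; rewrite !pairwise_cat pt1 /= => /and3P [mv -> ->]; rewrite !andbT /=.
      apply/and3P; split.
      - apply/allrelP => x x' xt; rewrite mem_cat inE orbCA => /orP [/eqP ->|x'm].
          have := allrelP p1 _ _ xt (mem_head _ _); rewrite /cle -!val_eqE /=; move: lba; clear; lia.
        by apply: (allrelP p1) => //; rewrite inE mem_cat x'm orbT.
      - apply/allrelP => x x' xm; rewrite inE => /orP [/eqP ->|x'v]; last exact: (allrelP mv).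
        by have /andP [/eqP xb _] := allP hm _ xm; rewrite /cle xb lba.
      - by apply/allP => x /(allP hv) h; rewrite /cle h.
    rewrite ys //; last by rewrite -st /t et2 !size_cat /= !size_cat addnS.
    rewrite (key t1 j t2) //; last first.
      by rewrite et2; apply/permP => P; rewrite /= ?count_cat /= ?count_cat; clear; lia.
    have [/andP [/eqP ej /eqP es]|_] := boolP ((j == i) && (t1 ++ (j, b) :: t2 == s)); last by rewrite !mulr0.
    congr (q ^- _ * _); rewrite /kap lba -es et2 count_cat /= count_cat ej ltnn andbF add0n.
    rewrite [X in (X + _)%N](_ : _ = 0%N); last first.
      apply/eqP; rewrite -leqn0 leqNgt -has_count; apply/hasPn => x xt.
      by have := allrelP p1 _ _ xt (mem_head _ _); rewrite ej /cle -!val_eqE /=; clear; lia.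
    rewrite [X in (_ + (_ + X))%N](_ : _ = 0%N); last first.
      apply/eqP; rewrite -leqn0 leqNgt -has_count; apply/hasPn => x xv.
      by have := allP hv _ xv; rewrite -!val_eqE /=; move: lba; clear; lia.
    rewrite add0n addn0; apply: eq_in_count => x xm /=.
    by have /andP [-> _] := allP hm _ xm.
  have lab : (a < b)%N by rewrite eab.
  have pl : forall x x' : letter, cle x x' -> (x'.2 < b)%N -> (x.2 < b)%N.
    by move=> x x'; rewrite /cle -val_eqE /=; clear; lia.
  have et1 := filter_split pt1 pl; set v := filter _ t1 in et1; set m := filter _ t1 in et1.
  have hm : all (fun x : letter => (x.2 == b) && (x.1 <= j)%N) m.
    apply/allP => x; rewrite mem_filter => /andP [xb xt].
    by have := allrelP p1 _ _ xt (mem_head _ _); move: xb; rewrite /cle -!val_eqE /=; clear; lia.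
  have hv : all (fun x : letter => x.2 < a)%N v.
    apply/allP => x; rewrite mem_filter => /andP [xb xt].
    by have := at12 x; rewrite mem_cat xt -val_eqE /= => /(_ isT); move: xb eab; clear; lia.
  rewrite [in LHS]et1 -catA (straighten_left eps0 yS _ _ lab hm).
  clearbody m v; rewrite et1 in p1 pt1.
  have pw : pairwise cle (v ++ (j, a) :: m ++ t2).
    move: pt1; rewrite !pairwise_cat /= pairwise_cat pt2 => /and3P [vm -> ->]; rewrite !andbT /=.
    apply/and3P; split.
    - apply/allrelP => x x' xv; rewrite inE mem_cat => /or3P [/eqP ->|x'm|x't].
      + by have h := allP hv _ xv; rewrite /cle h.
      + exact: (allrelP vm).
      + by apply: (allrelP p1); rewrite ?mem_cat ?xv // inE x't orbT.
    - apply/allP => x; rewrite mem_cat => /orP [xm|xt].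
        by have /andP [/eqP xb _] := allP hm _ xm; rewrite /cle xb lab.
      by have := allP p2 _ xt; rewrite /cle -!val_eqE /=; move: lab; clear; lia.
    - apply/allrelP => x x' xm x't.
      by apply: (allrelP p1); rewrite ?mem_cat ?xm ?orbT // inE x't orbT.
  rewrite ys //; last by rewrite -st /t et1 !size_cat /= !size_cat -addnS addnA.
  rewrite (key t1 j t2) //; last first.
    by rewrite et1; apply/permP => P; rewrite /= ?count_cat /= ?count_cat; clear; lia.
  have [/andP [/eqP ej /eqP es]|_] := boolP ((j == i) && (t1 ++ (j, b) :: t2 == s)); last by rewrite !mulr0.
  congr (q ^- _ * _); rewrite /kap ltnNge (ltnW lab) -es et1 !count_cat /= ej ltnn andbF add0n.
  rewrite [X in (_ + X)%N](_ : _ = 0%N); last first.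
    apply/eqP; rewrite -leqn0 leqNgt -has_count; apply/hasPn => x xt.
    by have := allP p2 _ xt; rewrite ej /cle -!val_eqE /=; clear; lia.
  rewrite [X in (X + _ + _)%N](_ : _ = 0%N); last first.
    apply/eqP; rewrite -leqn0 leqNgt -has_count; apply/hasPn => x xv.
    by have := allP hv _ xv; rewrite -!val_eqE /=; move: lab; clear; lia.
  rewrite add0n addn0; apply: eq_in_count => x xm /=.
  by have /andP [-> _] := allP hm _ xm.
exists ((tv_coef eps a b z (unzip2 s) * (q ^- kap * rsum a b z (fun t => ((i, a) \in t)%:R) s))^-1 *: (y * gtv a b z eps r)).
split; first exact: (in_idealZ _ (in_ideal_gtv_r heps hl hab hy.1)).
move=> t; rewrite (sorted_pairwise tr) => pt; rewrite ffunE -[_ *: _]/(_ * _) -weval_tuple weval_mul_gtv.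
(* If a already occurs in t, every changed word has at least two a's among its columns, whereas y
   lives on a content with one. *)
have [at_|at_] := boolP (a \in unzip2 t).
  rewrite (_ : (tval t == s) = false); last by apply/eqP => e; move: at_; rewrite e (negPf as_).
  suff -> : rsum a b z (weval y) t = 0 by rewrite !mulr0.
  rewrite -[RHS](rsum0 a b z t); apply: eq_rsum_split => t1 j t2 et.
  have sw : size (t1 ++ (j, a) :: t2) = r by rewrite -(size_tuple t) et !size_cat.
  pose w : r.-tuple letter := Tuple (introT eqP sw).
  rewrite -[_ ++ _]/(tval w) weval_tuple; apply: (dual_elt_content hy).
  apply/negP => /permP /(_ (pred1 a)); move: at_ as_; rewrite et /s.
  rewrite -!has_pred1 !has_count /= /unzip2 !map_cat /= !count_cat /= eqxx.
  rewrite [b == a]eq_sym (negPf nab); clear; lia.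
have -> : rsum a b z (weval y) t =
    q ^- kap * (tval t == s)%:R * rsum a b z (fun u => ((i, a) \in u)%:R) t.
  rewrite -rsumZ; apply: eq_rsum_split => t1 j t2 et.
  rewrite et in at_ pt *; rewrite term //; last by rewrite -et size_tuple.
  rewrite -mulrA -natrM mulnb andbC; congr (_ * (_ && _)%:R).
  move: at_; rewrite /unzip2 map_cat mem_cat inE /= !negb_or => /and3P [a1 _ a2].
  rewrite mem_cat inE (negPf (notin_col i a1)) (negPf (notin_col i a2)) orbF xpair_eqE eqxx andbT.
  by rewrite eq_sym.
have [->|_] := eqVneq (tval t) s; last by rewrite mulr0 mul0r !mulr0.
rewrite mulr1 mulVf // mulf_neq0 ?(tv_coef_neq0 heps hl) // mulf_neq0 ?invr_eq0 ?expf_neq0 //.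
apply: rsum_mem => //; rewrite sl andbT -has_count has_pred1 mem_cat mem_head orbT //.
Qed.

Lemma dual_exists (s : seq letter) : size s = r -> sorted cle s ->
  (forall x, (count_mem x s < l)%N) -> exists y, dual_elt y s.
Proof.
have tr := @cle_trans n.
pose f (x : letter) := val x.2.
have fE t : map val (unzip2 t) = map f t by rewrite -map_comp.
have [m] := ubnP (disp 0 (map f s)); elim: m s => // m IH s; rewrite ltnS => hm sz ss sl.
have sf : size (map f s) = r by rewrite size_map.
have sortf : sorted leq (map f s).
  rewrite (sorted_pairwise leq_trans) pairwise_map.
  move: ss; rewrite (sorted_pairwise tr); apply: sub_pairwise => -[? ?] [? ?] /=.
  by rewrite /cle /f -!val_eqE /=; clear; lia.
have [es|ns] := eqVneq (map f s) (iota 0 (size (map f s))).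
  apply: dual_elt_omega => //; suff -> : unzip2 s = womega hr by [].
  by apply: (inj_map val_inj); rewrite val_womega fE es sf.
have [||c1 [B [c2 [A [ec aN hd hab]]]]] := @sorted_move n.+1 (map f s) sortf _ _ ns.
- by rewrite sf.
- by rewrite all_map; apply/allP => x _; exact: ltn_ord.
have [s1 [[i b] [s2 [es e1 eb e2]]]] := map_eq_cat ec.
pose a := Ordinal aN.
have hcase : (a = b.+1 :> nat /\ all (fun x : letter => x.2 <= b)%N s1 /\ all (fun x : letter => a < x.2)%N s2) \/
  (b = a.+1 :> nat /\ all (fun x : letter => x.2 < a)%N s1 /\ all (fun x : letter => b <= x.2)%N s2).
  by move: hab; rewrite -e1 -e2 -eb /f !all_map.
have ps : pairwise cle (s1 ++ (i, b) :: s2) by rewrite -es -(sorted_pairwise tr).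
have ab : a != b by rewrite -val_eqE /=; case: hcase => -[/= -> _]; clear; lia.
have a1 : a \notin unzip2 s1.
  apply/negP => /mapP [x xs ex]; case: hcase => -[e [/allP /(_ _ xs) h _]]; move: e h; rewrite ex; clear; lia.
have a2 : a \notin unzip2 s2.
  apply/negP => /mapP [x xs ex]; case: hcase => -[e [_ /allP /(_ _ xs) h]]; move: e h; rewrite ex; clear; lia.
have [|||| y hy] := IH (s1 ++ (i, a) :: s2).
- by apply: leq_trans hm; rewrite map_cat /= e1 e2.
- by rewrite -sz es !size_cat.
- by rewrite (sorted_pairwise tr); apply: pairwise_move ps hcase.
- move=> x; have := sl x; rewrite es !count_cat /=.
  have [<-|_] := eqVneq (i, a) x; last by clear; lia.
  by rewrite (count_memPn (notin_col i a1)) (count_memPn (notin_col i a2)) => _; move: hl; clear; lia.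
move: ss sl; rewrite es => ss sl; apply: (@dual_move a b i s1 s2 y) => //.
by rewrite /unzip2 map_cat mem_cat inE /= !negb_or a1 ab.
Qed.

(** x is the sum of the dual elements of the [good] words with coefficients x(s). Both sides agree
    on sorted words: in a sorted word that is not good, l equal letters are consecutive, and x
    vanishes there. *)
Lemma vanishing_in_ideal (x : wdual) : in_qschur eps x ->
  (forall u i j v, weval x (u ++ nseq l (i, j) ++ v) = 0) -> in_ideal eps x.
Proof.
move=> hx x0.
pose good (s : r.-tuple letter) := sorted cle s && [forall y, count_mem y s < l]%N.
have /choice [Y hY] : forall s, exists y, good s -> dual_elt y s.
  move=> s; have [/andP [ss /forallP sl]|] := boolP (good s); last by exists 0.
  by have [y hy] := dual_exists (size_tuple s) ss sl; exists y.
have hsum : in_ideal eps (\sum_(s | good s) x s *: Y s).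
  elim/big_rec: _ => [|s y hs hy]; first exact: in_ideal0.
  by apply: in_ideal_lin hy; case: (hY s hs).
suff -> : x = \sum_(s | good s) x s *: Y s by [].
apply/eqP; rewrite -subr_eq0; apply/eqP; apply: (in_qschur_eq0 eps0).
  exact: in_qschurB hx (in_ideal_qschur heps hl hsum).
move=> A /size_monomial hA; pose t : r.-tuple letter := Tuple (introT eqP hA).
have st : sorted cle t := sorted_monomial A.
rewrite -[monomial A]/(tval t) wevalB !weval_tuple sum_ffunE.
have -> : \sum_(s | good s) (x s *: Y s) t = \sum_(s | good s) x s * (t == s)%:R.
  by apply: eq_bigr => s hs; rewrite ffunE; have [_ ->] := hY s hs.
have [gt|ngt] := boolP (good t).
  rewrite (bigD1 t) //= eqxx mulr1 big1 ?addr0 ?subrr // => s /andP [_ nst].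
  by rewrite eq_sym (negPf nst) mulr0.
rewrite big1 => [|s hs]; last first.
  by case: (eqVneq t s) => [e|_]; [rewrite -e (negPf ngt) in hs | rewrite mulr0].
move: ngt; rewrite /good st /= negb_forall => /existsP [[i j]]; rewrite -leqNgt => hc.
have [|U [V [et _ _]]] := @sorted_block n (i, j) t; first by rewrite -(sorted_pairwise (@cle_trans n)).
rewrite subr0 -weval_tuple et -(subnKC hc) nseqD -catA; exact: x0.
Qed.
End DualBasis.

(** * The kernel of the Schur functor and the kernel of the transfer map *)

Section SchurKernel.
Variables (k : fieldType) (A : algType k) (e : Defs.idempotent A).
Variable P : K0 A -> Prop.
Hypotheses (P0 : P 0) (PB : forall x y, P x -> P y -> P (x - y)).
Hypothesis Pkill : forall C : fdmod A, mact C (ival e) = 0 -> P (K0_class C).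

Definition mem_P : {pred K0 A} := fun x => `[< P x >].
Fact mem_P_zmod_closed : zmod_closed mem_P.
Proof.
by split=> [|x y /asboolP hx /asboolP hy]; apply/asboolP; [exact: P0 | exact: PB].
Qed.
HB.instance Definition _ := GRing.isZmodClosed.Build _ mem_P mem_P_zmod_closed.

Lemma K0_schur_kerP : finite_dim A -> forall x, K0_schur e x = 0 -> P x.
Proof.
move=> fd x hx; have := @K0_schur_ker k A e mem_P _ fd x hx.
by move=> h; apply/asboolP/h => C hC; apply/asboolP/Pkill.
Qed.
End SchurKernel.

Lemma ideal_gen_kills (k : fieldType) (A : algType k) (e x : A) (C : fdmod A) :
  ideal_gen e x -> mact C e = 0 -> mact C x = 0.
Proof.
move=> hx he; elim: hx => [//|c y z _ hy _ hz|a y _ hy|a y _ hy].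
- by rewrite linearP /= hy hz scaler0 addr0.
- by rewrite mactM hy mulmx0.
- by rewrite mactM hy mul0mx.
Qed.

Section Final.
Variables (k : fieldType) (l n r : nat) (eps : k).
Hypotheses (heps : l.-primitive_root eps) (hl : (3 <= l)%N) (hodd : odd l) (hr : (r <= n.+1)%N).
Let eps0 : eps != 0 := prim_neq0 hl heps.

Lemma lqschur_finite_dim : finite_dim (lqschur eps n r).
Proof.
pose E : vectType k := {ffun r.-tuple (letter n) -> k^o}.
have [||N [g [f [g_lin f_lin Pg gK fK]]]] := @subspace_coord k E (fun x => little eps (x : wdual k n r)).
- by have /asboolP := @rpred0 _ (little_pred eps (n := n) (r := r)).
- by move=> c x y hx hy; apply: little_lin.
exists N, (fun x => f (val x)), (fun v => in_lqschur (Pg v)); split.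
- by move=> c x y; rewrite -f_lin.
- by move=> c x y; apply: val_inj; rewrite /= g_lin.
- by move=> x; apply: val_inj; rewrite /= fK //; apply/asboolP/(valP x).
- exact: gK.
Qed.

Lemma in_ideal_val (x : lqschur eps n r) : in_ideal eps (val x) -> ideal_gen (komega eps n r) x.
Proof. by case=> y hy /val_inj <-. Qed.

Lemma ideal_full : (r < l)%N -> ideal_gen (komega eps n r) 1.
Proof.
move=> rl; apply: in_ideal_val; apply: (vanishing_in_ideal heps hl hodd hr).
  exact: (little_in_qschur eps0 (little_1 eps n r)).
move=> u i j v; apply: weval_size; rewrite !size_cat size_nseq.
by move: rl; clear; lia.
Qed.

Section LargeDegree.
Hypothesis rl : (l <= r)%N.
Variable rho : {lrmorphism lqschur eps n r -> lqschur eps n (r - l)}.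
Hypothesis hrho : baby_transfer rho.

Lemma transfer_ker_ideal x : rho x = 0 -> ideal_gen (komega eps n r) x.
Proof.
move=> hx; apply: in_ideal_val; apply: (vanishing_in_ideal heps hl hodd hr).
  by apply: (little_in_qschur eps0); apply/asboolP/(valP x).
move=> u i j v; rewrite (transfer_power heps hl hodd rl hrho) hx.
rewrite [X in _ * X](_ : _ = 0) ?mulr0 //.
by rewrite /weval; case: insubP => // w _ _; rewrite ffunE.
Qed.

(** By [transfer_power] its value at w is that of k_omega at c_00^l w, whose row letters are not
    distinct. *)
Lemma transfer_komega : rho (komega eps n r) = 0.
Proof.
apply: val_inj; apply/ffunP => w; rewrite -weval_tuple.
have := transfer_power heps hl hodd rl hrho (komega eps n r) [::] ord0 ord0 w.
rewrite eqxx mul1r => <-.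
have sz : size (nseq l (ord0, ord0) ++ w : seq (letter n)) = r.
  by rewrite size_cat size_nseq size_tuple subnKC.
pose t : r.-tuple (letter n) := Tuple (introT eqP sz).
rewrite -[_ ++ _]/(tval t) weval_tuple (val_komega_perm heps hl hr) ffunE.
rewrite (_ : perm_eq (rows t) _ = false) ?mulr0 ?ffunE //.
apply/negP => /perm_uniq; rewrite uniq_womega.
rewrite -[tval (rows t)]/(map fst (nseq l (ord0, ord0) ++ w)) map_cat map_nseq cat_uniq /=.
have nu m : (3 <= m)%N -> uniq (nseq m (ord0 : 'I_n.+1)) = false.
  by case: m => [|[|m]] //= _; rewrite inE eqxx.
by rewrite nu.
Qed.
End LargeDegree.
End Final.

(** Injectivity of inflation is part of the conclusion, since it is what makes K of the smaller
    algebra a subgroup. *)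
Theorem proposition6p3 (k : fieldType) (p l n r : nat) (eps : k)
    (hp : p \in [pchar k]) (heps : l.-primitive_root eps)
    (hl : (3 <= l)%N) (hodd : odd l) (hr : (r <= n.+1)%N) :
  let F : {additive K0 (lqschur eps n r) -> K0 (hecke hl heps hr)} :=
    baby_schur_K0 hl heps hr in
  [/\ forall y, exists x, F x = y,
      (r < l)%N -> forall x, F x = 0 <-> x = 0
    & (l <= r)%N ->
      forall rho : {lrmorphism lqschur eps n r -> lqschur eps n (r - l)},
        baby_transfer rho ->
        injective (K0_infl rho) /\
        forall x, F x = 0 <-> exists y, x = K0_infl rho y].
Proof.
have fd := lqschur_finite_dim n r eps.
move=> F; split; first exact: K0_schur_surj fd.
- move=> rl x; split=> [|->]; last by rewrite raddf0.
  apply: (@K0_schur_kerP k _ (komega_idem hl heps hr) (fun x => x = 0)) => //.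
    by move=> y z -> ->; rewrite subr0.
  move=> C hC; apply: K0_class0.
  (* The identity lies in AeA, so it acts by 0 on a module killed by e, which is therefore zero. *)
  have := ideal_gen_kills (ideal_full heps hl hodd hr rl) hC; rewrite mact1.
  case: (mdim C) => // d /matrixP /(_ ord0 ord0); rewrite !mxE eqxx => /eqP.
  by rewrite oner_eq0.
- move=> lr rho hrho; have sur := transfer_surj heps hl hrho.
  split; first exact: K0_infl_inj sur.
  have F_infl y : F (K0_infl rho y) = 0.
    elim/K0_ind: y => [|y z hy hz|X]; first by rewrite !raddf0.
      by rewrite !raddfB hy hz subr0.
    rewrite K0_infl_class K0_schur_class K0_class0 //=.
    by rewrite (transfer_komega heps hl hodd hr lr hrho) linear0 mxrank0.
  move=> x; split=> [|[y ->]]; last exact: F_infl.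
  apply: (@K0_schur_kerP k _ (komega_idem hl heps hr) (fun x => exists y, x = K0_infl rho y)) => //.
  - by exists 0; rewrite raddf0.
  - by move=> _ _ [y ->] [z ->]; exists (y - z); rewrite raddfB.
  (* A module killed by e is killed by AeA, which contains ker rho, and is therefore inflated. *)
  move=> C hC; have [|X hX] := deflate sur (V := C).
    move=> a ha; apply: ideal_gen_kills hC.
    exact: (transfer_ker_ideal heps hl hodd hr lr hrho).
  by exists (K0_class X); rewrite K0_infl_class; apply/esym/K0_isom.
Qed.
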